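(* For all $a,b\in\mathbb{C}$, $$\int_{\mathbb{R}}\mathrm{e}^{-t^2}\Bigl\{\mathrm{Ai}\bigl(2at-a[a^3+2b^3]\bigr)\mathrm{Bi}\bigl(2bt-b[2a^3+b^3]\bigr)+\mathrm{Ai}\bigl(2bt-b[2a^3+b^3]\bigr)\mathrm{Bi}\bigl(2at-a[a^3+2b^3]\bigr)\Bigr\}\,\mathrm{d}t$$ $$=\frac{2}{12^{1/3}}\exp\Bigl(-\frac{(a^3+b^3)^2}{3}\Bigr)\biggl\{\frac{1}{\Gamma(\frac56)}\,{}_0F_1\Bigl(\tfrac56\,\Big|\,\tfrac49(ab)^6\Bigr)-\frac{2ab}{12^{1/3}\,\Gamma(\frac76)}\,{}_0F_1\Bigl(\tfrac76\,\Big|\,\tfrac49(ab)^6\Bigr)\biggr\}.$$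
   Context: $\mathrm{Ai},\mathrm{Bi}$ are the Airy functions (entire functions of a complex variable), and ${}_0F_1(c\,|\,w)=\sum_{n\ge0}\frac{w^n}{(c)_n\,n!}$ with $(c)_n=c(c+1)\cdots(c+n-1)$. *)

(* Defs.v *)
From Stdlib Require Import Factorial Reals.
From Coquelicot Require Import Coquelicot.

Local Open Scope C_scope.

Definition Cexp (z : C) : C := (exp (Re z) * cos (Im z), exp (Re z) * sin (Im z))%R.

(* The sum of a convergent series of complex numbers, selected as [RInt_gen]
   selects the value of an integral; meaningless if the series diverges. *)
Definition CSeries (u : nat -> C) : C :=
  iota (@is_series R_AbsRing C_R_CompleteNormedModule u).

Fixpoint pochhammer (c : C) (n : nat) : C :=
  match n with
  | O => 1
  | S m => pochhammer c m * (c + INR m)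
  end.

Definition hyp0F1 (c w : C) : C :=
  CSeries (fun n => w ^ n / (pochhammer c n * INR (fact n))).

(* Euler's integral; it converges for x > 0, the only case used. *)
Definition Gamma (x : R) : R :=
  RInt_gen (fun t : R => Rpower t (x - 1) * exp (- t))%R
    (at_right 0) (Rbar_locally p_infty).

(* The solutions of y'' = z y with (y(0), y'(0)) = (1, 0) and (0, 1), given by
   their everywhere convergent Maclaurin series
     airy_f z = 1 + 1/3! z^3 + 1.4/6! z^6 + 1.4.7/9! z^9 + ...
     airy_g z = z + 2/4! z^4 + 2.5/7! z^7 + 2.5.8/10! z^10 + ...
   (Abramowitz and Stegun, 10.4.3). *)
Definition airy_f (z : C) : C :=
  CSeries (fun k => 3 ^ k * pochhammer (1 / 3) k
                    * z ^ (3 * k) / INR (fact (3 * k))).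

Definition airy_g (z : C) : C :=
  CSeries (fun k => 3 ^ k * pochhammer (2 / 3) k
                    * z ^ (3 * k + 1) / INR (fact (3 * k + 1))).

(* Ai(0) and - Ai'(0). *)
Definition airy_c1 : R := (Rpower 3 (- (2 / 3)) / Gamma (2 / 3))%R.
Definition airy_c2 : R := (Rpower 3 (- (1 / 3)) / Gamma (1 / 3))%R.

(* Abramowitz and Stegun, 10.4.2 and 10.4.3. *)
Definition Ai (z : C) : C := airy_c1 * airy_f z - airy_c2 * airy_g z.
Definition Bi (z : C) : C := sqrt 3 * (airy_c1 * airy_f z + airy_c2 * airy_g z).

(* The integral of f over the real line exists, as an absolutely convergent
   improper Riemann integral, and equals l.  For continuous f this is the
   Lebesgue integral. *)
Definition is_integral_R (f : R -> C) (l : C) : Prop :=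
  ex_RInt_gen (V := R_NormedModule) (fun t => Cmod (f t))
    (Rbar_locally m_infty) (Rbar_locally p_infty) /\
  is_RInt_gen (V := C_R_NormedModule) f
    (Rbar_locally m_infty) (Rbar_locally p_infty) l.

(* Main.v *)
(* In Ai(u)Bi(v) + Ai(v)Bi(u) the mixed products of the two Maclaurin solutions
   f, g of y'' = z y cancel, leaving a combination of f(u)f(v) and g(u)g(v).
   Scale (a, b) to (s a, s b). Modulo exact t-derivatives, the integrals of
   exp(-t^2) U(u)U(v) and of one companion combination of U, U' satisfy a 2x2
   linear system in s. Up to the factor exp(-s^6 (a^3+b^3)^2 / 3) and in the
   variable p = s^2 a b it is the equation h'' = 16 p^4 h, whose solutions are
   0F1(5/6 | 4p^6/9) and p 0F1(7/6 | 4p^6/9). On a finite interval [l, r] the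
   system has boundary terms that are O(1/(1+l^2) + 1/(1+r^2)) uniformly in s,
   so Gronwall's inequality compares the truncated integral with the exact
   solution, and no improper integral is ever differentiated.
   The constants reduce to relations between Gamma(k/6): the asymptotics
   Gamma(n+z) ~ n^z Gamma(n) give the duplication and triplication formulas up
   to a constant, and these two formulas together determine what is needed. *)

Require Import Defs.
From Stdlib Require Import Reals Lra Lia Factorial.
From Coquelicot Require Import Coquelicot.

Local Open Scope C_scope.

(** * Complex-valued functions of real variables *)

(** The deformation starts at s = 0 because both arguments vanish there: even a truncated integral
    is then exactly a constant times the truncated Gaussian integral. Multiplying the exact solution
    by that truncated Gaussian makes the comparison error start at zero, so only boundary terms feed
    it. The four products of U, U' at u with U, U' at v are stable under differentiation in s and in
    t because U'' = z U; hence each differential identity becomes a polynomial identity once the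
    four values are abstracted. All special functions involved are built by polynomials from 0F1 at
    a multiple of a power of the variable: one Taylor remainder estimate yields their derivatives
    and continuity, one contiguity relation their differential equations, one bound their growth.
    The Gaussian integral stays in the form Gamma(1/2), and the constants of the multiplication
    formulas are compared with each other instead of being evaluated. *)

Ltac Cparts := unfold Re, Im, Cconj, Cminus, Cplus, Cmult, Copp, RtoC; simpl.

Lemma im_le_Cmod (z : C) : (Rabs (Im z) <= Cmod z)%R.
Proof.
  eapply Rle_trans; [apply (Rmax_r (Rabs (fst z))) | apply Rmax_Cmod].
Qed.

Lemma Cmod_sqr (z : C) : (Cmod z * Cmod z = Re z * Re z + Im z * Im z)%R.
Proof. pose proof (Cmod2_alt z). simpl in H. lra. Qed.

Lemma Cmod_le_Re_Im (z : C) : (Cmod z <= Rabs (Re z) + Rabs (Im z))%R.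
Proof.
  pose proof (Rabs_pos (Re z)). pose proof (Rabs_pos (Im z)).
  apply Rsqr_incr_0_var; [| lra].
  unfold Rsqr. rewrite Cmod_sqr.
  rewrite (Rsqr_abs (Re z) : Re z * Re z = _)%R, (Rsqr_abs (Im z) : Im z * Im z = _)%R.
  unfold Rsqr. nra.
Qed.

Lemma Re_Im_dot_le (z w : C) : (Re z * Re w + Im z * Im w <= Cmod z * Cmod w)%R.
Proof.
  replace (Re z * Re w + Im z * Im w)%R with (Re (Cconj z * w)) by (Cparts; ring).
  rewrite <- (Cmod_conj z), <- Cmod_mult.
  eapply Rle_trans; [apply Rle_abs | apply re_le_Cmod].
Qed.

(** Componentwise, so that the real theorems on derivatives and integrals apply to each part;
    [is_Cderive_elim] and [is_Cderive_intro] restate it as one estimate of a modulus. *)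
Definition is_Cderive (f : R -> C) (x : R) (l : C) : Prop :=
  is_derive (fun t => Re (f t)) x (Re l) /\ is_derive (fun t => Im (f t)) x (Im l).

Lemma is_derive_elim (f : R -> R) (x l : R) : is_derive f x l ->
  forall eps, (0 < eps)%R -> exists delta, (0 < delta)%R /\
    forall y, (Rabs (y - x) < delta -> Rabs (f y - f x - (y - x) * l) <= eps * Rabs (y - x))%R.
Proof.
  intros H eps He. apply is_derive_Reals in H.
  destruct (H eps He) as [d Hd]. exists d. split; [apply cond_pos|].
  intros y Hy. destruct (Req_dec (y - x) 0) as [E|E].
  - replace y with x by lra. replace (f x - f x - (x - x) * l)%R with 0%R by ring.
    rewrite Rabs_R0. replace (x - x)%R with 0%R by ring. rewrite Rabs_R0. lra.
  - specialize (Hd (y - x)%R E Hy). replace (x + (y - x))%R with y in Hd by ring.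
    replace (f y - f x - (y - x) * l)%R with (((f y - f x) / (y - x) - l) * (y - x))%R by (field; exact E).
    rewrite Rabs_mult. apply Rmult_le_compat_r; [apply Rabs_pos | lra].
Qed.

Lemma is_derive_intro (f : R -> R) (x l : R) :
  (forall eps, (0 < eps)%R -> exists delta, (0 < delta)%R /\
    forall y, (Rabs (y - x) < delta -> Rabs (f y - f x - (y - x) * l) <= eps * Rabs (y - x))%R) ->
  is_derive f x l.
Proof.
  intros H. apply is_derive_Reals. intros eps He.
  destruct (H (eps / 2)%R) as [d [Hd H']]; [lra|].
  exists (mkposreal d Hd). intros h Hh Hlt. simpl in Hlt.
  specialize (H' (x + h)%R). replace (x + h - x)%R with h in H' by ring.
  specialize (H' Hlt).
  replace ((f (x + h) - f x) / h - l)%R with ((f (x + h) - f x - h * l) / h)%R by (field; exact Hh).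
  unfold Rdiv at 1. rewrite Rabs_mult, Rabs_inv.
  assert (0 < Rabs h)%R by (apply Rabs_pos_lt; exact Hh).
  apply Rle_lt_trans with (eps / 2)%R; [|lra].
  apply Rmult_le_reg_r with (Rabs h); [assumption|].
  rewrite Rmult_assoc, Rinv_l, Rmult_1_r by lra. exact H'.
Qed.

Lemma is_Cderive_elim (f : R -> C) (x : R) (l : C) : is_Cderive f x l ->
  forall eps, (0 < eps)%R -> exists delta, (0 < delta)%R /\
    forall y, (Rabs (y - x) < delta -> Cmod (f y - f x - RtoC (y - x) * l) <= eps * Rabs (y - x))%R.
Proof.
  intros [Hr Hi] eps He.
  destruct (is_derive_elim _ _ _ Hr (eps / 2)%R) as [d1 [Hd1 H1]]; [lra|].
  destruct (is_derive_elim _ _ _ Hi (eps / 2)%R) as [d2 [Hd2 H2]]; [lra|].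
  exists (Rmin d1 d2). split; [apply Rmin_pos; assumption|].
  intros y Hy. specialize (H1 y). specialize (H2 y).
  pose proof (Rmin_l d1 d2). pose proof (Rmin_r d1 d2).
  specialize (H1 ltac:(lra)). specialize (H2 ltac:(lra)).
  eapply Rle_trans; [apply Cmod_le_Re_Im|].
  replace (Re (f y - f x - RtoC (y - x) * l)) with (Re (f y) - Re (f x) - (y - x) * Re l)%R by (Cparts; ring).
  replace (Im (f y - f x - RtoC (y - x) * l)) with (Im (f y) - Im (f x) - (y - x) * Im l)%R by (Cparts; ring).
  lra.
Qed.

Lemma is_Cderive_intro (f : R -> C) (x : R) (l : C) :
  (forall eps, (0 < eps)%R -> exists delta, (0 < delta)%R /\
    forall y, (Rabs (y - x) < delta -> Cmod (f y - f x - RtoC (y - x) * l) <= eps * Rabs (y - x))%R) ->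
  is_Cderive f x l.
Proof.
  intros H; split; apply is_derive_intro; intros eps He;
    destruct (H eps He) as [d [Hd H']]; exists d; split; try exact Hd;
    intros y Hy; eapply Rle_trans; try (apply (H' y Hy)).
  - replace (Re (f y) - Re (f x) - (y - x) * Re l)%R with (Re (f y - f x - RtoC (y - x) * l)) by (Cparts; ring).
    apply re_le_Cmod.
  - replace (Im (f y) - Im (f x) - (y - x) * Im l)%R with (Im (f y - f x - RtoC (y - x) * l)) by (Cparts; ring).
    apply im_le_Cmod.
Qed.

Lemma is_Cderive_eq (f : R -> C) (x : R) (l l' : C) :
  is_Cderive f x l -> l = l' -> is_Cderive f x l'.
Proof. intros H <-; exact H. Qed.

Lemma is_Cderive_ext (f g : R -> C) (x : R) (l : C) :
  (forall t, f t = g t) -> is_Cderive f x l -> is_Cderive g x l.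
Proof.
  intros E [H1 H2]; split.
  - apply is_derive_ext with (2 := H1). intros t; now rewrite E.
  - apply is_derive_ext with (2 := H2). intros t; now rewrite E.
Qed.

Lemma is_Cderive_const (c : C) (x : R) : is_Cderive (fun _ => c) x 0.
Proof. split; apply (is_derive_const (V := R_NormedModule)). Qed.

Lemma is_Cderive_RtoC (f : R -> R) (x l : R) :
  is_derive f x l -> is_Cderive (fun t => RtoC (f t)) x (RtoC l).
Proof. intros H; split; [exact H | exact (is_derive_const (V := R_NormedModule) 0%R x)]. Qed.

Lemma is_Cderive_id (x : R) : is_Cderive (fun t => RtoC t) x 1.
Proof. apply (is_Cderive_RtoC (fun t => t)). apply (is_derive_id (K := R_AbsRing)). Qed.

Lemma is_Cderive_plus (f g : R -> C) (x : R) (lf lg : C) :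
  is_Cderive f x lf -> is_Cderive g x lg -> is_Cderive (fun t => f t + g t) x (lf + lg).
Proof.
  intros [H1 H2] [H3 H4]; split.
  - apply (is_derive_plus (V := R_NormedModule) _ _ _ _ _ H1 H3).
  - apply (is_derive_plus (V := R_NormedModule) _ _ _ _ _ H2 H4).
Qed.

Lemma is_Cderive_opp (f : R -> C) (x : R) (lf : C) :
  is_Cderive f x lf -> is_Cderive (fun t => - f t) x (- lf).
Proof.
  intros [H1 H2]; split.
  - apply (is_derive_opp (V := R_NormedModule) _ _ _ H1).
  - apply (is_derive_opp (V := R_NormedModule) _ _ _ H2).
Qed.

Lemma is_Cderive_minus (f g : R -> C) (x : R) (lf lg : C) :
  is_Cderive f x lf -> is_Cderive g x lg -> is_Cderive (fun t => f t - g t) x (lf - lg).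
Proof. intros Hf Hg. apply is_Cderive_plus; [| apply is_Cderive_opp]; assumption. Qed.

Lemma is_Cderive_mult (f g : R -> C) (x : R) (lf lg : C) :
  is_Cderive f x lf -> is_Cderive g x lg -> is_Cderive (fun t => f t * g t) x (lf * g x + f x * lg).
Proof.
  intros [H1 H2] [H3 H4]; split; simpl.
  - evar_last.
    apply (is_derive_minus (V := R_NormedModule)
      (fun t => fst (f t) * fst (g t))%R (fun t => snd (f t) * snd (g t))%R);
      (apply (is_derive_mult (K := R_AbsRing)); [eassumption | eassumption | exact Rmult_comm]).
    unfold minus, plus, opp, mult; simpl. unfold Re, Im. ring.
  - evar_last.
    apply (is_derive_plus (V := R_NormedModule)
      (fun t => fst (f t) * snd (g t))%R (fun t => snd (f t) * fst (g t))%R);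
      (apply (is_derive_mult (K := R_AbsRing)); [eassumption | eassumption | exact Rmult_comm]).
    unfold minus, plus, opp, mult; simpl. unfold Re, Im. ring.
Qed.

Lemma is_Cderive_pow (f : R -> C) (x : R) (lf : C) (n : nat) :
  is_Cderive f x lf -> is_Cderive (fun t => f t ^ S n) x (INR (S n) * f x ^ n * lf).
Proof.
  intros Hf. induction n as [|n IH].
  - eapply is_Cderive_eq; [eapply is_Cderive_ext; [|exact Hf] |].
    + intros t. cbn [Cpow]. ring.
    + cbn [Cpow INR]. ring.
  - eapply is_Cderive_eq; [apply (is_Cderive_mult _ (fun t => f t ^ S n) _ _ _ Hf IH) |].
    rewrite (S_INR (S n)), RtoC_plus. change (f x ^ S n) with (f x * f x ^ n). ring.
Qed.

(** Complex differentiability is stated as the chain rule along differentiable real curves, the form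
    in which it is used: composition is immediate, and all derivatives are taken in a real variable
    s or t. *)
Definition holo (F F' : C -> C) : Prop :=
  forall (g : R -> C) (x : R) (l : C),
    is_Cderive g x l -> is_Cderive (fun t => F (g t)) x (F' (g x) * l).

Lemma holo_eq (F F' G' : C -> C) : holo F F' -> (forall z, F' z = G' z) -> holo F G'.
Proof. intros H E g x l Hg. rewrite <- E. apply H, Hg. Qed.

(** With h = g y - g x the error splits into the quadratic remainder of F, of size O(|y - x|^2)
    because g is Lipschitz at x, and the first-order error of g multiplied by F'. For a power series
    the quadratic remainder can be bounded termwise. *)
Lemma holo_of_quadratic_remainder (F F' : C -> C) :
  (forall z, exists K, forall h, (Cmod h <= 1)%R ->
     (Cmod (F (z + h)%C - F z - h * F' z) <= K * (Cmod h * Cmod h))%R) -> holo F F'.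
Proof.
  intros H g x l Hg. apply is_Cderive_intro. intros eps He.
  destruct (H (g x)) as [K HK].
  (* The added 1 keeps the majorants [A], [L] and [K'] positive, so that the tolerances below may be
     divided by them. *)
  set (A := (Cmod (F' (g x)) + 1)%R). set (L := (Cmod l + 1)%R).
  assert (HA : (0 < A)%R) by (unfold A; pose proof (Cmod_ge_0 (F' (g x))); lra).
  assert (HL : (0 < L)%R) by (unfold L; pose proof (Cmod_ge_0 l); lra).
  set (K' := (Rabs K + 1)%R).
  assert (HK' : (0 < K')%R) by (unfold K'; pose proof (Rabs_pos K); lra).
  destruct (is_Cderive_elim _ _ _ Hg (Rmin 1 (eps / (2 * A)))%R) as [d [Hd H1]].
  { apply Rmin_pos; [lra|]. apply Rdiv_lt_0_compat; lra. }
  exists (Rmin d (Rmin (1 / L) (eps / (2 * K' * L * L)))). split.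
  { repeat apply Rmin_pos; try assumption; apply Rdiv_lt_0_compat; try lra.
    repeat apply Rmult_lt_0_compat; lra. }
  intros y Hy.
  assert (Hy1 : (Rabs (y - x) < d)%R) by (eapply Rlt_le_trans; [exact Hy | apply Rmin_l]).
  assert (Hy2 : (Rabs (y - x) < 1 / L)%R).
  { eapply Rlt_le_trans; [exact Hy|]. eapply Rle_trans; [apply Rmin_r | apply Rmin_l]. }
  assert (Hy3 : (Rabs (y - x) < eps / (2 * K' * L * L))%R).
  { eapply Rlt_le_trans; [exact Hy|]. eapply Rle_trans; [apply Rmin_r | apply Rmin_r]. }
  specialize (H1 y Hy1).
  set (D := Rabs (y - x)) in *. assert (HD : (0 <= D)%R) by apply Rabs_pos.
  set (h := g y - g x). set (r := g y - g x - RtoC (y - x) * l) in *.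
  assert (Hr1 : (Cmod r <= D)%R).
  { eapply Rle_trans; [exact H1|]. pose proof (Rmin_l 1 (eps / (2 * A))). nra. }
  assert (Hr2 : (Cmod r <= eps / (2 * A) * D)%R).
  { eapply Rle_trans; [exact H1|]. pose proof (Rmin_r 1 (eps / (2 * A))). nra. }
  assert (Hh : (Cmod h <= L * D)%R).
  { replace h with (r + RtoC (y - x) * l) by (unfold r, h; ring).
    eapply Rle_trans; [apply Cmod_triangle|]. rewrite Cmod_mult, Cmod_R.
    fold D. unfold L. lra. }
  assert (Hh1 : (L * D <= 1)%R).
  { apply Rlt_le in Hy2. apply (Rmult_le_compat_l L) in Hy2; [|lra].
    replace (L * (1 / L))%R with 1%R in Hy2 by (field; lra). exact Hy2. }
  specialize (HK h ltac:(lra)).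
  replace (g x + h) with (g y) in HK by (unfold h; ring).
  replace (F (g y) - F (g x) - RtoC (y - x) * (F' (g x) * l))
    with ((F (g y) - F (g x) - h * F' (g x)) + r * F' (g x)) by (unfold r, h; ring).
  eapply Rle_trans; [apply Cmod_triangle|]. rewrite Cmod_mult.
  assert (HB1 : (Cmod r * Cmod (F' (g x)) <= eps / 2 * D)%R).
  { apply Rle_trans with (eps / (2 * A) * D * A)%R.
    - apply Rmult_le_compat; try apply Cmod_ge_0; [exact Hr2 | unfold A; lra].
    - right. field. lra. }
  assert (HB2 : (K * (Cmod h * Cmod h) <= eps / 2 * D)%R).
  { apply Rle_trans with (K' * ((L * D) * (L * D)))%R.
    - apply Rle_trans with (K' * (Cmod h * Cmod h))%R.
      + apply Rmult_le_compat_r; [apply Rmult_le_pos; apply Cmod_ge_0|].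
        unfold K'. pose proof (Rle_abs K). lra.
      + apply Rmult_le_compat_l; [lra|]. apply Rmult_le_compat; try apply Cmod_ge_0; exact Hh.
    - replace (K' * (L * D * (L * D)))%R with ((K' * L * L * D) * D)%R by ring.
      apply Rmult_le_compat_r; [exact HD|].
      apply Rle_trans with (K' * L * L * (eps / (2 * K' * L * L)))%R; [| right; field; lra].
      apply Rmult_le_compat_l; [|lra]. apply Rlt_le. repeat apply Rmult_lt_0_compat; lra. }
  lra.
Qed.

Lemma holo_id : holo (fun z => z) (fun _ => 1).
Proof. intros g x l H. eapply is_Cderive_eq; [exact H | ring]. Qed.

Lemma holo_const (c : C) : holo (fun _ => c) (fun _ => 0).
Proof. intros g x l H. eapply is_Cderive_eq; [apply is_Cderive_const | ring]. Qed.

Lemma holo_mult (F F' G G' : C -> C) :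
  holo F F' -> holo G G' -> holo (fun z => F z * G z) (fun z => F' z * G z + F z * G' z).
Proof.
  intros HF HG g x l H. eapply is_Cderive_eq; [apply is_Cderive_mult; [apply HF, H | apply HG, H]|].
  cbv beta. ring.
Qed.

Lemma holo_pow (n : nat) : holo (fun z => z ^ S n) (fun z => INR (S n) * z ^ n).
Proof. intros g x l H. apply is_Cderive_pow, H. Qed.

Lemma holo_comp (F F' G G' : C -> C) :
  holo F F' -> holo G G' -> holo (fun z => F (G z)) (fun z => F' (G z) * G' z).
Proof.
  intros HF HG g x l H. eapply is_Cderive_eq; [apply (HF (fun t => G (g t))), HG, H|].
  ring.
Qed.

(** * Joint continuity in the deformation parameter and the integration variable *)

Definition Ccontinuous2 (f : R -> R -> C) (s t : R) : Prop :=
  continuity_2d_pt (fun s t => Re (f s t)) s t /\ continuity_2d_pt (fun s t => Im (f s t)) s t.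

Lemma Ccontinuous2_const (c : C) s t : Ccontinuous2 (fun _ _ => c) s t.
Proof. split; apply continuity_2d_pt_const. Qed.

Lemma Ccontinuous2_fst s t : Ccontinuous2 (fun s _ => RtoC s) s t.
Proof. split; [apply continuity_2d_pt_id1 | exact (continuity_2d_pt_const s t 0%R)]. Qed.

Lemma Ccontinuous2_snd s t : Ccontinuous2 (fun _ t => RtoC t) s t.
Proof. split; [apply continuity_2d_pt_id2 | exact (continuity_2d_pt_const s t 0%R)]. Qed.

Lemma Ccontinuous2_RtoC (f : R -> R -> R) s t :
  continuity_2d_pt f s t -> Ccontinuous2 (fun s t => RtoC (f s t)) s t.
Proof. split; [assumption | exact (continuity_2d_pt_const s t 0%R)]. Qed.

Lemma Ccontinuous2_plus f g s t :
  Ccontinuous2 f s t -> Ccontinuous2 g s t -> Ccontinuous2 (fun s t => f s t + g s t) s t.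
Proof. intros [H1 H2] [H3 H4]; split; apply continuity_2d_pt_plus; assumption. Qed.

Lemma Ccontinuous2_opp f s t :
  Ccontinuous2 f s t -> Ccontinuous2 (fun s t => - f s t) s t.
Proof. intros [H1 H2]; split; apply continuity_2d_pt_opp; assumption. Qed.

Lemma Ccontinuous2_minus f g s t :
  Ccontinuous2 f s t -> Ccontinuous2 g s t -> Ccontinuous2 (fun s t => f s t - g s t) s t.
Proof. intros Hf Hg; apply Ccontinuous2_plus; [|apply Ccontinuous2_opp]; assumption. Qed.

Lemma Ccontinuous2_mult f g s t :
  Ccontinuous2 f s t -> Ccontinuous2 g s t -> Ccontinuous2 (fun s t => f s t * g s t) s t.
Proof.
  intros [H1 H2] [H3 H4]; split.
  - apply continuity_2d_pt_minus; apply continuity_2d_pt_mult; assumption.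
  - apply continuity_2d_pt_plus; apply continuity_2d_pt_mult; assumption.
Qed.

Lemma Ccontinuous2_pow f n s t :
  Ccontinuous2 f s t -> Ccontinuous2 (fun s t => f s t ^ n) s t.
Proof.
  intros H. induction n as [|n IH]; [exact (Ccontinuous2_const 1 s t)|].
  apply (Ccontinuous2_mult _ _ _ _ H IH).
Qed.

(** A Lipschitz bound centred at each point, with its own constant: the quadratic remainder of a
    power series gives it directly, and it makes compositions continuous. *)
Definition locally_lipschitz (F : C -> C) : Prop :=
  forall z, exists K, forall h, (Cmod h <= 1)%R -> (Cmod (F (z + h)%C - F z) <= K * Cmod h)%R.

Lemma Ccontinuous2_comp (F : C -> C) f s t :
  locally_lipschitz F -> Ccontinuous2 f s t -> Ccontinuous2 (fun s t => F (f s t)) s t.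
Proof.
  intros HF [H1 H2]. destruct (HF (f s t)) as [K HK].
  set (K' := (Rabs K + 1)%R).
  assert (HK' : (0 < K')%R) by (unfold K'; pose proof (Rabs_pos K); lra).
  assert (HC : forall eps : posreal, locally_2d (fun x y => (Cmod (F (f x y) - F (f s t)) < eps)%R) s t).
  { intros eps.
    (* The bound 1/2 on each component keeps |h| at most 1, where the Lipschitz estimate holds; the
       other bound makes K' |h| smaller than [eps]. *)
    assert (He : (0 < Rmin (1/2) (eps / (2 * K')))%R).
    { apply Rmin_pos; [lra|]. apply Rdiv_lt_0_compat; [apply cond_pos | lra]. }
    destruct (H1 (mkposreal _ He)) as [d1 Hd1]. destruct (H2 (mkposreal _ He)) as [d2 Hd2].
    simpl in Hd1, Hd2.
    assert (Hd : (0 < Rmin d1 d2)%R) by (apply Rmin_pos; apply cond_pos).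
    exists (mkposreal _ Hd). simpl. intros x y Hx Hy.
    pose proof (Rmin_l d1 d2). pose proof (Rmin_r d1 d2).
    specialize (Hd1 x y ltac:(lra) ltac:(lra)). specialize (Hd2 x y ltac:(lra) ltac:(lra)).
    set (e := (eps / (2 * K'))%R) in *.
    pose proof (Rmin_l (1/2) e). pose proof (Rmin_r (1/2) e).
    set (h := f x y - f s t).
    assert (Hh : (Cmod h < 2 * Rmin (1/2) e)%R).
    { eapply Rle_lt_trans; [apply Cmod_le_Re_Im|].
      replace (Re h) with (Re (f x y) - Re (f s t))%R by (Cparts; ring).
      replace (Im h) with (Im (f x y) - Im (f s t))%R by (Cparts; ring). lra. }
    specialize (HK h ltac:(lra)).
    replace (f s t + h) with (f x y) in HK by (unfold h; ring).
    eapply Rle_lt_trans; [exact HK|].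
    apply Rle_lt_trans with (K' * Cmod h)%R.
    { apply Rmult_le_compat_r; [apply Cmod_ge_0|]. unfold K'. pose proof (Rle_abs K). lra. }
    apply Rlt_le_trans with (K' * (2 * e))%R.
    { apply Rmult_lt_compat_l; lra. }
    right. unfold e. field. lra. }
  split; intros eps; destruct (HC eps) as [d Hd]; exists d; intros x y Hx Hy;
    specialize (Hd x y Hx Hy); (eapply Rle_lt_trans; [|exact Hd]).
  - apply (re_le_Cmod (F (f x y) - F (f s t))).
  - apply (im_le_Cmod (F (f x y) - F (f s t))).
Qed.

(** * Series of complex numbers *)

Definition is_Cseries (u : nat -> C) (l : C) : Prop :=
  is_series (fun n => Re (u n)) (Re l) /\ is_series (fun n => Im (u n)) (Im l).

Lemma is_series_of_is_Cseries (u : nat -> C) (l : C) :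
  is_Cseries u l -> @is_series R_AbsRing C_R_NormedModule u l.
Proof.
  intros [H1 H2]. unfold is_series in *.
  assert (E : forall n, sum_n (G := C_R_NormedModule) u n
     = (sum_n (fun n => Re (u n)) n, sum_n (fun n => Im (u n)) n)).
  { intros n; induction n as [|n IH].
    - rewrite !sum_O. destruct (u 0%nat); reflexivity.
    - rewrite !sum_Sn, IH. reflexivity. }
  apply filterlim_ext with (fun n => (sum_n (fun n => Re (u n)) n, sum_n (fun n => Im (u n)) n)).
  { intros n; symmetry; apply E. }
  destruct l as [l1 l2]. simpl in H1, H2.
  intros P [eps HP].
  generalize (H1 _ (locally_ball l1 eps)) (H2 _ (locally_ball l2 eps)).
  unfold filtermap.
  intros A B. generalize (filter_and _ _ A B). apply filter_imp.
  intros n [Ha Hb]. apply HP. split; assumption.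
Qed.

Lemma CSeries_unique (u : nat -> C) (l : C) : is_Cseries u l -> CSeries u = l.
Proof.
  intros H. apply is_series_of_is_Cseries in H.
  exact (iota_filterlim_locally (V := C_R_CompleteNormedModule) (F := eventually) _ _ H).
Qed.

Lemma is_Cseries_ext (u v : nat -> C) (l : C) :
  (forall n, u n = v n) -> is_Cseries u l -> is_Cseries v l.
Proof.
  intros E [H1 H2]; split; [apply is_series_ext with (2 := H1) | apply is_series_ext with (2 := H2)];
    intros n; now rewrite E.
Qed.

Lemma is_Cseries_plus (u v : nat -> C) (l m : C) :
  is_Cseries u l -> is_Cseries v m -> is_Cseries (fun n => u n + v n) (l + m).
Proof.
  intros [H1 H2] [H3 H4]; split.
  - exact (is_series_plus _ _ _ _ H1 H3).
  - exact (is_series_plus _ _ _ _ H2 H4).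
Qed.

Lemma is_Cseries_scal (c : C) (u : nat -> C) (l : C) :
  is_Cseries u l -> is_Cseries (fun n => c * u n) (c * l).
Proof.
  intros [H1 H2]; split.
  - exact (is_series_minus _ _ _ _ (is_series_scal (K := R_AbsRing) (V := R_NormedModule) (Re c) _ _ H1)
             (is_series_scal (K := R_AbsRing) (V := R_NormedModule) (Im c) _ _ H2)).
  - exact (is_series_plus _ _ _ _ (is_series_scal (K := R_AbsRing) (V := R_NormedModule) (Re c) _ _ H2)
             (is_series_scal (K := R_AbsRing) (V := R_NormedModule) (Im c) _ _ H1)).
Qed.

Lemma is_Cseries_minus (u v : nat -> C) (l m : C) :
  is_Cseries u l -> is_Cseries v m -> is_Cseries (fun n => u n - v n) (l - m).
Proof.
  intros H1 H2.
  pose proof (is_Cseries_plus _ _ _ _ H1 (is_Cseries_scal (-(1)) _ _ H2)) as H.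
  replace (l - m) with (l + - (1) * m) by ring.
  apply is_Cseries_ext with (2 := H). intros n; ring.
Qed.

Lemma is_Cseries_decr_1 (u : nat -> C) (l : C) :
  is_Cseries (fun n => u (S n)) l -> is_Cseries u (u 0%nat + l).
Proof.
  intros [H1 H2]; split.
  - apply is_series_decr_1.
    replace (plus _ _) with (Re l); [exact H1 | unfold plus, opp; Cparts; ring].
  - apply is_series_decr_1.
    replace (plus _ _) with (Im l); [exact H2 | unfold plus, opp; Cparts; ring].
Qed.

Lemma ex_Cseries_le (u : nat -> C) (b : nat -> R) :
  (forall n, Cmod (u n) <= b n)%R -> ex_series b -> exists l, is_Cseries u l.
Proof.
  intros H Hb.
  assert (H1 : ex_series (fun n => Re (u n))).
  { apply (ex_series_le (V := R_CompleteNormedModule)) with (2 := Hb). intros n.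
    eapply Rle_trans; [apply re_le_Cmod | apply H]. }
  assert (H2 : ex_series (fun n => Im (u n))).
  { apply (ex_series_le (V := R_CompleteNormedModule)) with (2 := Hb). intros n.
    eapply Rle_trans; [apply im_le_Cmod | apply H]. }
  destruct H1 as [x Hx], H2 as [y Hy]. exists (x, y). split; assumption.
Qed.

Lemma is_series_le (u v : nat -> R) (l m : R) :
  (forall n, u n <= v n)%R -> is_series u l -> is_series v m -> (l <= m)%R.
Proof.
  intros H Hu Hv.
  apply (is_lim_seq_le (sum_n u) (sum_n v) l m); [| exact Hu | exact Hv].
  intros n. apply sum_n_m_le, H.
Qed.

Lemma is_series_term_le (a : nat -> R) (l : R) (n : nat) :
  is_series a l -> (forall k, 0 <= a k)%R -> (a n <= l)%R.
Proof.
  intros H Ha. apply Rle_trans with (sum_n a n).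
  - destruct n as [|n]; [rewrite sum_O; lra|]. rewrite sum_Sn.
    assert (0 <= sum_n a n)%R; [|unfold plus; simpl; lra].
    clear -Ha. induction n as [|n IH]; [rewrite sum_O; apply Ha|].
    rewrite sum_Sn. unfold plus; simpl. pose proof (Ha (S n)). lra.
  - apply (is_lim_seq_incr_compare (sum_n a)); [exact H|]. intros k.
    rewrite sum_Sn. unfold plus; simpl. pose proof (Ha (S k)). lra.
Qed.

Lemma Cmod_is_Cseries_le (u : nat -> C) (b : nat -> R) (l : C) (B : R) :
  (forall n, Cmod (u n) <= b n)%R -> is_Cseries u l -> is_series b B -> (Cmod l <= B)%R.
Proof.
  intros H [H1 H2] Hb.
  (* the scalar product with [l] reduces the estimate to a real series *)
  assert (Hs : (Cmod l * Cmod l <= Cmod l * B)%R).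
  { rewrite Cmod_sqr at 1.
    apply is_series_le with (u := fun n => (Re l * Re (u n) + Im l * Im (u n))%R)
                            (v := fun n => (Cmod l * b n)%R).
    - intros n. eapply Rle_trans; [apply Re_Im_dot_le|].
      apply Rmult_le_compat_l; [apply Cmod_ge_0 | apply H].
    - exact (is_series_plus _ _ _ _ (is_series_scal (K := R_AbsRing) (V := R_NormedModule) (Re l) _ _ H1)
             (is_series_scal (K := R_AbsRing) (V := R_NormedModule) (Im l) _ _ H2)).
    - exact (is_series_scal (K := R_AbsRing) (V := R_NormedModule) (Cmod l) _ _ Hb). }
  pose proof (Cmod_ge_0 l).
  destruct (Req_dec (Cmod l) 0) as [E|E].
  - rewrite E. assert (0 <= B)%R; [|lra].
    apply is_series_le with (u := fun _ => 0%R) (v := b); [| | exact Hb].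
    + intros n. eapply Rle_trans; [apply Cmod_ge_0 | apply H].
    + pose proof (is_series_scal (K := R_AbsRing) (V := R_NormedModule) 0%R _ _ Hb) as Hz.
      unfold scal in Hz; simpl in Hz; unfold mult in Hz; simpl in Hz. rewrite Rmult_0_l in Hz.
      apply is_series_ext with (2 := Hz). intros n. exact (Rmult_0_l (b n)).
  - apply Rmult_le_reg_l with (Cmod l); lra.
Qed.

Lemma is_series_exp (x : R) : is_series (fun n => x ^ n / INR (fact n))%R (exp x).
Proof.
  pose proof (is_exp_Reals x) as H.
  apply is_series_ext with (2 := H). intros n.
  unfold scal; simpl; unfold mult; simpl. rewrite pow_n_pow. reflexivity.
Qed.

(** * The series 0F1: convergence, contiguity, Taylor remainder, growth *)

Fixpoint rpoch (c : R) (n : nat) : R :=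
  match n with O => 1 | S m => rpoch c m * (c + INR m) end%R.

Definition coef0F1 (c : R) (n : nat) : R := (/ (rpoch c n * INR (fact n)))%R.

Lemma pochhammer_RtoC (c : R) (n : nat) : pochhammer (RtoC c) n = RtoC (rpoch c n).
Proof.
  induction n as [|n IH]; [reflexivity|].
  simpl. rewrite IH, <- RtoC_plus, <- RtoC_mult. reflexivity.
Qed.

Lemma rpoch_pos (c : R) (n : nat) : (0 < c)%R -> (0 < rpoch c n)%R.
Proof.
  intros Hc. induction n as [|n IH]; simpl; [lra|].
  apply Rmult_lt_0_compat; [exact IH|]. pose proof (pos_INR n). lra.
Qed.

Lemma rpoch_shift (c : R) (n : nat) : (rpoch c (S n) = c * rpoch (c + 1) n)%R.
Proof.
  induction n as [|n IH]; [simpl; ring|].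
  change (rpoch c (S (S n))) with (rpoch c (S n) * (c + INR (S n)))%R.
  rewrite IH, S_INR. simpl. ring.
Qed.

(** For c at least 1/2 the inequality k + 1 <= 2 (c + k) holds factor by factor. This gives
    coefficient bounds uniform in c; all parameters that occur are at least 2/3. *)
Lemma rpoch_lower (c : R) (n : nat) : (/ 2 <= c)%R -> (INR (fact n) <= 2 ^ n * rpoch c n)%R.
Proof.
  intros Hc. induction n as [|n IH]; [simpl; lra|].
  rewrite fact_simpl, mult_INR, S_INR. simpl. pose proof (pos_INR n).
  pose proof (pos_INR (fact n)).
  replace (2 * 2 ^ n * (rpoch c n * (c + INR n)))%R with ((2 ^ n * rpoch c n) * (2 * (c + INR n)))%R by ring.
  rewrite Rmult_comm. apply Rmult_le_compat; lra.
Qed.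

Lemma coef0F1_pos (c : R) (n : nat) : (0 < c)%R -> (0 < coef0F1 c n)%R.
Proof.
  intros Hc. apply Rinv_0_lt_compat, Rmult_lt_0_compat; [apply rpoch_pos, Hc | apply INR_fact_lt_0].
Qed.

Lemma coef0F1_le (c : R) (n : nat) : (/ 2 <= c)%R ->
  (coef0F1 c n <= 2 ^ n / (INR (fact n) * INR (fact n)))%R.
Proof.
  intros Hc. unfold coef0F1.
  pose proof (rpoch_lower c n Hc). pose proof (INR_fact_lt_0 n). pose proof (rpoch_pos c n ltac:(lra)).
  assert (0 < 2 ^ n)%R by (apply pow_lt; lra).
  replace (2 ^ n / (INR (fact n) * INR (fact n)))%R
    with (/ (INR (fact n) / 2 ^ n * INR (fact n)))%R by (field; lra).
  apply Rinv_le_contravar.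
  - apply Rmult_lt_0_compat; [apply Rdiv_lt_0_compat|]; lra.
  - apply Rmult_le_compat_r; [lra|]. apply Rle_div_l; lra.
Qed.

Lemma coef0F1_le_fact (c : R) (n : nat) : (/ 2 <= c)%R ->
  (coef0F1 c n <= 2 ^ n / INR (fact n))%R.
Proof.
  intros Hc. eapply Rle_trans; [apply coef0F1_le, Hc|].
  pose proof (INR_fact_lt_0 n). assert (0 < 2 ^ n)%R by (apply pow_lt; lra).
  assert (1 <= INR (fact n))%R.
  { change 1%R with (INR 1). apply le_INR. pose proof (lt_O_fact n). lia. }
  apply Rmult_le_compat_l; [lra|]. apply Rinv_le_contravar; [lra|]. nra.
Qed.

Definition y0F1 (c : R) (w : C) : C := hyp0F1 (RtoC c) w.

Lemma Cmod_term0F1 (c : R) (w : C) (n : nat) : (/ 2 <= c)%R ->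
  (Cmod (w ^ n * RtoC (coef0F1 c n)) = Cmod w ^ n * coef0F1 c n)%R.
Proof.
  intros Hc. rewrite Cmod_mult, Cmod_pow, Cmod_R, Rabs_pos_eq; [reflexivity|].
  apply Rlt_le, coef0F1_pos; lra.
Qed.

Lemma is_Cseries_0F1 (c : R) (w : C) : (/ 2 <= c)%R ->
  is_Cseries (fun n => w ^ n * RtoC (coef0F1 c n)) (y0F1 c w).
Proof.
  intros Hc.
  destruct (ex_Cseries_le (fun n => w ^ n * RtoC (coef0F1 c n))
              (fun n => (2 * Cmod w) ^ n / INR (fact n))%R) as [l Hl].
  - intros n. rewrite Cmod_term0F1 by exact Hc. rewrite Rpow_mult_distr.
    replace (2 ^ n * Cmod w ^ n / INR (fact n))%R with (Cmod w ^ n * (2 ^ n / INR (fact n)))%R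
      by (field; apply INR_fact_neq_0).
    apply Rmult_le_compat_l; [apply pow_le, Cmod_ge_0 | apply coef0F1_le_fact, Hc].
  - eexists; apply is_series_exp.
  - replace (y0F1 c w) with l; [exact Hl|]. symmetry. unfold y0F1, hyp0F1.
    apply CSeries_unique. apply is_Cseries_ext with (2 := Hl). intros n.
    rewrite pochhammer_RtoC, <- RtoC_mult. unfold coef0F1. rewrite RtoC_inv; [reflexivity|].
    apply Rmult_integral_contrapositive; split; [|apply INR_fact_neq_0].
    pose proof (rpoch_pos c n ltac:(lra)). lra.
Qed.

Lemma y0F1_0 (c : R) : (/ 2 <= c)%R -> y0F1 c 0 = 1.
Proof.
  intros Hc. pose proof (is_Cseries_0F1 c 0 Hc) as H.
  unfold y0F1, hyp0F1. apply CSeries_unique.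
  (* All terms after the first vanish. Their series is obtained as 0 times a convergent one, which
     explains the value 1 + 0 * 0. *)
  replace (RtoC 1) with (1 + 0 * 0) by ring.
  eapply is_Cseries_ext; [| apply (is_Cseries_decr_1 (fun n => match n with O => RtoC 1 | S _ => 0 * 0 end))].
  - intros [|n].
    + simpl. field.
    + simpl. unfold Cdiv. ring.
  - pose proof (is_Cseries_scal 0 _ _ H) as H0. 
    replace (0 * 0) with (0 * y0F1 c 0) by ring.
    apply is_Cseries_ext with (2 := H0). intros n. ring.
Qed.

Lemma coef0F1_shift (c : R) (n : nat) : (0 < c)%R ->
  (INR (S n) * coef0F1 c (S n) = coef0F1 (c + 1) n / c)%R.
Proof.
  intros Hc. unfold coef0F1. rewrite rpoch_shift, fact_simpl, mult_INR.
  pose proof (rpoch_pos (c + 1) n ltac:(lra)). pose proof (INR_fact_neq_0 n).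
  pose proof (pos_INR n). rewrite S_INR. field. repeat split; lra.
Qed.

(** Differentiation raises the parameter by one, so a second derivative involves the parameters c +
    1 and c + 2. This relation links them back to c and so takes the place of the differential
    equation of 0F1. On coefficients it is the identity (c + n)/c - 1 = n/c. *)
Lemma y0F1_contiguous (c : R) (w : C) : (/ 2 <= c)%R ->
  y0F1 c w = y0F1 (c + 1) w + w * RtoC (/ (c * (c + 1))) * y0F1 (c + 1 + 1) w.
Proof.
  intros Hc. apply CSeries_unique.
  pose proof (is_Cseries_0F1 (c + 1) w ltac:(lra)) as H1.
  pose proof (is_Cseries_scal (w * RtoC (/ (c * (c + 1)))) _ _ (is_Cseries_0F1 (c + 1 + 1) w ltac:(lra))) as H2.
  set (v := fun n => match n with O => RtoC 0 | S n => w * RtoC (/ (c * (c + 1))) * (w ^ n * RtoC (coef0F1 (c + 1 + 1) n)) end).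
  assert (H3 : is_Cseries v (w * RtoC (/ (c * (c + 1))) * y0F1 (c + 1 + 1) w)).
  { replace (w * RtoC (/ (c * (c + 1))) * y0F1 (c + 1 + 1) w) with (v 0%nat + w * RtoC (/ (c * (c + 1))) * y0F1 (c + 1 + 1) w) by (simpl; ring).
    apply (is_Cseries_decr_1 v). exact H2. }
  pose proof (is_Cseries_plus _ _ _ _ H1 H3) as H4.
  apply is_Cseries_ext with (2 := H4). intros n. unfold v.
  assert (E : w ^ n / (pochhammer c n * INR (fact n)) = w ^ n * RtoC (coef0F1 c n)).
  { rewrite pochhammer_RtoC, <- RtoC_mult. unfold coef0F1. rewrite RtoC_inv; [reflexivity|].
    apply Rmult_integral_contrapositive; split; [|apply INR_fact_neq_0].
    pose proof (rpoch_pos c n ltac:(lra)). lra. }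
  rewrite E. destruct n as [|n].
  - unfold coef0F1. simpl. ring.
  - replace (w * RtoC (/ (c * (c + 1))) * (w ^ n * RtoC (coef0F1 (c + 1 + 1) n)))
      with (w ^ S n * RtoC (/ (c * (c + 1)) * coef0F1 (c + 1 + 1) n)) by (rewrite RtoC_mult; simpl; ring).
    rewrite <- Cmult_plus_distr_l, <- RtoC_plus. do 2 f_equal.
    unfold coef0F1. rewrite (rpoch_shift c), (rpoch_shift (c + 1)).
    assert (E2 : (rpoch (c + 1) (S n) = rpoch (c + 1) n * (c + 1 + INR n))%R) by reflexivity.
    rewrite (rpoch_shift (c + 1)) in E2.
    assert (E3 : (rpoch (c + 1) n = (c + 1) * rpoch (c + 1 + 1) n / (c + 1 + INR n))%R).
    { rewrite E2. pose proof (pos_INR n). field. lra. }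
    rewrite E3, fact_simpl, mult_INR, S_INR.
    pose proof (rpoch_pos (c + 1 + 1) n ltac:(lra)). pose proof (INR_fact_neq_0 n).
    pose proof (pos_INR n). field. repeat split; lra.
Qed.

(** Induction through the recursion R' = (z + h) R + m h^2 z^n, where R and R' are the remainders
    for the exponents m = n + 1 and m + 1. The growth of the bound is covered by m^2 + m <= (m +
    1)^2, and r >= 1 absorbs the missing powers of r. *)
Lemma Cpow_quadratic_remainder (z h : C) (r : R) (n : nat) :
  (1 <= r)%R -> (Cmod z + Cmod h <= r)%R ->
  (Cmod ((z + h) ^ S n - z ^ S n - INR (S n) * h * z ^ n)
     <= Cmod h * Cmod h * (INR (S n) * INR (S n) * r ^ S n))%R.
Proof.
  intros Hr Hzh. pose proof (Cmod_ge_0 z). pose proof (Cmod_ge_0 h).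
  induction n as [|n IH].
  - replace ((z + h) ^ 1 - z ^ 1 - INR 1 * h * z ^ 0) with (RtoC 0) by (simpl; ring).
    rewrite Cmod_0. simpl. apply Rmult_le_pos; [nra|]. lra.
  - set (Rn := (z + h) ^ S n - z ^ S n - INR (S n) * h * z ^ n) in *.
    replace ((z + h) ^ S (S n) - z ^ S (S n) - INR (S (S n)) * h * z ^ S n)
      with ((z + h) * Rn + INR (S n) * (h * h) * z ^ n).
    2:{ unfold Rn. rewrite (S_INR (S n)), RtoC_plus. simpl Cpow. ring. }
    eapply Rle_trans; [apply Cmod_triangle|].
    rewrite !Cmod_mult, Cmod_pow, Cmod_R, (Rabs_pos_eq _ (pos_INR _)).
    assert (H1 : (Cmod z ^ n <= r ^ S (S n))%R).
    { apply Rle_trans with (r ^ n)%R; [apply pow_incr; lra|]. apply Rle_pow; [exact Hr | lia]. }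
    assert (H2 : (Cmod (z + h) <= r)%R) by (eapply Rle_trans; [apply Cmod_triangle | exact Hzh]).
    set (m := INR (S n)) in *. assert (Hm : (0 <= m)%R) by apply pos_INR.
    set (q := (Cmod h * Cmod h)%R) in *. assert (Hq : (0 <= q)%R) by (unfold q; nra).
    assert (A1 : (Cmod (z + h) * Cmod Rn <= q * (m * m * r ^ S (S n)))%R).
    { apply Rle_trans with (r * (q * (m * m * r ^ S n)))%R.
      - apply Rmult_le_compat; try apply Cmod_ge_0; assumption.
      - right. simpl. ring. }
    assert (A2 : (m * q * Cmod z ^ n <= q * (m * r ^ S (S n)))%R).
    { replace (q * (m * r ^ S (S n)))%R with (m * q * r ^ S (S n))%R by ring.
      apply Rmult_le_compat_l; [nra | exact H1]. }
    rewrite (S_INR (S n)). fold m.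
    assert (0 <= r ^ S (S n))%R by (apply pow_le; lra).
    assert (0 <= q * r ^ S (S n))%R by (apply Rmult_le_pos; assumption).
    replace (q * ((m + 1) * (m + 1) * r ^ S (S n)))%R
      with (q * (m * m * r ^ S (S n)) + q * (m * r ^ S (S n)) + m * (q * r ^ S (S n)) + q * r ^ S (S n))%R by ring.
    nra.
Qed.

Lemma INR_sqr_le_pow4 (n : nat) : (INR n * INR n <= 4 ^ n)%R.
Proof.
  assert (H : (INR n <= 2 ^ n)%R).
  { induction n as [|n IH]; [simpl; lra|]. rewrite S_INR. simpl.
    assert (1 <= 2 ^ n)%R by (apply pow_R1_Rle; lra). lra. }
  replace 4%R with (2 * 2)%R by ring. rewrite Rpow_mult_distr.
  pose proof (pos_INR n). apply Rmult_le_compat; lra.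
Qed.

(** The single estimate behind both [holo_y0F1] and [locally_lipschitz_y0F1]. Termwise, n^2 <= 4^n
    and the coefficient bound 2^n / n! combine with r^n to (8 r)^n / n!, whose sum is the
    exponential. *)
Lemma y0F1_quadratic_remainder (c : R) (z h : C) : (/ 2 <= c)%R -> (Cmod h <= 1)%R ->
  (Cmod (y0F1 c (z + h) - y0F1 c z - h * (RtoC (/ c) * y0F1 (c + 1) z))
     <= exp (8 * (Cmod z + 1)) * (Cmod h * Cmod h))%R.
Proof.
  intros Hc Hh. set (r := (Cmod z + 1)%R).
  assert (Hr : (1 <= r)%R) by (unfold r; pose proof (Cmod_ge_0 z); lra).
  (* The derivative series is shifted by one and given a zero constant term, so that it lines up
     with the other two series term by term. *)
  set (d := fun n => match n with O => RtoC 0 | S n => h * (RtoC (/ c) * (z ^ n * RtoC (coef0F1 (c + 1) n))) end).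
  assert (Hd : is_Cseries d (h * (RtoC (/ c) * y0F1 (c + 1) z))).
  { replace (h * (RtoC (/ c) * y0F1 (c + 1) z)) with (d 0%nat + h * (RtoC (/ c) * y0F1 (c + 1) z)) by (simpl; ring).
    apply (is_Cseries_decr_1 d). simpl. do 2 apply is_Cseries_scal. apply is_Cseries_0F1. lra. }
  eapply (Cmod_is_Cseries_le _ (fun n => (Cmod h * Cmod h * ((8 * r) ^ n / INR (fact n)))%R)).
  2:{ apply is_Cseries_minus; [apply is_Cseries_minus | exact Hd]; apply is_Cseries_0F1; exact Hc. }
  2:{ rewrite (Rmult_comm (exp _)). exact (is_series_scal (K := R_AbsRing) (V := R_NormedModule) (Cmod h * Cmod h)%R _ _ (is_series_exp (8 * r))). }
  intros n. cbv beta. destruct n as [|n].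
  - simpl. replace (1 * RtoC (coef0F1 c 0) - 1 * RtoC (coef0F1 c 0) - 0) with (RtoC 0) by ring.
    rewrite Cmod_0. pose proof (Cmod_ge_0 h). apply Rmult_le_pos; [nra | lra].
  - unfold d. cbv beta iota.
    replace ((z + h) ^ S n * RtoC (coef0F1 c (S n)) - z ^ S n * RtoC (coef0F1 c (S n))
       - h * (RtoC (/ c) * (z ^ n * RtoC (coef0F1 (c + 1) n))))
      with (((z + h) ^ S n - z ^ S n - INR (S n) * h * z ^ n) * RtoC (coef0F1 c (S n))).
    2:{ replace (RtoC (/ c) * (z ^ n * RtoC (coef0F1 (c + 1) n))) with (z ^ n * RtoC (coef0F1 (c + 1) n / c))
          by (unfold Rdiv; rewrite RtoC_mult; ring).
        rewrite <- coef0F1_shift, RtoC_mult by lra. ring. }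
    rewrite Cmod_mult, Cmod_R, Rabs_pos_eq by (apply Rlt_le, coef0F1_pos; lra).
    assert (Hrem := Cpow_quadratic_remainder z h r n Hr ltac:(unfold r; lra)).
    apply Rle_trans with (Cmod h * Cmod h * (INR (S n) * INR (S n) * r ^ S n) * (2 ^ S n / INR (fact (S n))))%R.
    { apply Rmult_le_compat; [apply Cmod_ge_0 | apply Rlt_le, coef0F1_pos; lra | exact Hrem | apply coef0F1_le_fact, Hc]. }
    rewrite !Rmult_assoc. apply Rmult_le_compat_l; [apply Cmod_ge_0|]. apply Rmult_le_compat_l; [apply Cmod_ge_0|].
    pose proof (INR_sqr_le_pow4 (S n)) as H4.
    replace ((8 * r) ^ S n / INR (fact (S n)))%R with (4 ^ S n * (r ^ S n * (2 ^ S n / INR (fact (S n)))))%R.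
    2:{ replace (8 * r)%R with (4 * (r * 2))%R by ring. rewrite !Rpow_mult_distr. unfold Rdiv. ring. }
    rewrite <- Rmult_assoc. apply Rmult_le_compat_r; [|exact H4].
    apply Rmult_le_pos; [apply pow_le; lra|]. apply Rmult_le_pos; [apply pow_le; lra|].
    apply Rlt_le, Rinv_0_lt_compat, INR_fact_lt_0.
Qed.

Lemma holo_y0F1 (c : R) : (/ 2 <= c)%R -> holo (y0F1 c) (fun z => RtoC (/ c) * y0F1 (c + 1) z).
Proof.
  intros Hc. apply holo_of_quadratic_remainder. intros z. eexists. intros h Hh.
  apply y0F1_quadratic_remainder; assumption.
Qed.

Lemma locally_lipschitz_y0F1 (c : R) : (/ 2 <= c)%R -> locally_lipschitz (y0F1 c).
Proof.
  intros Hc z. exists (exp (8 * (Cmod z + 1)) + Cmod (RtoC (/ c) * y0F1 (c + 1) z))%R. intros h Hh.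
  pose proof (y0F1_quadratic_remainder c z h Hc Hh) as H.
  set (D := RtoC (/ c) * y0F1 (c + 1) z) in *. set (E := exp (8 * (Cmod z + 1))) in *.
  replace (y0F1 c (z + h) - y0F1 c z) with ((y0F1 c (z + h) - y0F1 c z - h * D) + h * D) by ring.
  eapply Rle_trans; [apply Cmod_triangle|]. rewrite Cmod_mult.
  assert (0 < E)%R by apply exp_pos. pose proof (Cmod_ge_0 h).
  assert (E * (Cmod h * Cmod h) <= E * Cmod h)%R by (apply Rmult_le_compat_l; nra).
  lra.
Qed.

(* Uses q^(2n) / n!^2 <= e^q * q^n / n! *)
Lemma y0F1_growth (c : R) (w : C) (q : R) : (/ 2 <= c)%R -> (0 <= q)%R -> (2 * Cmod w <= q * q)%R ->
  (Cmod (y0F1 c w) <= exp (2 * q))%R.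
Proof.
  intros Hc Hq Hw.
  replace (2 * q)%R with (q + q)%R by ring. rewrite exp_plus.
  eapply (Cmod_is_Cseries_le _ (fun n => (exp q * (q ^ n / INR (fact n)))%R)).
  2:{ apply is_Cseries_0F1, Hc. }
  2:{ exact (is_series_scal (K := R_AbsRing) (V := R_NormedModule) (exp q) _ _ (is_series_exp q)). }
  intros n. cbv beta. rewrite Cmod_term0F1 by exact Hc.
  pose proof (INR_fact_lt_0 n).
  assert (Hn : (0 <= q ^ n / INR (fact n))%R).
  { apply Rmult_le_pos; [apply pow_le, Hq | apply Rlt_le, Rinv_0_lt_compat; assumption]. }
  assert (Hle : (q ^ n / INR (fact n) <= exp q)%R).
  { apply (is_series_term_le (fun k => q ^ k / INR (fact k))%R _ n (is_series_exp q)). intros k.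
    apply Rmult_le_pos; [apply pow_le, Hq | apply Rlt_le, Rinv_0_lt_compat, INR_fact_lt_0]. }
  apply Rle_trans with ((q ^ n / INR (fact n)) * (q ^ n / INR (fact n)))%R.
  2:{ apply Rmult_le_compat_r; assumption. }
  apply Rle_trans with (Cmod w ^ n * (2 ^ n / (INR (fact n) * INR (fact n))))%R.
  { apply Rmult_le_compat_l; [apply pow_le, Cmod_ge_0 | apply coef0F1_le, Hc]. }
  replace (Cmod w ^ n * (2 ^ n / (INR (fact n) * INR (fact n))))%R
    with ((2 * Cmod w) ^ n / (INR (fact n) * INR (fact n)))%R by (rewrite Rpow_mult_distr; field; lra).
  replace (q ^ n / INR (fact n) * (q ^ n / INR (fact n)))%R
    with ((q * q) ^ n / (INR (fact n) * INR (fact n)))%R by (rewrite Rpow_mult_distr; field; lra).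
  apply Rmult_le_compat_r.
  - apply Rlt_le, Rinv_0_lt_compat. nra.
  - apply pow_incr. split; [|exact Hw]. pose proof (Cmod_ge_0 w). lra.
Qed.

(** * Values of the Gamma function at multiples of 1/6 *)

Local Open Scope R_scope.

(** Integrals of a nonnegative function grow with the interval, so their supremum is the improper
    integral. The convex set [P] is the domain of integration; this form covers the open half-line,
    the closed half-line and the whole line at once. *)
Lemma ex_RInt_gen_bounded (Fa Fb : (R -> Prop) -> Prop) (P : R -> Prop) (f : R -> R) (M : R) :
  Filter Fa -> Filter Fb ->
  (forall x y z, P x -> P z -> x <= y <= z -> P y) -> (exists c, P c) ->
  (forall c, P c -> Fa (fun x => P x /\ x <= c)) ->
  (forall c, P c -> Fb (fun x => P x /\ c <= x)) ->
  (forall x, P x -> 0 <= f x) -> (forall x, P x -> continuous f x) ->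
  (forall a b, P a -> P b -> a <= b -> RInt f a b <= M) ->
  ex_RInt_gen f Fa Fb.
Proof.
  intros FFa FFb Hconv [c0 Hc0] HFa HFb Hpos Hcont HM.
  assert (Hex : forall a b, P a -> P b -> a <= b -> ex_RInt f a b).
  { intros a b Ha Hb Hab. apply (ex_RInt_continuous (V := R_CompleteNormedModule)). intros z.
    rewrite Rmin_left, Rmax_right by exact Hab. intros Hz. apply Hcont, (Hconv a z b); assumption. }
  destruct (completeness (fun v => exists a b, P a /\ P b /\ a <= b /\ v = RInt f a b)) as [L [HL1 HL2]].
  - exists M. intros v (a & b & Ha & Hb & Hab & ->). apply HM; assumption.
  - exists (RInt f c0 c0), c0, c0. repeat split; try assumption. lra.
  - exists L. intros Q [eps HQ].
    assert (Hs : exists a b, P a /\ P b /\ a <= b /\ L - eps < RInt f a b).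
    { apply Classical_Prop.NNPP. intros Hn.
      assert (L <= L - eps); [|pose proof (cond_pos eps); lra].
      apply HL2. intros v (a & b & Ha & Hb & Hab & ->).
      apply Rnot_lt_le. intros Hlt. apply Hn. exists a, b. auto. }
    destruct Hs as (a & b & Ha & Hb & Hab & Hlt).
    apply (Filter_prod _ _ _ _ _ (HFa a Ha) (HFb b Hb)).
    intros x y [Hx Hxa] [Hy Hby]. exists (RInt f x y). simpl.
    split; [apply (RInt_correct (V := R_CompleteNormedModule)), Hex; try assumption; lra |].
    apply HQ. change (Rabs (RInt f x y - L) < eps).
    assert (RInt f x y <= L) by (apply HL1; exists x, y; repeat split; try assumption; lra).
    assert (Hxa' : ex_RInt f x a) by (apply Hex; assumption).
    assert (Hab' : ex_RInt f a b) by (apply Hex; assumption).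
    assert (Hby' : ex_RInt f b y) by (apply Hex; assumption).
    assert (Hay' : ex_RInt f a y) by (apply Hex; try assumption; lra).
    assert (E1 := RInt_Chasles (V := R_CompleteNormedModule) f x a y Hxa' Hay').
    assert (E2 := RInt_Chasles (V := R_CompleteNormedModule) f a b y Hab' Hby').
    unfold plus in E1, E2; simpl in E1, E2.
    assert (0 <= RInt f x a).
    { apply RInt_ge_0; try assumption. intros t Ht. apply Hpos, (Hconv x t a); try assumption; lra. }
    assert (0 <= RInt f b y).
    { apply RInt_ge_0; try assumption. intros t Ht. apply Hpos, (Hconv b t y); try assumption; lra. }
    apply Rabs_def1; lra.
Qed.

Lemma is_RInt_gen_primitive (Fa Fb : (R -> Prop) -> Prop) (P : R -> Prop) (F f : R -> R) (la lb : R) :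
  Filter Fa -> Filter Fb ->
  (forall x y z, P x -> P z -> x <= y <= z -> P y) -> Fa P -> Fb P ->
  (forall x, P x -> is_derive F x (f x)) -> (forall x, P x -> continuous f x) ->
  filterlim F Fa (locally la) -> filterlim F Fb (locally lb) ->
  is_RInt_gen f Fa Fb (lb - la).
Proof.
  intros FFa FFb Hconv HFa HFb HF Hf Hla Hlb Q [eps HQ].
  pose proof (is_pos_div_2 eps) as He.
  generalize (Hla _ (locally_ball la (pos_div_2 eps))) (Hlb _ (locally_ball lb (pos_div_2 eps))).
  unfold filtermap. intros Ha Hb.
  apply (Filter_prod _ _ _ _ _ (filter_and _ _ HFa Ha) (filter_and _ _ HFb Hb)).
  intros x y [Hx Hxa] [Hy Hyb]. exists (F y - F x). simpl.
  change (Rabs (F x - la) < eps / 2) in Hxa. change (Rabs (F y - lb) < eps / 2) in Hyb.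
  assert (HP : forall z, Rmin x y <= z <= Rmax x y -> P z).
  { intros z. destruct (Rle_lt_dec x y).
    - rewrite Rmin_left, Rmax_right by lra. apply Hconv; assumption.
    - rewrite Rmin_right, Rmax_left by lra. apply Hconv; assumption. }
  split.
  - apply (is_RInt_derive (V := R_CompleteNormedModule)); intros z Hz; [apply HF | apply Hf]; auto.
  - apply HQ. change (Rabs (F y - F x - (lb - la)) < eps).
    replace (F y - F x - (lb - la)) with ((F y - lb) - (F x - la)) by ring.
    eapply Rle_lt_trans; [apply Rabs_triang|]. rewrite Rabs_Ropp. lra.
Qed.

Lemma filterlim_within_locally (f : R -> R) (x : R) (D : R -> Prop) :
  continuous f x -> filterlim f (within D (locally x)) (locally (f x)).
Proof.
  intros H Q HQ. destruct (H Q HQ) as [eps He]. exists eps. intros y Hy _. apply He, Hy.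
Qed.

Definition gamma_integrand (x t : R) : R := Rpower t (x - 1) * exp (- t).

Lemma continuous_gamma_integrand (x t : R) : 0 < t -> continuous (gamma_integrand x) t.
Proof.
  intros Ht. apply (ex_derive_continuous (V := R_NormedModule)).
  unfold gamma_integrand, Rpower. auto_derive. exact Ht.
Qed.

Lemma at_right_0_pos (c : R) : 0 < c -> at_right 0 (fun x => 0 < x /\ x <= c).
Proof.
  intros Hc. exists (mkposreal c Hc). intros y Hy Hy0. split; [exact Hy0|].
  change (Rabs (y - 0) < c) in Hy. rewrite Rminus_0_r in Hy. pose proof (Rle_abs y). lra.
Qed.

Lemma p_infty_pos (c : R) : 0 < c -> Rbar_locally p_infty (fun x => 0 < x /\ c <= x).
Proof. intros Hc. exists c. intros y Hy. lra. Qed.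

Lemma ln_le_sub1 (y : R) : 0 < y -> ln y <= y - 1.
Proof.
  intros Hy. pose proof (exp_ineq1_le (ln y)) as H. rewrite exp_ln in H by exact Hy. lra.
Qed.

(* The integrand is dominated by a multiple of the derivative
   x t^(x-1) / (1+t)^(x+1) of the bounded function (t / (1+t))^x. *)
Lemma is_RInt_gen_Gamma (x : R) : 0 < x ->
  is_RInt_gen (gamma_integrand x) (at_right 0) (Rbar_locally p_infty) (Gamma x).
Proof.
  intros Hx. apply (RInt_gen_correct (V := R_CompleteNormedModule)).
  set (h := fun t => exp (x * (ln t - ln (1 + t)))).
  set (h' := fun t => x * (/ t - / (1 + t)) * exp (x * (ln t - ln (1 + t)))).
  (* The maximum of (1 + t)^(x+1) exp(-t) over t > 0, attained at t = x. *)
  set (K := exp (- x + (x + 1) * ln (x + 1))).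
  assert (Hh : forall t, 0 < t -> 0 <= h t <= 1).
  { intros t Ht. unfold h. split; [apply Rlt_le, exp_pos|]. apply Rle_trans with (exp 0); [|rewrite exp_0; lra].
    assert (ln t < ln (1 + t)) by (apply ln_increasing; lra).
    assert (0 < x * (ln (1 + t) - ln t)) by (apply Rmult_lt_0_compat; lra).
    apply Rlt_le, exp_increasing. lra. }
  assert (Hd : forall t, 0 < t -> is_derive h t (h' t)).
  { intros t Ht. unfold h, h'. auto_derive; [repeat split; lra | unfold Rminus; field; lra]. }
  assert (Hc : forall t, 0 < t -> continuous h' t).
  { intros t Ht. apply (ex_derive_continuous (V := R_NormedModule)). unfold h'. auto_derive. repeat split; lra. }
  assert (Hle : forall t, 0 < t -> gamma_integrand x t <= K / x * h' t).
  { intros t Ht. unfold gamma_integrand, h', Rpower.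
    replace (K / x * (x * (/ t - / (1 + t)) * exp (x * (ln t - ln (1 + t)))))
      with (K * (/ t * / (1 + t)) * exp (x * (ln t - ln (1 + t)))) by (field; lra).
    replace (/ t) with (exp (- ln t)) by (rewrite exp_Ropp, exp_ln; lra).
    replace (/ (1 + t)) with (exp (- ln (1 + t))) by (rewrite exp_Ropp, exp_ln; lra).
    unfold K. rewrite <- !exp_plus.
    destruct (Rle_lt_or_eq_dec ((x - 1) * ln t + - t)
      (- x + (x + 1) * ln (x + 1) + (- ln t + - ln (1 + t)) + x * (ln t - ln (1 + t)))) as [Hl|He].
    (* The inequality ln y <= y - 1 at y = (1 + t)/(x + 1) is what proves the maximality of [K]. *)
    - assert (Hy : 0 < (1 + t) / (x + 1)) by (apply Rdiv_lt_0_compat; lra).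
      pose proof (ln_le_sub1 _ Hy) as Hln. rewrite ln_div in Hln by lra.
      apply (Rmult_le_compat_l (x + 1)) in Hln; [|lra].
      replace ((x + 1) * ((1 + t) / (x + 1) - 1)) with (t - x) in Hln by (field; lra). lra.
    - left. apply exp_increasing, Hl.
    - right. f_equal. exact He. }
  apply (ex_RInt_gen_bounded _ _ (fun t => 0 < t) _ (K / x)); try typeclasses eauto.
  - intros u v w Hu Hw Hv. lra.
  - exists 1. lra.
  - apply at_right_0_pos.
  - apply p_infty_pos.
  - intros t Ht. apply Rlt_le, Rmult_lt_0_compat; apply exp_pos.
  - intros t Ht. apply continuous_gamma_integrand, Ht.
  - intros a b Ha Hb Hab.
    assert (HI : is_RInt h' a b (h b - h a)).
    { apply (is_RInt_derive (V := R_CompleteNormedModule)); intros z; rewrite Rmin_left by exact Hab;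
        intros Hz; [apply Hd | apply Hc]; lra. }
    apply (is_RInt_scal (V := R_NormedModule) _ _ _ (K / x)) in HI.
    apply Rle_trans with (RInt (fun t => K / x * h' t) a b).
    + apply RInt_le; [exact Hab | | eexists; exact HI |].
      * apply (ex_RInt_continuous (V := R_CompleteNormedModule)). intros z. rewrite Rmin_left by exact Hab.
        intros Hz. apply continuous_gamma_integrand. lra.
      * intros t Ht. apply Hle. lra.
    + rewrite (is_RInt_unique (V := R_CompleteNormedModule) (fun t => K / x * h' t) _ _ _ HI).
      change (K / x * (h b - h a) <= K / x). pose proof (Hh a Ha). pose proof (Hh b Hb).
      assert (0 < K / x) by (apply Rdiv_lt_0_compat; [apply exp_pos | exact Hx]).
      assert (K / x * (h b - h a) <= K / x * 1) by (apply Rmult_le_compat_l; lra). lra.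
Qed.

Lemma filterlim_exp_m_infty {T} (F : (T -> Prop) -> Prop) (f : T -> R) :
  Filter F -> filterlim f F (Rbar_locally m_infty) -> filterlim (fun t => exp (f t)) F (locally 0).
Proof.
  intros FF H. apply filterlim_comp with (1 := H). exact is_lim_exp_m.
Qed.

(** Integration by parts: t^x exp(-t) vanishes at both ends and has derivative x t^(x-1) exp(-t) -
    t^x exp(-t). *)
Lemma Gamma_S (x : R) : 0 < x -> Gamma (x + 1) = x * Gamma x.
Proof.
  intros Hx.
  assert (HF : is_RInt_gen (fun t => x * gamma_integrand x t - gamma_integrand (x + 1) t)
                (at_right 0) (Rbar_locally p_infty) (0 - 0)).
  { apply (is_RInt_gen_primitive _ _ (fun t => 0 < t) (fun t => exp (x * ln t - t))); try typeclasses eauto.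
    - intros u v w Hu Hw Hv. lra.
    - generalize (at_right_0_pos 1 Rlt_0_1). apply filter_imp. tauto.
    - generalize (p_infty_pos 1 Rlt_0_1). apply filter_imp. tauto.
    - intros t Ht. unfold gamma_integrand, Rpower. auto_derive; [exact Ht|].
      rewrite <- !exp_plus. replace (x + 1 - 1) with x by ring.
      replace ((x - 1) * ln t + - t) with ((x * ln t + - t) + - ln t) by ring.
      rewrite (exp_plus _ (- ln t)), exp_Ropp, exp_ln by exact Ht. unfold Rminus. field. lra.
    - intros t Ht. apply (continuous_minus (V := R_NormedModule)).
      + apply (continuous_scal_r (V := R_NormedModule)). apply continuous_gamma_integrand, Ht.
      + apply continuous_gamma_integrand, Ht.
    - apply filterlim_exp_m_infty; [typeclasses eauto|].
      intros Q [M HM]. unfold filtermap.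
      pose proof is_lim_ln_0 as Hln. specialize (Hln (fun y => x * y < M)).
      assert (Hloc : Rbar_locally m_infty (fun y => x * y < M)).
      { exists (M / x). intros y Hy. apply Rlt_div_r in Hy; lra. }
      assert (Hln' : at_right 0 (fun t => x * ln t < M)) by exact (Hln Hloc).
      generalize (filter_and _ _ Hln' (at_right_0_pos 1 Rlt_0_1)).
      apply filter_imp. intros t [H1 [H2 _]]. apply HM. lra.
    - apply filterlim_exp_m_infty; [typeclasses eauto|].
      intros Q [M HM]. unfold filtermap.
      (* From ln y <= y - 1 at y = t/(2 x) follows x ln t <= x ln (2 x) + t/2 - x, so the exponent x
         ln t - t lies below x ln (2 x) - t/2. *)
      exists (Rmax 1 (2 * (x * ln (2 * x) - M))). intros t Ht. apply HM.
      pose proof (Rmax_l 1 (2 * (x * ln (2 * x) - M))). pose proof (Rmax_r 1 (2 * (x * ln (2 * x) - M))).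
      assert (Hy : 0 < t / (2 * x)) by (apply Rdiv_lt_0_compat; lra).
      pose proof (ln_le_sub1 _ Hy) as Hln. rewrite ln_div in Hln by lra.
      apply (Rmult_le_compat_l x) in Hln; [|lra].
      replace (x * (t / (2 * x) - 1)) with (t / 2 - x) in Hln by (field; lra). lra. }
  pose proof (is_RInt_gen_minus (V := R_NormedModule) _ _ _ _
     (is_RInt_gen_scal (V := R_NormedModule) _ x _ (is_RInt_gen_Gamma x Hx)) (is_RInt_gen_Gamma (x + 1) ltac:(lra))) as H2.
  apply (is_RInt_gen_unique (V := R_CompleteNormedModule)) in HF.
  apply (is_RInt_gen_unique (V := R_CompleteNormedModule)) in H2.
  assert (E : 0 - 0 = x * Gamma x - Gamma (x + 1)).
  { rewrite <- HF. exact H2. }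
  lra.
Qed.

(** Convexity of exp between 0 and z: both end values are compared with the tangent at s z and
    weighted by 1 - s and s, whereupon the linear terms cancel. *)
Lemma exp_convex_0 (s z : R) : 0 <= s <= 1 -> exp (s * z) <= 1 - s + s * exp z.
Proof.
  intros Hs. set (E := exp (s * z)).
  assert (HE : 0 < E) by apply exp_pos.
  assert (H1 : E * (1 + (1 - s) * z) <= exp z).
  { replace (exp z) with (E * exp ((1 - s) * z)) by (unfold E; rewrite <- exp_plus; f_equal; ring).
    apply Rmult_le_compat_l; [lra | apply exp_ineq1_le]. }
  assert (H2 : E * (1 + - (s * z)) <= 1).
  { replace 1 with (E * exp (- (s * z))) at 2 by (unfold E; rewrite <- exp_plus, Rplus_opp_r, exp_0; reflexivity).
    apply Rmult_le_compat_l; [lra | apply exp_ineq1_le]. }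
  apply (Rmult_le_compat_l s) in H1; [|lra]. apply (Rmult_le_compat_l (1 - s)) in H2; [|lra].
  lra.
Qed.

(** Wendel's inequality. Convexity gives (t/y)^s <= 1 - s + s t/y pointwise; integrated against
    t^(y-1) exp(-t), the right side becomes (1 - s) Gamma(y) + s Gamma(y + 1)/y = Gamma(y). *)
Lemma Gamma_add_le (y s : R) : 0 < y -> 0 <= s <= 1 -> Gamma (y + s) <= Rpower y s * Gamma y.
Proof.
  intros Hy Hs. assert (Hy1 : 0 < y + 1) by lra. assert (Hys : 0 < y + s) by lra.
  pose proof (is_RInt_gen_plus (V := R_NormedModule) _ _ _ _
     (is_RInt_gen_scal (V := R_NormedModule) _ ((1 - s) * Rpower y s) _ (is_RInt_gen_Gamma y Hy))
     (is_RInt_gen_scal (V := R_NormedModule) _ (s * Rpower y s / y) _ (is_RInt_gen_Gamma (y + 1) Hy1))) as H2.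
  pose proof (is_RInt_gen_Gamma (y + s) Hys) as H1.
  assert (Hl : Rabs (Gamma (y + s)) <= (1 - s) * Rpower y s * Gamma y + s * Rpower y s / y * Gamma (y + 1)).
  { refine (RInt_gen_norm (V := R_CompleteNormedModule) _ _ _ _ _ _ H1 H2).
    - apply (Filter_prod _ _ _ _ _ (at_right_0_pos 1 Rlt_0_1) (p_infty_pos 1 Rlt_0_1)).
      intros u v; simpl; lra.
    - apply (Filter_prod _ _ _ _ _ (at_right_0_pos 1 Rlt_0_1) (p_infty_pos 1 Rlt_0_1)).
      intros u v Hu Hv t Ht. simpl in Ht.
      change (Rabs (gamma_integrand (y + s) t) <= (1 - s) * Rpower y s * gamma_integrand y t
              + s * Rpower y s / y * gamma_integrand (y + 1) t).
      unfold gamma_integrand. rewrite Rabs_pos_eq by (apply Rlt_le, Rmult_lt_0_compat; apply exp_pos).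
      unfold Rpower.
      replace ((y + s - 1) * ln t) with ((y - 1) * ln t + (s * ln y + s * (ln t - ln y))) by ring.
      replace ((y + 1 - 1) * ln t) with ((y - 1) * ln t + ln t) by ring.
      rewrite !exp_plus, exp_ln by lra.
      pose proof (exp_convex_0 s (ln t - ln y) Hs) as Hc.
      unfold Rminus in Hc at 3. rewrite (exp_plus (ln t)), exp_Ropp, !exp_ln in Hc by lra.
      set (A := exp ((y - 1) * ln t) * exp (s * ln y) * exp (- t)).
      assert (HA : 0 <= A) by (unfold A; apply Rlt_le; repeat apply Rmult_lt_0_compat; apply exp_pos).
      apply (Rmult_le_compat_l A) in Hc; [|exact HA].
      eapply Rle_trans; [right | eapply Rle_trans; [exact Hc | right]].
      + unfold A; ring.
      + unfold A; field; lra. }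
  eapply Rle_trans; [apply Rle_abs|]. eapply Rle_trans; [exact Hl|].
  rewrite Gamma_S by exact Hy. right. field. lra.
Qed.

Lemma Gamma_1 : Gamma 1 = 1.
Proof.
  assert (HF : is_RInt_gen (gamma_integrand 1) (at_right 0) (Rbar_locally p_infty) (0 - (-1))).
  { apply (is_RInt_gen_primitive _ _ (fun t => 0 < t) (fun t => - exp (- t))); try typeclasses eauto.
    - intros u v w Hu Hw Hv. lra.
    - generalize (at_right_0_pos 1 Rlt_0_1). apply filter_imp. tauto.
    - generalize (p_infty_pos 1 Rlt_0_1). apply filter_imp. tauto.
    - intros t Ht. unfold gamma_integrand, Rpower. auto_derive; [exact I|].
      replace ((1 - 1) * ln t) with 0 by ring. rewrite exp_0. ring.
    - intros t Ht. apply continuous_gamma_integrand, Ht.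
    - replace (-1) with (- exp (- 0)) by (rewrite Ropp_0, exp_0; reflexivity).
      apply (filterlim_within_locally (fun t => - exp (- t))).
      apply (ex_derive_continuous (V := R_NormedModule) (fun t => - exp (- t))). auto_derive. exact I.
    - replace 0 with (- 0) by ring.
      apply filterlim_comp with (g := Ropp) (G := locally 0).
      + apply filterlim_exp_m_infty; [typeclasses eauto|].
        intros Q [M HM]. exists (- M). intros t Ht. apply HM. lra.
      + apply (filterlim_opp (V := R_NormedModule)). }
  apply (is_RInt_gen_unique (V := R_CompleteNormedModule)) in HF.
  change (Gamma 1 = 0 - -1) in HF. lra.
Qed.

(** [Gamma_add_le] with s = 1 - x bounds Gamma(1) = 1 by a positive multiple of [Gamma x]. *)
Lemma Gamma_pos_unit (x : R) : 0 < x <= 1 -> 0 < Gamma x.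
Proof.
  intros Hx. pose proof (Gamma_add_le x (1 - x) ltac:(lra) ltac:(lra)) as H.
  replace (x + (1 - x)) with 1 in H by ring. rewrite Gamma_1 in H.
  assert (HR : 0 < Rpower x (1 - x)) by apply exp_pos.
  apply Rnot_le_lt. intros Hn. nra.
Qed.

Lemma Gamma_pos_add_INR (x : R) (n : nat) : 0 < x <= 1 -> 0 < Gamma (x + INR n).
Proof.
  intros Hx. induction n as [|n IH].
  - simpl. rewrite Rplus_0_r. apply Gamma_pos_unit, Hx.
  - rewrite S_INR, <- Rplus_assoc. pose proof (pos_INR n).
    rewrite Gamma_S by lra. apply Rmult_lt_0_compat; lra.
Qed.

Lemma Gamma_INR_pos (n : nat) : 0 < Gamma (INR (S n)).
Proof. rewrite S_INR, Rplus_comm. apply Gamma_pos_add_INR. lra. Qed.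

(** * Asymptotics of Gamma and its multiplication formulas *)

Definition gamma_ratio (z : R) (n : nat) : R :=
  Gamma (z + INR (S n)) / (Rpower (INR (S n)) z * Gamma (INR (S n))).

Lemma INR_S_pos (n : nat) : 0 < INR (S n).
Proof. rewrite S_INR. pose proof (pos_INR n). lra. Qed.

(** Two uses of [Gamma_add_le] with N = n + 1: the step z from N gives the upper bound; the step 1 -
    z from N + z ends at N + 1 and gives N Gamma(N) <= (N + z)^(1-z) Gamma(N + z), hence the lower
    one. *)
Lemma gamma_ratio_bounds (z : R) (n : nat) : 0 < z <= 1 ->
  INR (S n) / (INR (S n) + z) <= gamma_ratio z n <= 1.
Proof.
  intros Hz. unfold gamma_ratio. set (N := INR (S n)).
  assert (HN : 0 < N) by apply INR_S_pos.
  assert (HG : 0 < Gamma N) by apply Gamma_INR_pos.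
  assert (HR : 0 < Rpower N z) by apply exp_pos.
  assert (HD : 0 < Rpower N z * Gamma N) by (apply Rmult_lt_0_compat; assumption).
  split.
  - pose proof (Gamma_add_le (N + z) (1 - z) ltac:(lra) ltac:(lra)) as H.
    replace (N + z + (1 - z)) with (N + 1) in H by ring. rewrite Gamma_S in H by exact HN.
    replace (z + N) with (N + z) by ring.
    assert (Hp : Rpower (N + z) (1 - z) * Rpower N z <= N + z).
    { apply Rle_trans with (Rpower (N + z) (1 - z) * Rpower (N + z) z).
      - apply Rmult_le_compat_l; [apply Rlt_le, exp_pos|]. apply Rle_Rpower_l; lra.
      - rewrite <- Rpower_plus. replace (1 - z + z) with 1 by ring. rewrite Rpower_1; lra. }
    set (X := Gamma (N + z)) in *.
    assert (HX : 0 < X) by (unfold X, N; rewrite Rplus_comm; apply Gamma_pos_add_INR, Hz).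
    apply Rmult_le_reg_r with (Rpower N z * Gamma N); [exact HD|].
    apply Rmult_le_reg_r with (N + z); [lra|].
    replace (N / (N + z) * (Rpower N z * Gamma N) * (N + z)) with (Rpower N z * (N * Gamma N)) by (field; lra).
    replace (X / (Rpower N z * Gamma N) * (Rpower N z * Gamma N) * (N + z)) with (X * (N + z)) by (field; lra).
    apply Rle_trans with (Rpower N z * (Rpower (N + z) (1 - z) * X)).
    + apply Rmult_le_compat_l; lra.
    + replace (Rpower N z * (Rpower (N + z) (1 - z) * X)) with (X * (Rpower (N + z) (1 - z) * Rpower N z)) by ring.
      apply Rmult_le_compat_l; lra.
  - apply Rle_div_l; [exact HD|]. rewrite Rmult_1_l.
    replace (z + N) with (N + z) by ring. apply Gamma_add_le; lra.
Qed.

Lemma is_lim_seq_gamma_ratio (z : R) : 0 < z <= 1 -> is_lim_seq (gamma_ratio z) 1.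
Proof.
  intros Hz.
  apply is_lim_seq_le_le with (u := fun n => 1 - z * / INR (S n)) (w := fun _ => 1).
  - intros n. destruct (gamma_ratio_bounds z n Hz) as [H1 H2]. split; [|exact H2].
    eapply Rle_trans; [|exact H1]. pose proof (INR_S_pos n) as HN. set (N := INR (S n)) in *.
    apply Rle_div_r; [lra|].
    replace ((1 - z * / N) * (N + z)) with (N - z * z * / N) by (field; lra).
    assert (0 < / N) by (apply Rinv_0_lt_compat, HN). assert (0 <= z * z * / N) by nra. lra.
  - evar_last.
    + apply is_lim_seq_minus'; [apply is_lim_seq_const|].
      apply (is_lim_seq_scal_l (fun n => / INR (S n)) z 0).
      apply (is_lim_seq_incr_1 (fun n => / INR n)).
      evar_last; [apply is_lim_seq_inv; [apply is_lim_seq_INR | discriminate] | reflexivity].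
    + simpl. f_equal. ring.
  - apply is_lim_seq_const.
Qed.

(** The index [k * S n - 1] is the one whose successor is k (n + 1), as required for the denominator
    Gamma(k z + k N) of a multiplication formula. *)
Lemma is_lim_seq_gamma_ratio_mul (z : R) (k : nat) : 0 < z <= 1 -> (1 <= k)%nat ->
  is_lim_seq (fun n => gamma_ratio z (k * S n - 1)) 1.
Proof.
  intros Hz Hk. apply (is_lim_seq_subseq (gamma_ratio z) 1 (fun n => (k * S n - 1)%nat)).
  - apply eventually_subseq. intros n. nia.
  - apply is_lim_seq_gamma_ratio, Hz.
Qed.

Lemma Gamma_ratio_eq (z : R) (n : nat) :
  Gamma (z + INR (S n)) = gamma_ratio z n * (Rpower (INR (S n)) z * Gamma (INR (S n))).
Proof.
  unfold gamma_ratio. field. split; apply Rgt_not_eq; [apply Gamma_INR_pos | apply exp_pos].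
Qed.

Lemma gamma_ratio_pos (z : R) (n : nat) : 0 < z <= 1 -> 0 < gamma_ratio z n.
Proof.
  intros Hz. destruct (gamma_ratio_bounds z n Hz) as [H _]. eapply Rlt_le_trans; [|exact H].
  pose proof (INR_S_pos n). apply Rdiv_lt_0_compat; lra.
Qed.

(** Cross-multiplication eliminates r: q1 * k2 n = q2 * k1 n for every n, and the limit gives the
    equality. *)
Lemma eq_of_common_asymptotics (q1 q2 : R) (k1 k2 r : nat -> R) :
  is_lim_seq k1 1 -> is_lim_seq k2 1 ->
  (forall n, q1 = k1 n * r n) -> (forall n, q2 = k2 n * r n) -> q1 = q2.
Proof.
  intros H1 H2 E1 E2.
  assert (L1 : is_lim_seq (fun n => q1 * k2 n) (q1 * 1)) by (apply (is_lim_seq_scal_l k2 q1 1), H2).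
  assert (L2 : is_lim_seq (fun n => q2 * k1 n) (q2 * 1)) by (apply (is_lim_seq_scal_l k1 q2 1), H1).
  apply is_lim_seq_unique in L1. apply is_lim_seq_unique in L2.
  rewrite (Lim_seq_ext _ (fun n => q2 * k1 n)) in L1.
  - rewrite L1 in L2. injection L2. lra.
  - intros n. rewrite (E1 n), (E2 n). ring.
Qed.

Lemma Rpower_base_pos (x y : R) : 0 < Rpower x y.
Proof. apply exp_pos. Qed.

(** By Legendre's duplication formula this is constant in z, with value 2 sqrt(pi). *)
Definition dup_quotient (z : R) : R := Rpower 4 z * Gamma z * Gamma (z + 1 / 2) / Gamma (2 * z).

Lemma dup_quotient_add (z : R) (n : nat) : 0 < z -> 0 < 2 * z <= 1 ->
  dup_quotient (z + INR n) = dup_quotient z.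
Proof.
  intros Hz H2z. induction n as [|n IH]; [simpl; now rewrite Rplus_0_r|].
  rewrite <- IH, S_INR. pose proof (pos_INR n).
  set (w := z + INR n). unfold dup_quotient.
  replace (z + (INR n + 1)) with (w + 1) by (unfold w; ring).
  replace (w + 1 + 1 / 2) with (w + 1 / 2 + 1) by ring.
  replace (2 * (w + 1)) with (2 * w + 1 + 1) by ring.
  rewrite !Gamma_S by (unfold w; lra). rewrite Rpower_plus, Rpower_1 by lra.
  assert (0 < Gamma (2 * w)).
  { replace (2 * w) with (2 * z + INR (2 * n)) by (unfold w; rewrite mult_INR; simpl; ring).
    apply Gamma_pos_add_INR, H2z. }
  field. unfold w in *. repeat split; lra.
Qed.

Lemma Rpower_mul_scale (k : nat) (x z : R) : (0 < k)%nat -> 0 < x ->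
  Rpower (INR k * x) (INR k * z) = Rpower (INR k ^ k) z * Rpower x z ^ k.
Proof.
  intros Hk Hx. assert (HK : 0 < INR k) by (apply lt_0_INR, Hk).
  rewrite <- Rpower_mult, Rpower_pow by (apply Rmult_lt_0_compat; assumption).
  rewrite Rpow_mult_distr, <- Rpower_mult_distr by (apply pow_lt; assumption).
  f_equal. rewrite <- (Rpower_pow k x) by assumption.
  rewrite <- (Rpower_pow k (Rpower x z)) by apply exp_pos.
  rewrite !Rpower_mult. f_equal. ring.
Qed.

(** By periodicity z may be replaced by z + N with N = n + 1. There the powers 4^z and N^(2z) cancel
    between numerator and denominator, and z survives only in a factor that tends to 1. *)
Lemma dup_quotient_asymptotics (z : R) (n : nat) : 0 < z -> 0 < 2 * z <= 1 ->
  dup_quotient z = (gamma_ratio z n * gamma_ratio (z + 1 / 2) n / gamma_ratio (2 * z) (2 * S n - 1))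
   * (Rpower (INR (S n)) (1 / 2) * Rpower 4 (INR (S n)) * Gamma (INR (S n)) ^ 2 / Gamma (INR (2 * S n))).
Proof.
  intros Hz H2z. rewrite <- (dup_quotient_add z (S n) Hz H2z). unfold dup_quotient.
  replace (z + INR (S n) + 1 / 2) with (z + 1 / 2 + INR (S n)) by ring.
  assert (E2 : INR 2 = 2) by (simpl; ring).
  replace (2 * (z + INR (S n))) with (2 * z + INR (S (2 * S n - 1))).
  2:{ replace (S (2 * S n - 1)) with (2 * S n)%nat by lia. rewrite mult_INR, E2. ring. }
  rewrite !Gamma_ratio_eq.
  replace (S (2 * S n - 1)) with (2 * S n)%nat by lia.
  pose proof (gamma_ratio_pos (2 * z) (2 * S n - 1) H2z).
  pose proof (Gamma_INR_pos (2 * S n - 1)) as HG2. replace (S (2 * S n - 1)) with (2 * S n)%nat in HG2 by lia.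
  assert (E : Rpower (INR (2 * S n)) (2 * z) = Rpower 4 z * Rpower (INR (S n)) z ^ 2).
  { rewrite mult_INR. pose proof (Rpower_mul_scale 2 (INR (S n)) z ltac:(lia) (INR_S_pos n)) as Hp.
    rewrite E2 in *. replace (2 ^ 2) with 4 in Hp by ring. exact Hp. }
  rewrite E, !Rpower_plus.
  pose proof (Rpower_base_pos 4 z). pose proof (Rpower_base_pos (INR (S n)) z).
  field. repeat split; lra.
Qed.

Lemma dup_quotient_const (z1 z2 : R) : 0 < z1 <= 1 / 2 -> 0 < z2 <= 1 / 2 ->
  dup_quotient z1 = dup_quotient z2.
Proof.
  intros H1 H2.
  assert (HL : forall z, 0 < z <= 1 / 2 ->
    is_lim_seq (fun n => gamma_ratio z n * gamma_ratio (z + 1 / 2) n / gamma_ratio (2 * z) (2 * S n - 1)) 1).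
  { intros z Hz. replace (Finite 1) with (Finite (1 * 1 / 1)) by (f_equal; field).
    apply is_lim_seq_div'; [apply is_lim_seq_mult'; apply is_lim_seq_gamma_ratio; lra | | lra].
    apply is_lim_seq_gamma_ratio_mul; [lra | lia]. }
  (* The common factor [r], which is free of z, is found by unification with the asymptotic
     formula. *)
  eapply (fun r => eq_of_common_asymptotics _ _ _ _ r (HL z1 H1) (HL z2 H2));
    intros n; apply dup_quotient_asymptotics; lra.
Qed.

(** By Gauss's multiplication formula for three factors this is constant in z, with value 2 pi
    sqrt(3). *)
Definition tri_quotient (z : R) : R :=
  Rpower 27 z * Gamma z * Gamma (z + 1 / 3) * Gamma (z + 2 / 3) / Gamma (3 * z).

Lemma tri_quotient_add (z : R) (n : nat) : 0 < z -> 0 < 3 * z <= 1 ->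
  tri_quotient (z + INR n) = tri_quotient z.
Proof.
  intros Hz H3z. induction n as [|n IH]; [simpl; now rewrite Rplus_0_r|].
  rewrite <- IH, S_INR. pose proof (pos_INR n).
  set (w := z + INR n). unfold tri_quotient.
  replace (z + (INR n + 1)) with (w + 1) by (unfold w; ring).
  replace (w + 1 + 1 / 3) with (w + 1 / 3 + 1) by ring.
  replace (w + 1 + 2 / 3) with (w + 2 / 3 + 1) by ring.
  replace (3 * (w + 1)) with (3 * w + 1 + 1 + 1) by ring.
  rewrite !Gamma_S by (unfold w; lra). rewrite Rpower_plus, Rpower_1 by lra.
  assert (0 < Gamma (3 * w)).
  { replace (3 * w) with (3 * z + INR (3 * n)) by (unfold w; rewrite mult_INR; simpl; ring).
    apply Gamma_pos_add_INR, H3z. }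
  field. unfold w in *. repeat split; lra.
Qed.

Lemma tri_quotient_asymptotics (z : R) (n : nat) : 0 < z -> 0 < 3 * z <= 1 ->
  tri_quotient z = (gamma_ratio z n * gamma_ratio (z + 1 / 3) n * gamma_ratio (z + 2 / 3) n
                      / gamma_ratio (3 * z) (3 * S n - 1))
   * (Rpower (INR (S n)) (1 / 3) * Rpower (INR (S n)) (2 / 3) * Rpower 27 (INR (S n))
        * Gamma (INR (S n)) ^ 3 / Gamma (INR (3 * S n))).
Proof.
  intros Hz H3z. rewrite <- (tri_quotient_add z (S n) Hz H3z). unfold tri_quotient.
  replace (z + INR (S n) + 1 / 3) with (z + 1 / 3 + INR (S n)) by ring.
  replace (z + INR (S n) + 2 / 3) with (z + 2 / 3 + INR (S n)) by ring.
  assert (E3 : INR 3 = 3) by (simpl; ring).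
  replace (3 * (z + INR (S n))) with (3 * z + INR (S (3 * S n - 1))).
  2:{ replace (S (3 * S n - 1)) with (3 * S n)%nat by lia. rewrite mult_INR, E3. ring. }
  rewrite !Gamma_ratio_eq.
  replace (S (3 * S n - 1)) with (3 * S n)%nat by lia.
  pose proof (gamma_ratio_pos (3 * z) (3 * S n - 1) H3z).
  pose proof (Gamma_INR_pos (3 * S n - 1)) as HG3. replace (S (3 * S n - 1)) with (3 * S n)%nat in HG3 by lia.
  assert (E : Rpower (INR (3 * S n)) (3 * z) = Rpower 27 z * Rpower (INR (S n)) z ^ 3).
  { rewrite mult_INR. pose proof (Rpower_mul_scale 3 (INR (S n)) z ltac:(lia) (INR_S_pos n)) as Hp.
    rewrite E3 in *. replace (3 ^ 3) with 27 in Hp by ring. exact Hp. }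
  rewrite E, !Rpower_plus.
  pose proof (Rpower_base_pos 27 z). pose proof (Rpower_base_pos (INR (S n)) z).
  field. repeat split; lra.
Qed.

Lemma tri_quotient_const (z1 z2 : R) : 0 < z1 <= 1 / 3 -> 0 < z2 <= 1 / 3 ->
  tri_quotient z1 = tri_quotient z2.
Proof.
  intros H1 H2.
  assert (HL : forall z, 0 < z <= 1 / 3 ->
    is_lim_seq (fun n => gamma_ratio z n * gamma_ratio (z + 1 / 3) n * gamma_ratio (z + 2 / 3) n
                      / gamma_ratio (3 * z) (3 * S n - 1)) 1).
  { intros z Hz. replace (Finite 1) with (Finite (1 * 1 * 1 / 1)) by (f_equal; field).
    apply is_lim_seq_div'; [apply is_lim_seq_mult'; [apply is_lim_seq_mult'|]; apply is_lim_seq_gamma_ratio; lra | | lra].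
    apply is_lim_seq_gamma_ratio_mul; [lra | lia]. }
  eapply (fun r => eq_of_common_asymptotics _ _ _ _ r (HL z1 H1) (HL z2 H2));
    intros n; apply tri_quotient_asymptotics; lra.
Qed.

Lemma Rpower_root_pow (x : R) (k : nat) : 0 < x -> (0 < k)%nat -> Rpower x (1 / INR k) ^ k = x.
Proof.
  intros Hx Hk. assert (INR k <> 0) by (apply not_0_INR; lia).
  rewrite <- Rpower_pow by apply exp_pos. rewrite Rpower_mult.
  replace (1 / INR k * INR k) with 1 by (field; assumption). apply Rpower_1, Hx.
Qed.

(* The duplication and triplication formulas at the multiples of 1/6 determine
   the value; no reflection formula is needed. *)
Lemma Gamma_sixths :
  let g k := Gamma (k / 6) in
  Rpower 2 (1 / 3) * g 1 * g 4 = 2 * g 3 * g 2 /\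
  Rpower 2 (1 / 3) ^ 2 * g 2 * g 5 = 2 * g 3 * g 4 /\
  3 * g 2 * g 4 = 2 * sqrt 3 * g 3 ^ 2.
Proof.
  intros g.
  assert (Hp : forall k, 0 < k <= 6 -> 0 < g k) by (intros k Hk; apply Gamma_pos_unit; lra).
  pose proof (Hp 1 ltac:(lra)) as P1. pose proof (Hp 2 ltac:(lra)) as P2. pose proof (Hp 3 ltac:(lra)) as P3.
  pose proof (Hp 4 ltac:(lra)) as P4. pose proof (Hp 5 ltac:(lra)) as P5.
  (* The comparison points 1/2 and 1/3 make Gamma(2 z), respectively Gamma(3 z), equal to Gamma(1) =
     1: the quotients there are 2 Gamma(1/2) and 3 Gamma(1/3) Gamma(2/3). *)
  pose proof (dup_quotient_const (1 / 6) (1 / 2) ltac:(lra) ltac:(lra)) as D1.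
  pose proof (dup_quotient_const (1 / 3) (1 / 2) ltac:(lra) ltac:(lra)) as D2.
  pose proof (tri_quotient_const (1 / 6) (1 / 3) ltac:(lra) ltac:(lra)) as T.
  unfold dup_quotient, tri_quotient in *.
  replace (1 / 6 + 1 / 2) with (4 / 6) in * by field. replace (2 * (1 / 6)) with (2 / 6) in * by field.
  replace (1 / 3 + 1 / 2) with (5 / 6) in * by field. replace (2 * (1 / 3)) with (4 / 6) in * by field.
  replace (2 * (1 / 2)) with 1 in * by field. replace (1 / 2 + 1 / 2) with 1 in * by field.
  replace (1 / 6 + 1 / 3) with (3 / 6) in * by field. replace (1 / 6 + 2 / 3) with (5 / 6) in * by field.
  replace (3 * (1 / 6)) with (3 / 6) in * by field. replace (1 / 3 + 1 / 3) with (4 / 6) in * by field.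
  replace (1 / 3 + 2 / 3) with 1 in * by field. replace (3 * (1 / 3)) with 1 in * by field.
  replace (Gamma (1 / 2)) with (g 3) in * by (unfold g; f_equal; field).
  replace (Gamma (1 / 3)) with (g 2) in * by (unfold g; f_equal; field).
  rewrite Gamma_1 in *. fold (g 1) (g 2) (g 3) (g 4) (g 5) in *.
  set (p := Rpower 2 (1 / 3)).
  assert (Hpp : 0 < p) by apply exp_pos.
  assert (Hp3 : p ^ 3 = 2).
  { unfold p. replace (1 / 3) with (1 / INR 3) by (simpl; field). apply Rpower_root_pow; [lra | lia]. }
  assert (E1 : Rpower 4 (1 / 6) = p).
  { unfold p. replace 4 with (Rpower 2 2).
    - rewrite Rpower_mult. f_equal. field.
    - replace 2 with (INR 2) at 2 by (simpl; ring). rewrite Rpower_pow by lra. ring. }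
  assert (E2 : Rpower 4 (1 / 3) = p ^ 2).
  { replace (1 / 3) with (1 / 6 + 1 / 6) by field. rewrite Rpower_plus, E1. ring. }
  assert (E3 : Rpower 4 (1 / 2) = 2).
  { replace (1 / 2) with (1 / 6 + 1 / 3) by field. rewrite Rpower_plus, E1, E2, <- Hp3. ring. }
  assert (E4 : Rpower 27 (1 / 3) = 3).
  { replace 27 with (Rpower 3 3).
    - rewrite Rpower_mult. replace (3 * (1 / 3)) with 1 by field. apply Rpower_1. lra.
    - replace 3 with (INR 3) at 2 by (simpl; ring). rewrite Rpower_pow by lra. ring. }
  assert (E5 : Rpower 27 (1 / 6) = sqrt 3).
  { symmetry. rewrite <- Rpower_sqrt by lra. rewrite <- E4 at 1. rewrite Rpower_mult. f_equal. field. }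
  rewrite E1, E3 in D1. rewrite E2, E3 in D2. rewrite E4, E5 in T.
  assert (F1 : p * g 1 * g 4 = 2 * g 3 * g 2).
  { apply Rmult_eq_reg_r with (/ g 2); [|apply Rinv_neq_0_compat; lra]. 
    etransitivity; [etransitivity; [|exact D1]|]; field; lra. }
  assert (F2 : p ^ 2 * g 2 * g 5 = 2 * g 3 * g 4).
  { apply Rmult_eq_reg_r with (/ g 4); [|apply Rinv_neq_0_compat; lra].
    etransitivity; [etransitivity; [|exact D2]|]; field; lra. }
  assert (F3 : sqrt 3 * g 1 * g 5 = 3 * g 2 * g 4).
  { etransitivity; [etransitivity; [|exact T]|]; field; lra. }
  repeat split; [exact F1 | exact F2 |].
  rewrite <- F3.
  (* The product of the two duplication identities, in which g 2 * g 4 cancels and p ^ 3 = 2. It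
     expresses that Gamma(1/6) Gamma(5/6) is twice Gamma(1/2)^2. *)
  assert (F4 : g 1 * g 5 = 2 * g 3 ^ 2).
  { apply Rmult_eq_reg_r with (p ^ 3 * (g 2 * g 4)); [|apply Rgt_not_eq; rewrite Hp3; repeat apply Rmult_lt_0_compat; lra].
    rewrite Hp3 at 2.
    transitivity ((p * g 1 * g 4) * (p ^ 2 * g 2 * g 5)); [ring|]. rewrite F1, F2. ring. }
  replace (sqrt 3 * g 1 * g 5) with (sqrt 3 * (g 1 * g 5)) by ring. rewrite F4. ring.
Qed.

(** * The Gaussian integral and the constants of the Airy functions *)

Lemma continuous_gaussian (t : R) : continuous (fun t => exp (- t ^ 2)) t.
Proof. apply (ex_derive_continuous (V := R_NormedModule)). auto_derive. exact I. Qed.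

Lemma ex_RInt_gaussian (a b : R) : ex_RInt (fun t => exp (- t ^ 2)) a b.
Proof.
  apply (ex_RInt_continuous (V := R_CompleteNormedModule)). intros z _. apply continuous_gaussian.
Qed.

(** The substitution x = t^2: with E the partial Gaussian integral, 2 E(sqrt x) is a primitive of
    the integrand x^(-1/2) exp(-x) of Gamma(1/2). The value is left as Gamma(1/2) because the Airy
    constants are Gamma values too. *)
Lemma is_lim_RInt_gaussian :
  is_lim (fun x => RInt (fun t => exp (- t ^ 2)) 0 x) p_infty (Gamma (1 / 2) / 2).
Proof.
  set (E := (fun x => RInt (fun t => exp (- t ^ 2)) 0 x) : R -> R).
  assert (HEd : forall x, is_derive E x (exp (- x ^ 2))).
  { intros x. apply (is_derive_RInt (V := R_CompleteNormedModule) (fun t => exp (- t ^ 2)) _ 0).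
    - apply filter_forall. intros y. apply (RInt_correct (V := R_CompleteNormedModule)), ex_RInt_gaussian.
    - apply continuous_gaussian. }
  assert (Hex : ex_RInt_gen (fun t => exp (- t ^ 2)) (at_point 0) (Rbar_locally p_infty)).
  (* Since 1 + t^2 <= exp(t^2), the integrand is at most the derivative of atan, which bounds all
     partial integrals by pi/2. *)
  { apply (ex_RInt_gen_bounded _ _ (fun t => 0 <= t) _ (PI / 2)); try typeclasses eauto.
    - intros x y z. lra.
    - exists 0. lra.
    - intros c Hc. unfold at_point. lra.
    - intros c Hc. exists c. intros y Hy. lra.
    - intros x _. apply Rlt_le, exp_pos.
    - intros x _. apply continuous_gaussian.
    - intros a b Ha Hb Hab.
      assert (HI : is_RInt (fun t => / (1 + t ^ 2)) a b (atan b - atan a)).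
      { apply (is_RInt_derive (V := R_CompleteNormedModule)); intros x _.
        - apply is_derive_Reals, derivable_pt_lim_atan.
        - apply (ex_derive_continuous (V := R_NormedModule)). auto_derive. nra. }
      apply Rle_trans with (RInt (fun t => / (1 + t ^ 2)) a b).
      + apply RInt_le; [exact Hab | apply ex_RInt_gaussian | eexists; exact HI |].
        intros x _. rewrite exp_Ropp. apply Rinv_le_contravar; [nra | apply exp_ineq1_le].
      + rewrite (is_RInt_unique (V := R_CompleteNormedModule) _ _ _ _ HI).
        pose proof (atan_bound b). assert (0 <= atan a); [|lra].
        destruct Ha as [Ha| <-]; [|rewrite atan_0; lra].
        left. rewrite <- atan_0. apply atan_increasing, Ha. }
  destruct Hex as [e He].
  assert (HE : filterlim E (Rbar_locally p_infty) (locally e)).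
  { intros Q HQ. destruct (He Q HQ) as [P1 P2 HP1 HP2 HP]. unfold at_point in HP1.
    unfold filtermap. revert HP2. apply filter_imp. intros y Hy.
    destruct (HP 0 y HP1 Hy) as [v [Hv HvQ]]. cbn [fst snd] in Hv. unfold E.
    rewrite (is_RInt_unique (V := R_CompleteNormedModule) _ _ _ _ Hv). exact HvQ. }
  assert (HG : is_RInt_gen (gamma_integrand (1 / 2)) (at_right 0) (Rbar_locally p_infty) (2 * e - 2 * 0)).
  { apply (is_RInt_gen_primitive _ _ (fun t => 0 < t) (fun x => 2 * E (sqrt x))); try typeclasses eauto.
    - intros x y z. lra.
    - generalize (at_right_0_pos 1 Rlt_0_1). apply filter_imp. tauto.
    - generalize (p_infty_pos 1 Rlt_0_1). apply filter_imp. tauto.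
    - intros x Hx.
      assert (Hs : 0 < sqrt x) by (apply sqrt_lt_R0, Hx).
      evar_last.
      + apply is_derive_scal. apply (is_derive_comp E sqrt).
        * apply HEd.
        * apply is_derive_Reals. apply derivable_pt_lim_sqrt, Hx.
      + unfold gamma_integrand. replace (1 / 2 - 1) with (- (/ 2)) by field.
        rewrite Rpower_Ropp, Rpower_sqrt by exact Hx.
        replace (sqrt x ^ 2) with x by (rewrite pow2_sqrt; lra).
        unfold scal; simpl; unfold mult; simpl. field. lra.
    - intros x Hx. apply continuous_gamma_integrand, Hx.
    - replace (2 * 0) with (2 * E (sqrt 0)).
      2:{ unfold E. rewrite sqrt_0, RInt_point. reflexivity. }
      apply (filterlim_within_locally (fun x => 2 * E (sqrt x))).
      apply (continuous_scal_r (V := R_NormedModule) 2 (fun x => E (sqrt x))).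
      apply (continuous_comp sqrt E).
      + apply continuity_pt_filterlim. apply continuity_pt_sqrt. lra.
      + apply (ex_derive_continuous (V := R_NormedModule)). eexists; apply HEd.
    - apply (filterlim_comp _ _ _ (fun x => E (sqrt x)) (fun y => 2 * y) _ (locally e)).
      + apply (filterlim_comp _ _ _ sqrt E _ (Rbar_locally p_infty)); [|exact HE].
        exact filterlim_sqrt_p.
      + apply (continuous_scal_r (V := R_NormedModule) 2 (fun y => y)). apply continuous_id. }
  apply (is_RInt_gen_unique (V := R_CompleteNormedModule)) in HG.
  change (Gamma (1 / 2) = 2 * e - 2 * 0) in HG.
  replace (Gamma (1 / 2) / 2) with e by lra. exact HE.
Qed.

Lemma RInt_gaussian_symmetric (x y : R) :
  RInt (fun t => exp (- t ^ 2)) (- x) y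
    = RInt (fun t => exp (- t ^ 2)) 0 x + RInt (fun t => exp (- t ^ 2)) 0 y.
Proof.
  assert (H : RInt (fun t => exp (- t ^ 2)) (- x) 0 = RInt (fun t => exp (- t ^ 2)) 0 x).
  { apply (is_RInt_unique (V := R_CompleteNormedModule)).
    assert (H : is_RInt (fun t => exp (- t ^ 2)) (- - x) (- 0) (opp (RInt (fun t => exp (- t ^ 2)) 0 x))).
    { rewrite Ropp_involutive, Ropp_0. apply (is_RInt_swap (V := R_NormedModule)).
      apply (RInt_correct (V := R_CompleteNormedModule)), ex_RInt_gaussian. }
    apply (is_RInt_comp_opp (V := R_NormedModule)) in H.
    apply (is_RInt_opp (V := R_NormedModule)) in H. rewrite opp_opp in H.
    apply (is_RInt_ext (V := R_NormedModule)) with (2 := H). intros t _.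
    unfold opp; simpl. rewrite Ropp_involutive. f_equal. ring. }
  rewrite <- H. symmetry.
  exact (RInt_Chasles (V := R_CompleteNormedModule) (fun t => exp (- t ^ 2)) (- x) 0 y
    (ex_RInt_gaussian _ _) (ex_RInt_gaussian _ _)).
Qed.

Lemma Rpower_12 : Rpower 12 (1 / 3) = Rpower 2 (1 / 3) ^ 2 * Rpower 3 (1 / 3).
Proof.
  replace 12 with (2 * 2 * 3) by ring.
  rewrite <- !Rpower_mult_distr by lra. ring.
Qed.

Lemma Gamma_7_6 : Gamma (7 / 6) = Gamma (1 / 6) / 6.
Proof. replace (7 / 6) with (1 / 6 + 1) by field. rewrite Gamma_S by lra. field. Qed.

(** Matches the coefficients left by the integrals of f(u) f(v) and g(u) g(v), up to a common factor
    2, with those of the right-hand side of the theorem. *)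
Lemma airy_constants :
  sqrt 3 * airy_c1 ^ 2 * Gamma (1 / 2) = 1 / (Rpower 12 (1 / 3) * Gamma (5 / 6)) /\
  sqrt 3 * airy_c2 ^ 2 * Gamma (1 / 2) = 1 / (Rpower 12 (1 / 3) ^ 2 * Gamma (7 / 6)).
Proof.
  destruct Gamma_sixths as (F1 & F2 & F3).
  assert (Hp : forall k, 0 < k <= 6 -> 0 < Gamma (k / 6)) by (intros k Hk; apply Gamma_pos_unit; lra).
  pose proof (Hp 1 ltac:(lra)) as P1. pose proof (Hp 2 ltac:(lra)) as P2. pose proof (Hp 3 ltac:(lra)) as P3.
  pose proof (Hp 4 ltac:(lra)) as P4. pose proof (Hp 5 ltac:(lra)) as P5.
  unfold airy_c1, airy_c2. rewrite Gamma_7_6, Rpower_12.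
  replace (2 / 3) with (1 / 3 + 1 / 3) by field.
  rewrite !Rpower_Ropp, Rpower_plus.
  replace (1 / 3 + 1 / 3) with (4 / 6) by field.
  replace (Gamma (1 / 2)) with (Gamma (3 / 6)) by (f_equal; field).
  replace (Gamma (1 / 3)) with (Gamma (2 / 6)) by (f_equal; field).
  set (g1 := Gamma (1 / 6)) in *. set (g2 := Gamma (2 / 6)) in *. set (g3 := Gamma (3 / 6)) in *.
  set (g4 := Gamma (4 / 6)) in *. set (g5 := Gamma (5 / 6)) in *.
  set (p := Rpower 2 (1 / 3)) in *. set (r := Rpower 3 (1 / 3)).
  assert (Hr : 0 < r) by apply exp_pos. assert (Hpp : 0 < p) by apply exp_pos.
  assert (Hr3 : r ^ 3 = 3).
  { unfold r. replace (1 / 3) with (1 / INR 3) by (simpl; field). apply Rpower_root_pow; [lra | lia]. }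
  assert (Hp3 : p ^ 3 = 2).
  { unfold p. replace (1 / 3) with (1 / INR 3) by (simpl; field). apply Rpower_root_pow; [lra | lia]. }
  set (q := sqrt 3) in *.
  (* Solving for Gamma(5/6), Gamma(1/6) and sqrt(3) leaves identities that are rational in
     Gamma(1/3), Gamma(1/2), Gamma(2/3) and the cube roots [p], [r] of 2 and 3. *)
  assert (E5 : g5 = 2 * g3 * g4 / (p ^ 2 * g2)) by (rewrite <- F2; field; lra).
  assert (E1 : g1 = 2 * g3 * g2 / (p * g4)) by (rewrite <- F1; field; lra).
  assert (Eq : q = 3 * g2 * g4 / (2 * g3 ^ 2)) by (rewrite F3; field; lra).
  split.
  - rewrite E5, Eq. apply Rmult_eq_reg_r with (r ^ 3); [|apply Rgt_not_eq; rewrite Hr3; lra].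
    transitivity (3 * g2 / (2 * g4 * g3) / r); [field; repeat split; lra|].
    rewrite <- Hr3 at 1. field. repeat split; lra.
  - rewrite E1, Eq. 
    transitivity (3 * g4 / (2 * g2 * g3) / r ^ 2); [field; repeat split; lra|].
    apply Rmult_eq_reg_r with (p ^ 3); [|apply Rgt_not_eq; rewrite Hp3; lra].
    rewrite Hp3 at 1. field. repeat split; lra.
Qed.

Local Open Scope C_scope.

(** * Differential inequalities and growth *)

Lemma is_Cderive_Cexp (f : R -> C) (x : R) (l : C) :
  is_Cderive f x l -> is_Cderive (fun t => Cexp (f t)) x (Cexp (f x) * l).
Proof.
  intros [H1 H2].
  assert (Hexp : is_derive (fun t => exp (Re (f t))) x (Re l * exp (Re (f x)))%R).
  { apply (is_derive_comp exp (fun t => Re (f t))); [apply is_derive_exp | exact H1]. }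
  assert (Hcos : is_derive (fun t => cos (Im (f t))) x (Im l * (- sin (Im (f x))))%R).
  { apply (is_derive_comp cos (fun t => Im (f t))); [apply is_derive_cos | exact H2]. }
  assert (Hsin : is_derive (fun t => sin (Im (f t))) x (Im l * cos (Im (f x)))%R).
  { apply (is_derive_comp sin (fun t => Im (f t))); [apply is_derive_sin | exact H2]. }
  split.
  - evar_last; [apply (is_derive_mult (K := R_AbsRing) _ _ _ _ _ Hexp Hcos Rmult_comm)|].
    unfold Cexp, plus, mult; Cparts. ring.
  - evar_last; [apply (is_derive_mult (K := R_AbsRing) _ _ _ _ _ Hexp Hsin Rmult_comm)|].
    unfold Cexp, plus, mult; Cparts. ring.
Qed.

Lemma Cexp_0 : Cexp 0 = 1.
Proof.
  unfold Cexp. simpl. rewrite exp_0, cos_0, sin_0. unfold RtoC. f_equal; ring.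
Qed.

Lemma monotone_of_derive_le0 (f df : R -> R) (a b : R) : (a <= b)%R ->
  (forall x, (a <= x <= b)%R -> is_derive f x (df x)) ->
  (forall x, (a <= x <= b)%R -> (df x <= 0)%R) -> (f b <= f a)%R.
Proof.
  intros Hab Hd Hle.
  destruct (MVT_gen f a b df) as [c [Hc E]].
  - intros x Hx. rewrite Rmin_left, Rmax_right in Hx by exact Hab. apply Hd. lra.
  - intros x Hx. rewrite Rmin_left, Rmax_right in Hx by exact Hab.
    apply continuity_pt_filterlim, (ex_derive_continuous (V := R_NormedModule)). eexists; apply Hd, Hx.
  - rewrite Rmin_left, Rmax_right in Hc by exact Hab. specialize (Hle c Hc). nra.
Qed.

(** The squared norm n = |E1|^2 + |E2|^2 is differentiable even at zeros of E1 and E2. From 2 x y <=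
    x^2 + y^2 follows n' <= L n + 2 eps^2, where 4 M in L comes from the matrix and 1 from the
    inhomogeneity; hence exp(-L s) n - 2 eps^2 s is nonincreasing. *)
Lemma gronwall_Clinear_system (E1 E2 m11 m12 m21 m22 e1 e2 : R -> C) (M eps : R) :
  (forall s, is_Cderive E1 s (m11 s * E1 s + m12 s * E2 s + e1 s)) ->
  (forall s, is_Cderive E2 s (m21 s * E1 s + m22 s * E2 s + e2 s)) ->
  (forall s, (0 <= s <= 1)%R -> (Cmod (m11 s) <= M /\ Cmod (m12 s) <= M /\
     Cmod (m21 s) <= M /\ Cmod (m22 s) <= M /\ Cmod (e1 s) <= eps /\ Cmod (e2 s) <= eps)%R) ->
  E1 0%R = 0 -> E2 0%R = 0 ->
  (Cmod (E1 1%R) * Cmod (E1 1%R) <= 2 * exp (4 * M + 1) * (eps * eps))%R.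
Proof.
  intros H1 H2 HM Z1 Z2.
  set (L := (4 * M + 1)%R).
  set (D1 := fun s => m11 s * E1 s + m12 s * E2 s + e1 s) in *.
  set (D2 := fun s => m21 s * E1 s + m22 s * E2 s + e2 s) in *.
  set (n := fun s => (Re (E1 s) * Re (E1 s) + Im (E1 s) * Im (E1 s)
                     + (Re (E2 s) * Re (E2 s) + Im (E2 s) * Im (E2 s)))%R).
  set (dn := fun s => (2 * (Re (E1 s) * Re (D1 s) + Im (E1 s) * Im (D1 s)
                     + (Re (E2 s) * Re (D2 s) + Im (E2 s) * Im (D2 s))))%R).
  assert (Hn : forall s, is_derive n s (dn s)).
  { intros s. destruct (H1 s) as [A1 A2]. destruct (H2 s) as [A3 A4].
    assert (Hsq : forall f l, is_derive f s l -> is_derive (fun t => f t * f t)%R s (2 * (f s * l))%R).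
    { intros f l Hf. evar_last; [apply (is_derive_mult (K := R_AbsRing) _ _ _ _ _ Hf Hf Rmult_comm)|].
      unfold plus, mult; simpl. ring. }
    evar_last.
    - apply (is_derive_plus (V := R_NormedModule));
        apply (is_derive_plus (V := R_NormedModule)); apply Hsq; eassumption.
    - unfold dn, D1, D2, plus; simpl. ring. }
  set (phi := fun s => (exp (- L * s) * n s - 2 * (eps * eps) * s)%R).
  set (dphi := fun s => (exp (- L * s) * (dn s - L * n s) - 2 * (eps * eps))%R).
  assert (Hphi : (phi 1 <= phi 0)%R).
  { apply (monotone_of_derive_le0 phi dphi); [lra | |].
    - intros s _. unfold phi, dphi. evar_last.
      + apply (is_derive_minus (V := R_NormedModule)).
        * apply (is_derive_mult (K := R_AbsRing) (fun s => exp (- L * s)%R) n s (- L * exp (- L * s))%R (dn s));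
            [auto_derive; [exact I | ring] | apply Hn | exact Rmult_comm].
        * apply (is_derive_scal (fun s => s) s (2 * (eps * eps))%R 1%R). apply (is_derive_id (K := R_AbsRing)).
      + unfold minus, plus, opp, mult; simpl. ring.
    - intros s Hs. unfold dphi. destruct (HM s Hs) as (B1 & B2 & B3 & B4 & B5 & B6).
      set (p := Cmod (E1 s)). set (q := Cmod (E2 s)).
      assert (Hp : (0 <= p)%R) by apply Cmod_ge_0. assert (Hq : (0 <= q)%R) by apply Cmod_ge_0.
      assert (Hn2 : n s = (p * p + q * q)%R) by (unfold n, p, q; rewrite !Cmod_sqr; reflexivity).
      assert (HD : forall u v e, (Cmod u <= M -> Cmod v <= M -> Cmod e <= eps ->
                Cmod (u * E1 s + v * E2 s + e)%C <= M * p + M * q + eps)%R).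
      { intros u v e Hu Hv He. eapply Rle_trans; [apply Cmod_triangle|].
        apply Rplus_le_compat; [|exact He].
        eapply Rle_trans; [apply Cmod_triangle|]. rewrite !Cmod_mult.
        apply Rplus_le_compat; apply Rmult_le_compat_r; assumption. }
      assert (HD1 : (Cmod (D1 s) <= M * p + M * q + eps)%R) by (apply HD; assumption).
      assert (HD2 : (Cmod (D2 s) <= M * p + M * q + eps)%R) by (apply HD; assumption).
      pose proof (Re_Im_dot_le (E1 s) (D1 s)) as K1. pose proof (Re_Im_dot_le (E2 s) (D2 s)) as K2.
      fold p in K1. fold q in K2.
      apply (Rmult_le_compat_l p) in HD1; [|exact Hp]. apply (Rmult_le_compat_l q) in HD2; [|exact Hq].
      assert (HMpos : (0 <= M)%R) by (eapply Rle_trans; [apply Cmod_ge_0 | exact B1]).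
      assert (Hdn : (dn s <= 2 * (p + q) * (M * p + M * q + eps))%R) by (unfold dn; lra).
      assert (Hin : (dn s - L * n s <= 2 * (eps * eps))%R).
      { rewrite Hn2. unfold L. pose proof (Rle_0_sqr (p - q)). unfold Rsqr in H.
        pose proof (Rle_0_sqr (p - eps)) as S1. pose proof (Rle_0_sqr (q - eps)) as S2. unfold Rsqr in S1, S2.
        assert (0 <= M * ((p - q) * (p - q)))%R by (apply Rmult_le_pos; assumption).
        lra. }
      assert (He1 : (exp (- L * s) <= 1)%R).
      { rewrite <- exp_0. assert (0 <= L * s)%R by (apply Rmult_le_pos; unfold L; lra).
        destruct (Req_dec (L * s) 0) as [E|E].
        - right. f_equal. lra.
        - left. apply exp_increasing. lra. }
      pose proof (exp_pos (- L * s)).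
      assert (0 <= eps * eps)%R by apply Rle_0_sqr.
      apply Rle_trans with (exp (- L * s) * (2 * (eps * eps)) - 2 * (eps * eps))%R.
      + apply Rplus_le_compat_r, Rmult_le_compat_l; lra.
      + assert (exp (- L * s) * (2 * (eps * eps)) <= 1 * (2 * (eps * eps)))%R by (apply Rmult_le_compat_r; lra).
        lra. }
  unfold phi in Hphi.
  replace (n 0%R) with 0%R in Hphi by (unfold n; rewrite Z1, Z2; simpl; ring).
  replace (- L * 1)%R with (- L)%R in Hphi by ring. rewrite exp_Ropp in Hphi.
  pose proof (exp_pos L) as HL.
  assert (Hfin : (n 1 <= exp L * (2 * (eps * eps)))%R).
  { replace (n 1%R) with (exp L * (/ exp L * n 1))%R by (field; lra).
    apply Rmult_le_compat_l; lra. }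
  rewrite Cmod_sqr. unfold n in Hfin.
  pose proof (Rle_0_sqr (Re (E2 1%R))). pose proof (Rle_0_sqr (Im (E2 1%R))). unfold Rsqr in *. lra.
Qed.

(** * Integrals of complex-valued functions and differentiation under the integral sign *)

Definition CInt (f : R -> C) (a b : R) : C :=
  (RInt (fun t => Re (f t)) a b, RInt (fun t => Im (f t)) a b).

Definition Ccontinuous (f : R -> C) : Prop :=
  (forall t, continuous (fun t => Re (f t)) t) /\ (forall t, continuous (fun t => Im (f t)) t).

Lemma continuous_of_2d (f : R -> R -> R) (s t : R) : continuity_2d_pt f s t -> continuous (f s) t.
Proof.
  intros H. apply continuity_2d_pt_filterlim in H.
  intros Q HQ. destruct (H Q HQ) as [eps He]. exists eps. intros y Hy.
  apply (He (s, y)). split; [apply ball_center | exact Hy].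
Qed.

Lemma Ccontinuous_of_2 (f : R -> R -> C) (s : R) :
  (forall t, Ccontinuous2 f s t) -> Ccontinuous (f s).
Proof.
  intros H; split; intros t; [apply (continuous_of_2d (fun s t => Re (f s t))) | apply (continuous_of_2d (fun s t => Im (f s t)))];
    apply H.
Qed.

Lemma ex_RInt_of_continuous (f : R -> R) (a b : R) : (forall t, continuous f t) -> ex_RInt f a b.
Proof. intros H. apply (ex_RInt_continuous (V := R_CompleteNormedModule)). intros z _. apply H. Qed.

Lemma is_RInt_CInt (f : R -> C) (a b : R) : Ccontinuous f ->
  @is_RInt C_R_NormedModule f a b (CInt f a b).
Proof.
  intros [H1 H2].
  apply (is_RInt_fct_extend_pair (U := R_NormedModule) (V := R_NormedModule) f);
    apply (RInt_correct (V := R_CompleteNormedModule)), ex_RInt_of_continuous; assumption.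
Qed.

Lemma CInt_ext (f g : R -> C) (a b : R) : (forall t, f t = g t) -> CInt f a b = CInt g a b.
Proof.
  intros E. unfold CInt. f_equal; apply RInt_ext; intros t _; now rewrite E.
Qed.

Lemma CInt_plus (f g : R -> C) (a b : R) : Ccontinuous f -> Ccontinuous g ->
  CInt (fun t => f t + g t) a b = CInt f a b + CInt g a b.
Proof.
  intros [F1 F2] [G1 G2]. unfold CInt, Cplus. f_equal;
    apply (RInt_plus (V := R_CompleteNormedModule)); apply ex_RInt_of_continuous; assumption.
Qed.

Lemma CInt_scal (c : C) (f : R -> C) (a b : R) : Ccontinuous f ->
  CInt (fun t => c * f t) a b = c * CInt f a b.
Proof.
  intros [F1 F2]. unfold CInt, Cmult. simpl.
  pose proof (ex_RInt_of_continuous _ a b F1) as I1. pose proof (ex_RInt_of_continuous _ a b F2) as I2.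
  apply (RInt_correct (V := R_CompleteNormedModule)) in I1.
  apply (RInt_correct (V := R_CompleteNormedModule)) in I2.
  f_equal; apply (is_RInt_unique (V := R_CompleteNormedModule)).
  - exact (is_RInt_minus (V := R_NormedModule) _ _ _ _ _ _ (is_RInt_scal (V := R_NormedModule) _ _ _ (fst c) _ I1)
      (is_RInt_scal (V := R_NormedModule) _ _ _ (snd c) _ I2)).
  - exact (is_RInt_plus (V := R_NormedModule) _ _ _ _ _ _ (is_RInt_scal (V := R_NormedModule) _ _ _ (fst c) _ I2)
      (is_RInt_scal (V := R_NormedModule) _ _ _ (snd c) _ I1)).
Qed.

Lemma CInt_derive (F f : R -> C) (a b : R) :
  (forall t, is_Cderive F t (f t)) -> Ccontinuous f -> CInt f a b = F b - F a.
Proof.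
  intros H [F1 F2]. unfold CInt.
  replace (F b - F a) with (Re (F b) - Re (F a), Im (F b) - Im (F a))%R by (unfold Cminus, Cplus, Copp; reflexivity).
  f_equal; apply (is_RInt_unique (V := R_CompleteNormedModule)).
  - apply (is_RInt_derive (V := R_CompleteNormedModule) (fun t => Re (F t))); intros t _; [apply H | apply F1].
  - apply (is_RInt_derive (V := R_CompleteNormedModule) (fun t => Im (F t))); intros t _; [apply H | apply F2].
Qed.

Lemma is_derive_RInt_continuous (f g : R -> R -> R) (a b s : R) :
  (forall s t, is_derive (fun s => f s t) s (g s t)) ->
  (forall s t, continuity_2d_pt g s t) -> (forall s t, continuous (f s) t) ->
  is_derive (fun s => RInt (f s) a b) s (RInt (g s) a b).
Proof.
  intros Hd Hg Hf.
  assert (E : forall s t, Derive (fun u => f u t) s = g s t) by (intros; apply is_derive_unique, Hd).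
  evar_last.
  - apply (is_derive_RInt_param f a b s).
    + apply filter_forall. intros y t _. eexists; apply Hd.
    + intros t _. apply continuity_2d_pt_ext with (f := g); [|apply Hg].
      intros x y. symmetry. apply E.
    + apply filter_forall. intros y. apply ex_RInt_of_continuous, Hf.
  - apply RInt_ext. intros t _. apply E.
Qed.

Lemma is_Cderive_CInt (f g : R -> R -> C) (a b s : R) :
  (forall s t, is_Cderive (fun s => f s t) s (g s t)) ->
  (forall s t, Ccontinuous2 g s t) -> (forall s t, Ccontinuous2 f s t) ->
  is_Cderive (fun s => CInt (f s) a b) s (CInt (g s) a b).
Proof.
  intros Hd Hg Hf; split; simpl.
  - apply (is_derive_RInt_continuous (fun s t => Re (f s t)) (fun s t => Re (g s t))).
    + intros; apply Hd.
    + intros; apply Hg.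
    + intros s' t. apply (continuous_of_2d (fun s t => Re (f s t))), Hf.
  - apply (is_derive_RInt_continuous (fun s t => Im (f s t)) (fun s t => Im (g s t))).
    + intros; apply Hd.
    + intros; apply Hg.
    + intros s' t. apply (continuous_of_2d (fun s t => Im (f s t))), Hf.
Qed.

(** * Growth slower than every Gaussian, uniformly in the deformation parameter *)

Definition subgaussian (f : R -> R -> C) : Prop :=
  forall eps, (0 < eps)%R -> exists K, forall s t, (0 <= s <= 1)%R -> (Cmod (f s t) <= K * exp (eps * t ^ 2))%R.

Lemma exp_sqr_ge_1 (eps t : R) : (0 < eps)%R -> (1 <= exp (eps * t ^ 2))%R.
Proof.
  intros He. pose proof (exp_ineq1_le (eps * t ^ 2)). assert (0 <= eps * t ^ 2)%R by nra. lra.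
Qed.

Lemma subgaussian_bounded (f : R -> R -> C) (K : R) :
  (forall s t, (0 <= s <= 1)%R -> (Cmod (f s t) <= K)%R) -> subgaussian f.
Proof.
  intros H eps He. exists K. intros s t Hs. pose proof (H s t Hs). pose proof (Cmod_ge_0 (f s t)).
  pose proof (exp_sqr_ge_1 eps t He). nra.
Qed.

Lemma subgaussian_const (c : C) : subgaussian (fun _ _ => c).
Proof. apply subgaussian_bounded with (Cmod c). intros; lra. Qed.

Lemma subgaussian_fst : subgaussian (fun s _ => RtoC s).
Proof.
  apply subgaussian_bounded with 1%R. intros s t Hs. rewrite Cmod_R, Rabs_pos_eq; lra.
Qed.

Lemma subgaussian_snd : subgaussian (fun _ t => RtoC t).
Proof.
  intros eps He. exists (1 + / eps)%R. intros s t _. rewrite Cmod_R.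
  pose proof (exp_ineq1_le (eps * t ^ 2)) as H.
  assert (Hi : (0 < / eps)%R) by (apply Rinv_0_lt_compat, He).
  assert (Ht : (Rabs t <= 1 + t ^ 2)%R).
  { rewrite <- pow2_abs. pose proof (Rabs_pos t). nra. }
  assert (E : (/ eps * (eps * t ^ 2) = t ^ 2)%R) by (field; lra).
  assert (0 <= eps * t ^ 2)%R by nra.
  apply (Rmult_le_compat_l (1 + / eps)) in H; [|lra]. nra.
Qed.

Lemma subgaussian_plus f g : subgaussian f -> subgaussian g -> subgaussian (fun s t => f s t + g s t).
Proof.
  intros Hf Hg eps He. destruct (Hf eps He) as [K HK], (Hg eps He) as [L HL].
  exists (K + L)%R. intros s t Hs. eapply Rle_trans; [apply Cmod_triangle|].
  specialize (HK s t Hs). specialize (HL s t Hs). lra.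
Qed.

Lemma subgaussian_opp f : subgaussian f -> subgaussian (fun s t => - f s t).
Proof.
  intros Hf eps He. destruct (Hf eps He) as [K HK]. exists K. intros s t Hs. rewrite Cmod_opp. apply HK, Hs.
Qed.

Lemma subgaussian_minus f g : subgaussian f -> subgaussian g -> subgaussian (fun s t => f s t - g s t).
Proof. intros Hf Hg. apply subgaussian_plus; [|apply subgaussian_opp]; assumption. Qed.

(** Halving eps shows why the definition asks for every positive eps: the class becomes an algebra,
    containing the polynomial coefficients as well as products of two Airy solutions. *)
Lemma subgaussian_mult f g : subgaussian f -> subgaussian g -> subgaussian (fun s t => f s t * g s t).
Proof.
  intros Hf Hg eps He. destruct (Hf (eps / 2)%R ltac:(lra)) as [K HK], (Hg (eps / 2)%R ltac:(lra)) as [L HL].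
  exists (K * L)%R. intros s t Hs. rewrite Cmod_mult.
  replace (eps * t ^ 2)%R with (eps / 2 * t ^ 2 + eps / 2 * t ^ 2)%R by field. rewrite exp_plus.
  replace (K * L * (exp (eps / 2 * t ^ 2) * exp (eps / 2 * t ^ 2)))%R
    with ((K * exp (eps / 2 * t ^ 2)) * (L * exp (eps / 2 * t ^ 2)))%R by ring.
  apply Rmult_le_compat; try apply Cmod_ge_0; [apply HK | apply HL]; exact Hs.
Qed.

Lemma subgaussian_pow f n : subgaussian f -> subgaussian (fun s t => f s t ^ n).
Proof.
  intros Hf. induction n as [|n IH]; [apply (subgaussian_const 1)|].
  apply (subgaussian_mult _ _ Hf IH).
Qed.

(** Order at most 2 with minimal type; the Airy functions have order 3/2. Composition with an
    argument bounded affinely in |t| turns this into [subgaussian]. *)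
Definition order_lt_2 (F : C -> C) : Prop :=
  forall eps, (0 < eps)%R -> exists K, forall z, (Cmod (F z) <= K * exp (eps * Cmod z ^ 2))%R.

Lemma subgaussian_comp_affine (F : C -> C) (u : R -> R -> C) (A B : R) : order_lt_2 F ->
  (forall s t, (0 <= s <= 1)%R -> (Cmod (u s t) <= A * Rabs t + B)%R) -> subgaussian (fun s t => F (u s t)).
Proof.
  intros HF Hu eps He.
  (* From (A |t| + B)^2 <= 2 A^2 t^2 + 2 B^2; the added 1 keeps the divisor positive when A = 0. *)
  set (A' := (2 * A ^ 2 + 1)%R). assert (HA : (0 < A')%R) by (unfold A'; nra).
  destruct (HF (eps / A')%R) as [K HK]; [apply Rdiv_lt_0_compat; assumption|].
  exists (Rabs K * exp (eps / A' * (2 * B ^ 2)))%R. intros s t Hs.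
  eapply Rle_trans; [apply HK|].
  rewrite Rmult_assoc, <- exp_plus.
  apply Rle_trans with (Rabs K * exp (eps / A' * Cmod (u s t) ^ 2))%R.
  { apply Rmult_le_compat_r; [apply Rlt_le, exp_pos | apply Rle_abs]. }
  apply Rmult_le_compat_l; [apply Rabs_pos|].
  assert (Hexp : forall x y, (x <= y -> exp x <= exp y)%R).
  { intros x y [Hl| ->]; [left; apply exp_increasing, Hl | right; reflexivity]. }
  apply Hexp.
  assert (Hsq : (Cmod (u s t) ^ 2 <= 2 * B ^ 2 + A' * t ^ 2)%R).
  { specialize (Hu s t Hs). pose proof (Cmod_ge_0 (u s t)).
    apply Rle_trans with ((A * Rabs t + B) ^ 2)%R; [apply pow_incr; lra|].
    unfold A'. rewrite <- (pow2_abs t). pose proof (pow2_ge_0 (A * Rabs t - B)). pose proof (pow2_ge_0 (Rabs t)). nra. }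
  apply Rle_trans with (eps / A' * (2 * B ^ 2 + A' * t ^ 2))%R.
  - apply Rmult_le_compat_l; [apply Rlt_le, Rdiv_lt_0_compat; assumption | exact Hsq].
  - right. field. lra.
Qed.

(** With eps = 1/2 a factor exp(-t^2/2) is left, and exp(t^2/2) >= (1 + t^2)/2. The bound K/(1 +
    t^2) serves twice: it sends the boundary terms to 0 at infinity and, through atan, gives
    absolute convergence. *)
Lemma subgaussian_gaussian_bound (f : R -> R -> C) : subgaussian f -> exists K, (0 <= K)%R /\
  forall s t, (0 <= s <= 1)%R -> (Cmod (RtoC (exp (- t ^ 2)) * f s t) <= K / (1 + t ^ 2))%R.
Proof.
  intros Hf. destruct (Hf (1 / 2)%R ltac:(lra)) as [K HK].
  exists (2 * Rabs K)%R. split; [pose proof (Rabs_pos K); lra|]. intros s t Hs. specialize (HK s t Hs).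
  rewrite Cmod_mult, Cmod_R, Rabs_pos_eq by (apply Rlt_le, exp_pos).
  apply Rle_trans with (exp (- t ^ 2) * (Rabs K * exp (1 / 2 * t ^ 2)))%R.
  { apply Rmult_le_compat_l; [apply Rlt_le, exp_pos|]. eapply Rle_trans; [exact HK|].
    apply Rmult_le_compat_r; [apply Rlt_le, exp_pos | apply Rle_abs]. }
  replace (exp (- t ^ 2) * (Rabs K * exp (1 / 2 * t ^ 2)))%R with (Rabs K * exp (- (t ^ 2 / 2)))%R.
  2:{ replace (exp (- (t ^ 2 / 2))) with (exp (- t ^ 2) * exp (1 / 2 * t ^ 2))%R
        by (rewrite <- exp_plus; f_equal; field). ring. }
  unfold Rdiv at 2. rewrite (Rmult_comm 2), Rmult_assoc.
  apply Rmult_le_compat_l; [apply Rabs_pos|]. rewrite exp_Ropp.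
  pose proof (exp_ineq1_le (t ^ 2 / 2)). pose proof (pow2_ge_0 t).
  apply Rle_trans with (/ ((1 + t ^ 2) / 2))%R.
  - apply Rinv_le_contravar; lra.
  - right. field. lra.
Qed.

Lemma order_lt_2_const (c : C) : order_lt_2 (fun _ => c).
Proof.
  intros eps He. exists (Cmod c). intros z. pose proof (exp_sqr_ge_1 eps (Cmod z) He).
  pose proof (Cmod_ge_0 c). nra.
Qed.

Lemma order_lt_2_id : order_lt_2 (fun z => z).
Proof.
  intros eps He. destruct (subgaussian_snd eps He) as [K HK]. exists K. intros z.
  specialize (HK 0%R (Cmod z) ltac:(lra)). rewrite Cmod_R, Rabs_pos_eq in HK by apply Cmod_ge_0. exact HK.
Qed.

Lemma order_lt_2_plus F G : order_lt_2 F -> order_lt_2 G -> order_lt_2 (fun z => F z + G z).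
Proof.
  intros HF HG eps He. destruct (HF eps He) as [K HK], (HG eps He) as [L HL].
  exists (K + L)%R. intros z. eapply Rle_trans; [apply Cmod_triangle|].
  specialize (HK z). specialize (HL z). lra.
Qed.

Lemma order_lt_2_mult F G : order_lt_2 F -> order_lt_2 G -> order_lt_2 (fun z => F z * G z).
Proof.
  intros HF HG eps He. destruct (HF (eps / 2)%R ltac:(lra)) as [K HK], (HG (eps / 2)%R ltac:(lra)) as [L HL].
  exists (K * L)%R. intros z. rewrite Cmod_mult.
  replace (eps * Cmod z ^ 2)%R with (eps / 2 * Cmod z ^ 2 + eps / 2 * Cmod z ^ 2)%R by field. rewrite exp_plus.
  replace (K * L * (exp (eps / 2 * Cmod z ^ 2) * exp (eps / 2 * Cmod z ^ 2)))%R
    with ((K * exp (eps / 2 * Cmod z ^ 2)) * (L * exp (eps / 2 * Cmod z ^ 2)))%R by ring.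
  apply Rmult_le_compat; try apply Cmod_ge_0; [apply HK | apply HL].
Qed.

Lemma order_lt_2_pow n : order_lt_2 (fun z => z ^ n).
Proof.
  induction n as [|n IH]; [apply (order_lt_2_const 1)|].
  apply (order_lt_2_mult _ _ order_lt_2_id IH).
Qed.

Lemma order_lt_2_y0F1_cube (c : R) : (/ 2 <= c)%R -> order_lt_2 (fun z => y0F1 c (z ^ 3 * RtoC (1 / 9))).
Proof.
  intros Hc eps He.
  (* 2/9 |z|^3 <= (k^3 + d |z|^2)^2 when k d = 1 *)
  set (d := (eps / 2)%R). set (k := (/ d)%R).
  assert (Hd : (0 < d)%R) by (unfold d; lra).
  assert (Hk : (0 < k)%R) by (apply Rinv_0_lt_compat, Hd).
  assert (Hkd : (k * d = 1)%R) by (unfold k; field; lra).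
  exists (exp (2 * k ^ 3)). intros z. rewrite <- exp_plus.
  set (r := Cmod z). assert (Hr : (0 <= r)%R) by apply Cmod_ge_0.
  replace (2 * k ^ 3 + eps * r ^ 2)%R with (2 * (k ^ 3 + d * r ^ 2))%R by (unfold d; field).
  pose proof (pow_lt k 3 Hk). pose proof (pow2_ge_0 r). pose proof (pow_le r 3 Hr).
  assert (0 <= d * r ^ 2)%R by (apply Rmult_le_pos; lra).
  apply y0F1_growth; [exact Hc | lra |].
  rewrite Cmod_mult, Cmod_pow, Cmod_R, Rabs_pos_eq by lra. fold r.
  assert (Hs : (0 <= (d * r ^ 2 - k * r) ^ 2)%R) by apply pow2_ge_0.
  assert (E1 : ((d * r ^ 2 - k * r) ^ 2 = (d * r ^ 2) ^ 2 - 2 * (k * d) * r ^ 3 + (k * r) ^ 2)%R) by ring.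
  assert (E2 : ((k ^ 3 + d * r ^ 2) * (k ^ 3 + d * r ^ 2)
     = (k ^ 3) ^ 2 + 2 * (k * d) * (k * r) ^ 2 + (d * r ^ 2) ^ 2)%R) by ring.
  rewrite Hkd in E1, E2. rewrite E2.
  pose proof (pow2_ge_0 (k ^ 3)). pose proof (pow2_ge_0 (k * r)). lra.
Qed.

(** * Differential equations of the special functions *)

(** Each step contributes (3k+1)(3k+2)(3k+3) = 27 (k+1/3)(k+2/3)(k+1). In the Maclaurin series of
    [airy_f] the factor (1/3)_k then cancels, which leaves 0F1 with parameter 2/3 at z^3/9. *)
Lemma rpoch_fact_3k (k : nat) :
  (INR (fact (3 * k)) = 27 ^ k * INR (fact k) * rpoch (1 / 3) k * rpoch (2 / 3) k)%R.
Proof.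
  induction k as [|k IH]; [simpl; ring|].
  replace (3 * S k)%nat with (S (S (S (3 * k)))) by lia.
  rewrite !fact_simpl, !mult_INR, IH. rewrite !S_INR, mult_INR. simpl. field.
Qed.

Lemma rpoch_fact_3k1 (k : nat) :
  (INR (fact (3 * k + 1)) = 27 ^ k * INR (fact k) * rpoch (2 / 3) k * rpoch (4 / 3) k)%R.
Proof.
  induction k as [|k IH]; [simpl; ring|].
  replace (3 * S k + 1)%nat with (S (S (S (3 * k + 1)))) by lia.
  rewrite !fact_simpl, !mult_INR, IH. rewrite !S_INR, plus_INR, mult_INR. simpl. field.
Qed.

Lemma airy_f_0F1 (z : C) : airy_f z = y0F1 (2 / 3) (z ^ 3 * RtoC (1 / 9)).
Proof.
  unfold airy_f. apply CSeries_unique.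
  apply is_Cseries_ext with (2 := is_Cseries_0F1 (2 / 3) (z ^ 3 * RtoC (1 / 9)) ltac:(lra)).
  intros k.
  replace (1 / 3) with (RtoC (1 / 3)) by (apply RtoC_div; lra).
  rewrite pochhammer_RtoC, Cpow_mult_l, Cpow_mult_r.
  rewrite <- !RtoC_pow.
  assert (E : (3 ^ k * rpoch (1 / 3) k * / INR (fact (3 * k)) = (1 / 9) ^ k * coef0F1 (2 / 3) k)%R).
  { rewrite rpoch_fact_3k. unfold coef0F1.
    pose proof (rpoch_pos (1 / 3) k ltac:(lra)). pose proof (rpoch_pos (2 / 3) k ltac:(lra)).
    pose proof (INR_fact_neq_0 k). pose proof (pow_lt 3 k ltac:(lra)). pose proof (pow_lt 9 k ltac:(lra)).
    replace ((1 / 9) ^ k)%R with (/ 9 ^ k)%R by (unfold Rdiv; rewrite Rmult_1_l, pow_inv; reflexivity).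
    replace 27%R with (3 * 9)%R by ring. rewrite Rpow_mult_distr.
    field. repeat split; lra. }
  unfold Cdiv. rewrite <- RtoC_inv by apply INR_fact_neq_0.
  transitivity ((z ^ 3) ^ k * RtoC ((1 / 9) ^ k * coef0F1 (2 / 3) k)); [rewrite RtoC_mult; ring|].
  rewrite <- E, !RtoC_mult. ring.
Qed.

Lemma airy_g_0F1 (z : C) : airy_g z = z * y0F1 (4 / 3) (z ^ 3 * RtoC (1 / 9)).
Proof.
  unfold airy_g. apply CSeries_unique.
  apply is_Cseries_ext with (2 := is_Cseries_scal z _ _ (is_Cseries_0F1 (4 / 3) (z ^ 3 * RtoC (1 / 9)) ltac:(lra))).
  intros k.
  replace (2 / 3) with (RtoC (2 / 3)) by (apply RtoC_div; lra).
  rewrite pochhammer_RtoC, Cpow_mult_l, Cpow_add_r, Cpow_mult_r.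
  rewrite <- !RtoC_pow.
  assert (E : (3 ^ k * rpoch (2 / 3) k * / INR (fact (3 * k + 1)) = (1 / 9) ^ k * coef0F1 (4 / 3) k)%R).
  { rewrite rpoch_fact_3k1. unfold coef0F1.
    pose proof (rpoch_pos (4 / 3) k ltac:(lra)). pose proof (rpoch_pos (2 / 3) k ltac:(lra)).
    pose proof (INR_fact_neq_0 k). pose proof (pow_lt 3 k ltac:(lra)). pose proof (pow_lt 9 k ltac:(lra)).
    replace ((1 / 9) ^ k)%R with (/ 9 ^ k)%R by (unfold Rdiv; rewrite Rmult_1_l, pow_inv; reflexivity).
    replace 27%R with (3 * 9)%R by ring. rewrite Rpow_mult_distr.
    field. repeat split; lra. }
  unfold Cdiv. rewrite <- RtoC_inv by apply INR_fact_neq_0.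
  transitivity (z * ((z ^ 3) ^ k * RtoC ((1 / 9) ^ k * coef0F1 (4 / 3) k))); [rewrite RtoC_mult; ring|].
  rewrite <- E, !RtoC_mult. simpl (z ^ 1). ring.
Qed.

Definition preserves_continuity (F : C -> C) : Prop :=
  forall f s t, Ccontinuous2 f s t -> Ccontinuous2 (fun s t => F (f s t)) s t.

(** What the deformation uses about a solution of y'' = z y, collected so that one argument serves
    both Maclaurin solutions; continuity feeds the differentiation under the integral, growth the
    boundary terms. *)
Record airy_solution (U U' : C -> C) : Prop := {
  airy_holo : holo U U';
  airy_holo' : holo U' (fun z => z * U z);
  airy_cont : preserves_continuity U;
  airy_cont' : preserves_continuity U';
  airy_order : order_lt_2 U;
  airy_order' : order_lt_2 U' }.

Definition kernel_solution (h h' : C -> C) : Prop :=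
  holo h h' /\ holo h' (fun z => 16 * z ^ 4 * h z).

Lemma holo_y0F1_pow (c k : R) (m : nat) : (/ 2 <= c)%R ->
  holo (fun z => y0F1 c (z ^ S m * RtoC k))
       (fun z => RtoC (k * INR (S m) / c) * z ^ m * y0F1 (c + 1) (z ^ S m * RtoC k)).
Proof.
  intros Hc. eapply holo_eq.
  - eapply (holo_comp (y0F1 c) _ (fun z => z ^ S m * RtoC k)); [apply holo_y0F1, Hc|].
    apply holo_mult; [apply holo_pow | apply holo_const].
  - intros z. cbv beta. unfold Rdiv. rewrite !RtoC_mult. ring.
Qed.

Lemma preserves_continuity_y0F1_pow (c k : R) (m : nat) : (/ 2 <= c)%R ->
  preserves_continuity (fun z => y0F1 c (z ^ m * RtoC k)).
Proof.
  intros Hc f s t Hf.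
  apply (Ccontinuous2_comp (y0F1 c) (fun s t => f s t ^ m * RtoC k)); [apply locally_lipschitz_y0F1, Hc|].
  apply Ccontinuous2_mult; [apply Ccontinuous2_pow, Hf | apply Ccontinuous2_const].
Qed.

Lemma preserves_continuity_mult F G :
  preserves_continuity F -> preserves_continuity G -> preserves_continuity (fun z => F z * G z).
Proof. intros HF HG f s t Hf. apply Ccontinuous2_mult; [apply HF | apply HG]; exact Hf. Qed.

Lemma preserves_continuity_plus F G :
  preserves_continuity F -> preserves_continuity G -> preserves_continuity (fun z => F z + G z).
Proof. intros HF HG f s t Hf. apply Ccontinuous2_plus; [apply HF | apply HG]; exact Hf. Qed.

Lemma preserves_continuity_pow n : preserves_continuity (fun z => z ^ n).
Proof. intros f s t Hf. apply Ccontinuous2_pow, Hf. Qed.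

Lemma preserves_continuity_const c : preserves_continuity (fun _ => c).
Proof. intros f s t _. apply Ccontinuous2_const. Qed.

Lemma preserves_continuity_id : preserves_continuity (fun z => z).
Proof. intros f s t Hf. exact Hf. Qed.

Lemma holo_plus (F F' G G' : C -> C) :
  holo F F' -> holo G G' -> holo (fun z => F z + G z) (fun z => F' z + G' z).
Proof.
  intros HF HG g x l H. eapply is_Cderive_eq; [apply is_Cderive_plus; [apply HF, H | apply HG, H]|].
  ring.
Qed.

Definition airy_f' (z : C) : C := RtoC (1 / 2) * z ^ 2 * y0F1 (5 / 3) (z ^ 3 * RtoC (1 / 9)).

Definition airy_g' (z : C) : C :=
  y0F1 (4 / 3) (z ^ 3 * RtoC (1 / 9)) + RtoC (1 / 4) * z ^ 3 * y0F1 (7 / 3) (z ^ 3 * RtoC (1 / 9)).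

Lemma holo_ext (F G F' : C -> C) : (forall z, F z = G z) -> holo F F' -> holo G F'.
Proof.
  intros E H g x l Hg. apply is_Cderive_ext with (f := fun t => F (g t)); [intros; apply E | apply H, Hg].
Qed.

Lemma preserves_continuity_ext (F G : C -> C) :
  (forall z, F z = G z) -> preserves_continuity F -> preserves_continuity G.
Proof.
  intros E H f s t Hf. destruct (H f s t Hf) as [H1 H2]. split.
  - apply continuity_2d_pt_ext with (2 := H1). intros; now rewrite E.
  - apply continuity_2d_pt_ext with (2 := H2). intros; now rewrite E.
Qed.

Lemma order_lt_2_ext (F G : C -> C) : (forall z, F z = G z) -> order_lt_2 F -> order_lt_2 G.
Proof.
  intros E H eps He. destruct (H eps He) as [K HK]. exists K. intros z. rewrite <- E. apply HK.
Qed.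

Lemma airy_solution_f : airy_solution airy_f airy_f'.
Proof.
  split.
  - apply (holo_ext (fun z => y0F1 (2 / 3) (z ^ 3 * RtoC (1 / 9)))); [intros; symmetry; apply airy_f_0F1|].
    eapply holo_eq; [apply holo_y0F1_pow; lra|]. intros z. unfold airy_f'.
    replace (2 / 3 + 1)%R with (5 / 3)%R by field.
    replace (1 / 9 * INR 3 / (2 / 3))%R with (1 / 2)%R by (simpl; field). reflexivity.
  - eapply holo_eq.
    + unfold airy_f'. apply holo_mult; [apply holo_mult; [apply holo_const | apply holo_pow]|].
      apply holo_y0F1_pow; lra.
    + intros z. cbv beta. rewrite airy_f_0F1.
      (* The product rule has produced the parameters 5/3 and 8/3; contiguity expresses [airy_f]
         through the same two functions, so that their coefficients can be compared. *)
      rewrite (y0F1_contiguous (2 / 3)) by lra.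
      replace (2 / 3 + 1)%R with (5 / 3)%R by field. replace (5 / 3 + 1)%R with (8 / 3)%R by field.
      replace (1 / 9 * INR 3 / (5 / 3))%R with (1 / 5)%R by (simpl; field).
      replace (/ (2 / 3 * (5 / 3)))%R with (9 / 10)%R by field.
      replace (RtoC (INR 2)) with (RtoC 2) by (f_equal; simpl; ring).
      set (y := y0F1 (5 / 3) _). set (y' := y0F1 (8 / 3) _).
      (* All fractions are expressed through k = (1/9)(9/10) = 1/10, which reduces the comparison to
         integer coefficients and the relation k * 10 = 1. *)
      replace (RtoC (1 / 2)) with (RtoC (1 / 9) * RtoC (9 / 10) * 5) by (rewrite <- !RtoC_mult; f_equal; field).
      replace (RtoC (1 / 5)) with (RtoC (1 / 9) * RtoC (9 / 10) * 2) by (rewrite <- !RtoC_mult; f_equal; field).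
      set (k := RtoC (1 / 9) * RtoC (9 / 10)).
      assert (Hk : k * 10 = 1) by (unfold k; rewrite <- !RtoC_mult; f_equal; field).
      transitivity (k * 10 * z * y + (k * 10) * (k * z ^ 4 * y')); [simpl; ring|]. rewrite Hk.
      unfold k. simpl. ring.
  - apply (preserves_continuity_ext (fun z => y0F1 (2 / 3) (z ^ 3 * RtoC (1 / 9)))); [intros; symmetry; apply airy_f_0F1|].
    apply preserves_continuity_y0F1_pow; lra.
  - apply preserves_continuity_mult; [apply preserves_continuity_mult|apply preserves_continuity_y0F1_pow; lra];
      [apply preserves_continuity_const | apply preserves_continuity_pow].
  - apply (order_lt_2_ext (fun z => y0F1 (2 / 3) (z ^ 3 * RtoC (1 / 9)))); [intros; symmetry; apply airy_f_0F1|].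
    apply order_lt_2_y0F1_cube; lra.
  - apply order_lt_2_mult; [apply order_lt_2_mult; [apply order_lt_2_const | apply order_lt_2_pow]|].
    apply order_lt_2_y0F1_cube; lra.
Qed.

Lemma airy_solution_g : airy_solution airy_g airy_g'.
Proof.
  split.
  - apply (holo_ext (fun z => z * y0F1 (4 / 3) (z ^ 3 * RtoC (1 / 9)))); [intros; symmetry; apply airy_g_0F1|].
    eapply holo_eq; [apply holo_mult; [apply holo_id | apply holo_y0F1_pow; lra]|]. intros z. unfold airy_g'.
    replace (4 / 3 + 1)%R with (7 / 3)%R by field.
    replace (1 / 9 * INR 3 / (4 / 3))%R with (1 / 4)%R by (simpl; field). simpl. ring.
  - eapply holo_eq.
    + unfold airy_g'. apply holo_plus; [apply holo_y0F1_pow; lra|].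
      apply holo_mult; [apply holo_mult; [apply holo_const | apply holo_pow]|].
      apply holo_y0F1_pow; lra.
    + intros z. cbv beta. rewrite airy_g_0F1.
      rewrite (y0F1_contiguous (4 / 3)) by lra.
      replace (4 / 3 + 1)%R with (7 / 3)%R by field. replace (7 / 3 + 1)%R with (10 / 3)%R by field.
      replace (1 / 9 * INR 3 / (4 / 3))%R with (1 / 4)%R by (simpl; field).
      replace (1 / 9 * INR 3 / (7 / 3))%R with (1 / 7)%R by (simpl; field).
      replace (/ (4 / 3 * (7 / 3)))%R with (9 / 28)%R by field.
      set (y := y0F1 (7 / 3) _). set (y' := y0F1 (10 / 3) _).
      replace (RtoC (INR 3)) with (RtoC 3) by (f_equal; simpl; ring).
      assert (H1 : RtoC (1 / 4) * 4 = 1) by (rewrite <- RtoC_mult; f_equal; field).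
      assert (H2 : RtoC (1 / 4) * RtoC (1 / 7) = RtoC (1 / 9) * RtoC (9 / 28)) by (rewrite <- !RtoC_mult; f_equal; field).
      transitivity (RtoC (1 / 4) * 4 * z ^ 2 * y + RtoC (1 / 4) * RtoC (1 / 7) * z ^ 5 * y'); [simpl; ring|].
      rewrite H1, H2. simpl. ring.
  - apply (preserves_continuity_ext (fun z => z * y0F1 (4 / 3) (z ^ 3 * RtoC (1 / 9)))); [intros; symmetry; apply airy_g_0F1|].
    apply preserves_continuity_mult; [apply preserves_continuity_id | apply preserves_continuity_y0F1_pow; lra].
  - apply preserves_continuity_plus; [apply preserves_continuity_y0F1_pow; lra|].
    apply preserves_continuity_mult; [apply preserves_continuity_mult|apply preserves_continuity_y0F1_pow; lra];
      [apply preserves_continuity_const | apply preserves_continuity_pow].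
  - apply (order_lt_2_ext (fun z => z * y0F1 (4 / 3) (z ^ 3 * RtoC (1 / 9)))); [intros; symmetry; apply airy_g_0F1|].
    apply order_lt_2_mult; [apply order_lt_2_id | apply order_lt_2_y0F1_cube; lra].
  - apply order_lt_2_plus; [apply order_lt_2_y0F1_cube; lra|].
    apply order_lt_2_mult; [apply order_lt_2_mult; [apply order_lt_2_const | apply order_lt_2_pow]|].
    apply order_lt_2_y0F1_cube; lra.
Qed.

(** [kernel_f] and [kernel_g] are the solutions of h'' = 16 z^4 h with (h(0), h'(0)) equal to (1, 0)
    and (0, 1). *)
Definition kernel_f (z : C) : C := y0F1 (5 / 6) (z ^ 6 * RtoC (4 / 9)).
Definition kernel_f' (z : C) : C := RtoC (16 / 5) * z ^ 5 * y0F1 (11 / 6) (z ^ 6 * RtoC (4 / 9)).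
Definition kernel_g (z : C) : C := z * y0F1 (7 / 6) (z ^ 6 * RtoC (4 / 9)).
Definition kernel_g' (z : C) : C :=
  y0F1 (7 / 6) (z ^ 6 * RtoC (4 / 9)) + RtoC (16 / 7) * z ^ 6 * y0F1 (13 / 6) (z ^ 6 * RtoC (4 / 9)).

Lemma kernel_solution_f : kernel_solution kernel_f kernel_f'.
Proof.
  split.
  - unfold kernel_f. eapply holo_eq; [apply holo_y0F1_pow; lra|]. intros z. unfold kernel_f'.
    replace (5 / 6 + 1)%R with (11 / 6)%R by field.
    replace (4 / 9 * INR 6 / (5 / 6))%R with (16 / 5)%R by (simpl; field). reflexivity.
  - eapply holo_eq.
    + unfold kernel_f'. apply holo_mult; [apply holo_mult; [apply holo_const | apply holo_pow]|].
      apply holo_y0F1_pow; lra.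
    + intros z. cbv beta. unfold kernel_f.
      rewrite (y0F1_contiguous (5 / 6)) by lra.
      replace (5 / 6 + 1)%R with (11 / 6)%R by field. replace (11 / 6 + 1)%R with (17 / 6)%R by field.
      replace (4 / 9 * INR 6 / (11 / 6))%R with (16 / 11)%R by (simpl; field).
      replace (/ (5 / 6 * (11 / 6)))%R with (36 / 55)%R by field.
      set (y := y0F1 (11 / 6) _). set (y' := y0F1 (17 / 6) _).
      replace (RtoC (INR 5)) with (RtoC 5) by (f_equal; simpl; ring).
      assert (H1 : RtoC (16 / 5) * 5 = 16) by (rewrite <- RtoC_mult; f_equal; field).
      assert (H2 : RtoC (16 / 5) * RtoC (16 / 11) = 16 * RtoC (4 / 9) * RtoC (36 / 55)) by (rewrite <- !RtoC_mult; f_equal; field).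
      transitivity (RtoC (16 / 5) * 5 * z ^ 4 * y + RtoC (16 / 5) * RtoC (16 / 11) * z ^ 10 * y'); [simpl; ring|].
      rewrite H1, H2. simpl. ring.
Qed.

Lemma kernel_solution_g : kernel_solution kernel_g kernel_g'.
Proof.
  split.
  - unfold kernel_g. eapply holo_eq; [apply holo_mult; [apply holo_id | apply holo_y0F1_pow; lra]|]. intros z. unfold kernel_g'.
    replace (7 / 6 + 1)%R with (13 / 6)%R by field.
    replace (4 / 9 * INR 6 / (7 / 6))%R with (16 / 7)%R by (simpl; field). simpl. ring.
  - eapply holo_eq.
    + unfold kernel_g'. apply holo_plus; [apply holo_y0F1_pow; lra|].
      apply holo_mult; [apply holo_mult; [apply holo_const | apply holo_pow]|].
      apply holo_y0F1_pow; lra.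
    + intros z. cbv beta. unfold kernel_g.
      rewrite (y0F1_contiguous (7 / 6)) by lra.
      replace (7 / 6 + 1)%R with (13 / 6)%R by field. replace (13 / 6 + 1)%R with (19 / 6)%R by field.
      replace (4 / 9 * INR 6 / (7 / 6))%R with (16 / 7)%R by (simpl; field).
      replace (4 / 9 * INR 6 / (13 / 6))%R with (16 / 13)%R by (simpl; field).
      replace (/ (7 / 6 * (13 / 6)))%R with (36 / 91)%R by field.
      set (y := y0F1 (13 / 6) _). set (y' := y0F1 (19 / 6) _).
      replace (RtoC (INR 6)) with (RtoC 6) by (f_equal; simpl; ring).
      assert (H1 : RtoC (16 / 7) * 7 = 16) by (rewrite <- RtoC_mult; f_equal; field).
      assert (H2 : RtoC (16 / 7) * RtoC (16 / 13) = 16 * RtoC (4 / 9) * RtoC (36 / 91)) by (rewrite <- !RtoC_mult; f_equal; field).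
      transitivity (RtoC (16 / 7) * 7 * z ^ 5 * y + RtoC (16 / 7) * RtoC (16 / 13) * z ^ 11 * y'); [simpl; ring|].
      rewrite H1, H2. simpl. ring.
Qed.

(** * Deformation of the integral *)

Ltac Cderive_step :=
  lazymatch goal with
  | |- is_Cderive (fun x => @?f x + @?g x) ?x0 _ => eapply (is_Cderive_plus f g x0)
  | |- is_Cderive (fun x => @?f x - @?g x) ?x0 _ => eapply (is_Cderive_minus f g x0)
  | |- is_Cderive (fun x => - @?f x) ?x0 _ => eapply (is_Cderive_opp f x0)
  | |- is_Cderive (fun x => @?f x * @?g x) ?x0 _ => eapply (is_Cderive_mult f g x0)
  | |- is_Cderive (fun x => @?f x ^ S ?n) ?x0 _ => eapply (is_Cderive_pow f x0 _ n)
  | |- is_Cderive (fun x => RtoC x) ?x0 _ => eapply (is_Cderive_id x0)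
  | |- is_Cderive (fun _ => ?c) ?x0 _ => eapply (is_Cderive_const c x0)
  end.

Ltac Ccontinuous_step :=
  lazymatch goal with
  | |- Ccontinuous2 (fun s t => @?f s t + @?g s t) ?s0 ?t0 => apply (Ccontinuous2_plus f g s0 t0)
  | |- Ccontinuous2 (fun s t => @?f s t - @?g s t) ?s0 ?t0 => apply (Ccontinuous2_minus f g s0 t0)
  | |- Ccontinuous2 (fun s t => - @?f s t) ?s0 ?t0 => apply (Ccontinuous2_opp f s0 t0)
  | |- Ccontinuous2 (fun s t => @?f s t * @?g s t) ?s0 ?t0 => apply (Ccontinuous2_mult f g s0 t0)
  | |- Ccontinuous2 (fun s t => @?f s t ^ ?n) ?s0 ?t0 => apply (Ccontinuous2_pow f n s0 t0)
  | |- Ccontinuous2 (fun s t => RtoC s) ?s0 ?t0 => apply (Ccontinuous2_fst s0 t0)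
  | |- Ccontinuous2 (fun s t => RtoC t) ?s0 ?t0 => apply (Ccontinuous2_snd s0 t0)
  | |- Ccontinuous2 (fun _ _ => ?c) ?s0 ?t0 => apply (Ccontinuous2_const c s0 t0)
  end.

Ltac subgaussian_step :=
  lazymatch goal with
  | |- subgaussian (fun s t => @?f s t + @?g s t) => apply (subgaussian_plus f g)
  | |- subgaussian (fun s t => @?f s t - @?g s t) => apply (subgaussian_minus f g)
  | |- subgaussian (fun s t => - @?f s t) => apply (subgaussian_opp f)
  | |- subgaussian (fun s t => @?f s t * @?g s t) => apply (subgaussian_mult f g)
  | |- subgaussian (fun s t => @?f s t ^ ?n) => apply (subgaussian_pow f n)
  | |- subgaussian (fun s t => RtoC s) => apply subgaussian_fst
  | |- subgaussian (fun s t => RtoC t) => apply subgaussian_snd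
  | |- subgaussian (fun _ _ => ?c) => apply (subgaussian_const c)
  end.

Ltac Cderive_poly := cbv beta; repeat (Cderive_step; cbv beta).
Ltac Ccontinuous_poly := cbv beta; repeat (Ccontinuous_step; cbv beta).
Ltac subgaussian_poly := cbv beta; repeat (subgaussian_step; cbv beta).

(** The general bilinear form in the pairs (U, U') at u and at v. By U'' = z U its derivative is
    again of this form, so differentiation acts on the four coefficients alone, as [is_Cderive_bil]
    records. *)
Definition bil (U U' : C -> C) (c0 c1 c2 c3 u v : C) : C :=
  c0 * (U u * U v) + c1 * (U' u * U v) + c2 * (U u * U' v) + c3 * (U' u * U' v).

Lemma is_Cderive_bil (U U' : C -> C) (c0 c1 c2 c3 u v : R -> C) (x : R) (d0 d1 d2 d3 du dv : C) :
  airy_solution U U' ->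
  is_Cderive c0 x d0 -> is_Cderive c1 x d1 -> is_Cderive c2 x d2 -> is_Cderive c3 x d3 ->
  is_Cderive u x du -> is_Cderive v x dv ->
  is_Cderive (fun x => bil U U' (c0 x) (c1 x) (c2 x) (c3 x) (u x) (v x)) x
    (bil U U' (d0 + c1 x * du * u x + c2 x * dv * v x)
              (d1 + c0 x * du + c3 x * dv * v x)
              (d2 + c0 x * dv + c3 x * du * u x)
              (d3 + c1 x * dv + c2 x * du) (u x) (v x)).
Proof.
  intros [H H' _ _ _ _] H0 H1 H2 H3 Hu Hv.
  pose proof (H _ _ _ Hu) as Fu. pose proof (H _ _ _ Hv) as Fv.
  pose proof (H' _ _ _ Hu) as Fu'. pose proof (H' _ _ _ Hv) as Fv'.
  eapply is_Cderive_eq.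
  - unfold bil. Cderive_poly; eassumption.
  - unfold bil. cbv beta. ring.
Qed.

Lemma Ccontinuous2_bil (U U' : C -> C) (c0 c1 c2 c3 u v : R -> R -> C) (s t : R) :
  airy_solution U U' ->
  Ccontinuous2 c0 s t -> Ccontinuous2 c1 s t -> Ccontinuous2 c2 s t -> Ccontinuous2 c3 s t ->
  Ccontinuous2 u s t -> Ccontinuous2 v s t ->
  Ccontinuous2 (fun s t => bil U U' (c0 s t) (c1 s t) (c2 s t) (c3 s t) (u s t) (v s t)) s t.
Proof.
  intros [_ _ H H' _ _] H0 H1 H2 H3 Hu Hv.
  unfold bil. Ccontinuous_poly; first [assumption | apply H; assumption | apply H'; assumption].
Qed.

Lemma subgaussian_bil (U U' : C -> C) (c0 c1 c2 c3 u v : R -> R -> C) (A B : R) :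
  airy_solution U U' ->
  subgaussian c0 -> subgaussian c1 -> subgaussian c2 -> subgaussian c3 ->
  (forall s t, (0 <= s <= 1)%R -> (Cmod (u s t) <= A * Rabs t + B)%R) ->
  (forall s t, (0 <= s <= 1)%R -> (Cmod (v s t) <= A * Rabs t + B)%R) ->
  subgaussian (fun s t => bil U U' (c0 s t) (c1 s t) (c2 s t) (c3 s t) (u s t) (v s t)).
Proof.
  intros [_ _ _ _ H H'] H0 H1 H2 H3 Hu Hv.
  unfold bil. subgaussian_poly; first [assumption | eapply subgaussian_comp_affine; eassumption].
Qed.

(** The argument of the first Airy factor for the scaled pair (s a, s b). Exchanging a and b gives
    that of the second, since the shifts a (a^3 + 2 b^3) and b (b^3 + 2 a^3) are interchanged. *)
Definition arg_u (a b : C) (s t : R) : C := 2 * a * (RtoC s * RtoC t) - a * (a ^ 3 + 2 * b ^ 3) * RtoC s ^ 4.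

Definition gauss (t : R) : C := RtoC (exp (- t ^ 2)).

Section Deformation.

Variables (a b : C) (U U' h h' : C -> C).
Hypothesis HU : airy_solution U U'.
Hypothesis Hh : kernel_solution h h'.
(** Initial values at s = 0, where p = 0 and both arguments vanish: x0 reduces to U(0)^2 and x3 to
    its last term 2 U'(0)^2, each times the Gaussian. *)
Hypothesis h_0 : h 0 = U 0 * U 0.
Hypothesis h'_0 : h' 0 = 2 * (U' 0 * U' 0).

Let u (s t : R) : C := arg_u a b s t.
Let v (s t : R) : C := arg_u b a s t.

Let x0 (s t : R) : C := gauss t * bil U U' 1 0 0 0 (u s t) (v s t).
(* Up to the exponential factor, x3 integrates to the derivative of the integral
   of x0 with respect to p = s^2 a b. *)
Let x3 (s t : R) : C := gauss t *
  bil U U' (- 2 * a ^ 2 * b ^ 2 * RtoC s ^ 4) (- 2 * b ^ 2 * RtoC s ^ 2) (- 2 * a ^ 2 * RtoC s ^ 2) 2 (u s t) (v s t).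

(* R0 and R3 come from removing all powers of t in d/ds x0 and d/ds x3 by means
   of 2 t exp(-t^2) X = exp(-t^2) dX/dt - d/dt (exp(-t^2) X). *)
Let k0 (s t : R) : C := - 2 * (a ^ 3 + b ^ 3) * RtoC s ^ 2.
Let R0 (s t : R) : C := gauss t * bil U U' (k0 s t) (- a) (- b) 0 (u s t) (v s t).
Let l0 (s t : R) : C := (- 8 * a ^ 2 * b ^ 2 * RtoC s ^ 3 * RtoC t + 14 * a ^ 2 * b ^ 2 * (a ^ 3 + b ^ 3) * RtoC s ^ 6).
Let l1 (s t : R) : C := (- 4 * b ^ 2 * RtoC s ^ 1 * RtoC t + b ^ 2 * (10 * a ^ 3 + 6 * b ^ 3) * RtoC s ^ 4).
Let l2 (s t : R) : C := (- 4 * a ^ 2 * RtoC s ^ 1 * RtoC t + a ^ 2 * (6 * a ^ 3 + 10 * b ^ 3) * RtoC s ^ 4).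
Let R3 (s t : R) : C := gauss t * bil U U' (l0 s t) (l1 s t) (l2 s t) (k0 s t) (u s t) (v s t).

Lemma is_Cderive_gauss (t : R) : is_Cderive gauss t (- 2 * RtoC t * gauss t).
Proof.
  eapply is_Cderive_eq.
  - apply (is_Cderive_RtoC (fun t => exp (- t ^ 2))%R t (- (2 * t) * exp (- t ^ 2))%R).
    auto_derive; [exact I |]; change (t * (t * 1))%R with (t ^ 2)%R; ring.
  - unfold gauss. rewrite RtoC_mult, RtoC_opp, RtoC_mult. ring.
Qed.

Lemma Ccontinuous2_gauss (s t : R) : Ccontinuous2 (fun _ t => gauss t) s t.
Proof.
  apply (Ccontinuous2_RtoC (fun _ t => exp (- t ^ 2))%R).
  apply continuity_2d_pt_filterlim.
  apply (filterlim_comp _ _ _ (fun z : R * R => snd z) (fun t => exp (- t ^ 2))%R _ (locally t)).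
  - intros P [eps HP]. exists eps. intros y [_ Hy]. apply HP, Hy.
  - apply continuous_gaussian.
Qed.

Lemma Cderive_arg_s (c d : C) (s t : R) :
  is_Cderive (fun s => arg_u c d s t) s (2 * c * RtoC t - 4 * c * (c ^ 3 + 2 * d ^ 3) * RtoC s ^ 3).
Proof.
  eapply is_Cderive_eq; [unfold arg_u; Cderive_poly|].
  simpl. replace (RtoC (1 + 1 + 1 + 1)) with (RtoC 4) by (f_equal; ring). ring.
Qed.

Lemma Cderive_arg_t (c d : C) (s t : R) :
  is_Cderive (fun t => arg_u c d s t) t (2 * c * RtoC s).
Proof. eapply is_Cderive_eq; [unfold arg_u; Cderive_poly|]. ring. Qed.

(** The t-derivatives of [R0] and, next, [R3] are written out so that their joint continuity can be
    read off the formulas. *)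
Let dR0 (s t : R) : C := gauss t * (- 2 * RtoC t * bil U U' (k0 s t) (- a) (- b) 0 (u s t) (v s t)
  + bil U U' (- a * (2 * a * RtoC s) * u s t + - b * (2 * b * RtoC s) * v s t)
      (k0 s t * (2 * a * RtoC s)) (k0 s t * (2 * b * RtoC s))
      (- a * (2 * b * RtoC s) + - b * (2 * a * RtoC s)) (u s t) (v s t)).

Let dR3 (s t : R) : C := gauss t * (- 2 * RtoC t * bil U U' (l0 s t) (l1 s t) (l2 s t) (k0 s t) (u s t) (v s t)
  + bil U U' (- 8 * a ^ 2 * b ^ 2 * RtoC s ^ 3 + l1 s t * (2 * a * RtoC s) * u s t + l2 s t * (2 * b * RtoC s) * v s t)
      (- 4 * b ^ 2 * RtoC s ^ 1 + l0 s t * (2 * a * RtoC s) + k0 s t * (2 * b * RtoC s) * v s t)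
      (- 4 * a ^ 2 * RtoC s ^ 1 + l0 s t * (2 * b * RtoC s) + k0 s t * (2 * a * RtoC s) * u s t)
      (l1 s t * (2 * b * RtoC s) + l2 s t * (2 * a * RtoC s)) (u s t) (v s t)).

Lemma Cderive_R0 (s t : R) : is_Cderive (fun t => R0 s t) t (dR0 s t).
Proof.
  eapply is_Cderive_eq.
  - unfold R0. apply is_Cderive_mult; [apply is_Cderive_gauss|].
    eapply (is_Cderive_bil U U' (fun t => k0 s t) (fun _ => - a) (fun _ => - b) (fun _ => 0) (u s) (v s) t 0 0 0 0 _ _ HU);
      [exact (is_Cderive_const (k0 s t) t) | apply is_Cderive_const | apply is_Cderive_const | apply is_Cderive_const
      | apply Cderive_arg_t | apply Cderive_arg_t].
  - unfold dR0, bil. ring.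
Qed.

Lemma Cderive_R3 (s t : R) : is_Cderive (fun t => R3 s t) t (dR3 s t).
Proof.
  eapply is_Cderive_eq.
  - unfold R3. apply is_Cderive_mult; [apply is_Cderive_gauss|].
    eapply (is_Cderive_bil U U' (l0 s) (l1 s) (l2 s) (k0 s) (u s) (v s) t
       (- 8 * a ^ 2 * b ^ 2 * RtoC s ^ 3) (- 4 * b ^ 2 * RtoC s ^ 1) (- 4 * a ^ 2 * RtoC s ^ 1) 0 _ _ HU);
      [ | | | | apply Cderive_arg_t | apply Cderive_arg_t].
    + eapply is_Cderive_eq; [unfold l0; Cderive_poly|]. ring.
    + eapply is_Cderive_eq; [unfold l1; Cderive_poly|]. ring.
    + eapply is_Cderive_eq; [unfold l2; Cderive_poly|]. ring.
    + apply is_Cderive_const.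
  - unfold dR3, bil. ring.
Qed.

Let p (s : R) : C := a * b * RtoC s ^ 2.
Let q : C := (a ^ 3 + b ^ 3) ^ 2.
(** The coefficients that make (Om h(p), Om h'(p)) an exact solution with Om = exp(-q s^6/3): [m00]
    is the logarithmic derivative of Om, [m03] is p', and [m30] is 16 p^4 p', from h'' = 16 p^4
    h. *)
Let m00 (s : R) : C := - (2 * q) * RtoC s ^ 5.
Let m03 (s : R) : C := 2 * a * b * RtoC s ^ 1.
Let m30 (s : R) : C := 32 * (a * b) ^ 5 * RtoC s ^ 9.

Let dx0 (s t : R) : C := m00 s * x0 s t + m03 s * x3 s t + dR0 s t.
Let dx3 (s t : R) : C := m30 s * x0 s t + m00 s * x3 s t + dR3 s t.

Lemma Cderive_x0 (s t : R) : is_Cderive (fun s => x0 s t) s (dx0 s t).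
Proof.
  eapply is_Cderive_eq.
  - unfold x0. apply is_Cderive_mult; [apply is_Cderive_const|].
    eapply (is_Cderive_bil U U' (fun _ => 1) (fun _ => 0) (fun _ => 0) (fun _ => 0) (fun s => u s t) (fun s => v s t) s 0 0 0 0 _ _ HU);
      [apply is_Cderive_const | apply is_Cderive_const | apply is_Cderive_const | apply is_Cderive_const
      | apply Cderive_arg_s | apply Cderive_arg_s].
  - unfold dx0, dR0, x0, x3, bil, k0, m00, m03, q.
    (* Abstracting the values of U and U' before unfolding the arguments leaves a polynomial
       identity in which u and v are explicit in a, b, s, t. *)
    generalize (U (u s t)) (U' (u s t)) (U (v s t)) (U' (v s t)) (gauss t). intros.
    unfold u, v, arg_u. ring.
Qed.

Lemma Cderive_x3 (s t : R) : is_Cderive (fun s => x3 s t) s (dx3 s t).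
Proof.
  eapply is_Cderive_eq.
  - unfold x3. apply is_Cderive_mult; [apply is_Cderive_const|].
    eapply (is_Cderive_bil U U' (fun s => - 2 * a ^ 2 * b ^ 2 * RtoC s ^ 4) (fun s => - 2 * b ^ 2 * RtoC s ^ 2)
      (fun s => - 2 * a ^ 2 * RtoC s ^ 2) (fun _ => 2) (fun s => u s t) (fun s => v s t) s
      (- 8 * a ^ 2 * b ^ 2 * RtoC s ^ 3) (- 4 * b ^ 2 * RtoC s) (- 4 * a ^ 2 * RtoC s) 0 _ _ HU);
      [ | | | | apply Cderive_arg_s | apply Cderive_arg_s].
    + eapply is_Cderive_eq; [Cderive_poly|].
      simpl. replace (RtoC (1 + 1 + 1 + 1)) with (RtoC 4) by (f_equal; ring). ring.
    + eapply is_Cderive_eq; [Cderive_poly|].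
      simpl. replace (RtoC (1 + 1)) with (RtoC 2) by (f_equal; ring). ring.
    + eapply is_Cderive_eq; [Cderive_poly|].
      simpl. replace (RtoC (1 + 1)) with (RtoC 2) by (f_equal; ring). ring.
    + apply is_Cderive_const.
  - unfold dx3, dR3, x0, x3, bil, l0, l1, l2, k0, m00, m30, q.
    generalize (U (u s t)) (U' (u s t)) (U (v s t)) (U' (v s t)) (gauss t). intros.
    unfold u, v, arg_u. ring.
Qed.


Lemma Ccontinuous2_arg (c d : C) (s t : R) : Ccontinuous2 (arg_u c d) s t.
Proof. change (Ccontinuous2 (fun s t => arg_u c d s t) s t). unfold arg_u. Ccontinuous_poly. Qed.

Lemma Ccontinuous2_k0 (s t : R) : Ccontinuous2 k0 s t.
Proof. unfold k0. Ccontinuous_poly. Qed.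
Lemma Ccontinuous2_l0 (s t : R) : Ccontinuous2 l0 s t.
Proof. unfold l0. Ccontinuous_poly. Qed.
Lemma Ccontinuous2_l1 (s t : R) : Ccontinuous2 l1 s t.
Proof. unfold l1. Ccontinuous_poly. Qed.
Lemma Ccontinuous2_l2 (s t : R) : Ccontinuous2 l2 s t.
Proof. unfold l2. Ccontinuous_poly. Qed.

Lemma Ccontinuous2_x0 (s t : R) : Ccontinuous2 x0 s t.
Proof.
  apply (Ccontinuous2_mult (fun _ t => gauss t) _ s t (Ccontinuous2_gauss s t)).
  apply (Ccontinuous2_bil U U' (fun _ _ => 1) (fun _ _ => 0) (fun _ _ => 0) (fun _ _ => 0) u v s t HU);
    first [apply Ccontinuous2_const | apply Ccontinuous2_arg].
Qed.

Lemma Ccontinuous2_x3 (s t : R) : Ccontinuous2 x3 s t.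
Proof.
  apply (Ccontinuous2_mult (fun _ t => gauss t) _ s t (Ccontinuous2_gauss s t)).
  apply (Ccontinuous2_bil U U' (fun s _ => - 2 * a ^ 2 * b ^ 2 * RtoC s ^ 4) (fun s _ => - 2 * b ^ 2 * RtoC s ^ 2)
    (fun s _ => - 2 * a ^ 2 * RtoC s ^ 2) (fun _ _ => 2) u v s t HU);
    first [apply Ccontinuous2_arg | Ccontinuous_poly].
Qed.

Lemma Ccontinuous2_dR0 (s t : R) : Ccontinuous2 dR0 s t.
Proof.
  pose proof (Ccontinuous2_arg a b s t : Ccontinuous2 u s t) as Cu.
  pose proof (Ccontinuous2_arg b a s t : Ccontinuous2 v s t) as Cv.
  pose proof (Ccontinuous2_k0 s t) as Ck.
  apply (Ccontinuous2_mult (fun _ t => gauss t) _ s t (Ccontinuous2_gauss s t)).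
  apply Ccontinuous2_plus; [apply Ccontinuous2_mult; [Ccontinuous_poly|]|].
  - apply (Ccontinuous2_bil U U' k0 (fun _ _ => - a) (fun _ _ => - b) (fun _ _ => 0) u v s t HU);
      first [assumption | apply Ccontinuous2_const].
  - apply (Ccontinuous2_bil U U' (fun s t => - a * (2 * a * RtoC s) * u s t + - b * (2 * b * RtoC s) * v s t)
      (fun s t => k0 s t * (2 * a * RtoC s)) (fun s t => k0 s t * (2 * b * RtoC s))
      (fun s t => - a * (2 * b * RtoC s) + - b * (2 * a * RtoC s)) u v s t HU);
      first [assumption | Ccontinuous_poly; assumption].
Qed.

Lemma Ccontinuous2_dR3 (s t : R) : Ccontinuous2 dR3 s t.
Proof.
  pose proof (Ccontinuous2_arg a b s t : Ccontinuous2 u s t) as Cu.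
  pose proof (Ccontinuous2_arg b a s t : Ccontinuous2 v s t) as Cv.
  pose proof (Ccontinuous2_k0 s t) as Ck. pose proof (Ccontinuous2_l0 s t) as C0.
  pose proof (Ccontinuous2_l1 s t) as C1. pose proof (Ccontinuous2_l2 s t) as C2.
  apply (Ccontinuous2_mult (fun _ t => gauss t) _ s t (Ccontinuous2_gauss s t)).
  apply Ccontinuous2_plus; [apply Ccontinuous2_mult; [Ccontinuous_poly|]|].
  - apply (Ccontinuous2_bil U U' l0 l1 l2 k0 u v s t HU); assumption.
  - apply (Ccontinuous2_bil U U'
      (fun s t => - 8 * a ^ 2 * b ^ 2 * RtoC s ^ 3 + l1 s t * (2 * a * RtoC s) * u s t + l2 s t * (2 * b * RtoC s) * v s t)
      (fun s t => - 4 * b ^ 2 * RtoC s ^ 1 + l0 s t * (2 * a * RtoC s) + k0 s t * (2 * b * RtoC s) * v s t)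
      (fun s t => - 4 * a ^ 2 * RtoC s ^ 1 + l0 s t * (2 * b * RtoC s) + k0 s t * (2 * a * RtoC s) * u s t)
      (fun s t => l1 s t * (2 * b * RtoC s) + l2 s t * (2 * a * RtoC s)) u v s t HU);
      first [assumption | Ccontinuous_poly; assumption].
Qed.

Lemma Ccontinuous2_dx0 (s t : R) : Ccontinuous2 dx0 s t.
Proof.
  unfold dx0, m00, m03. apply Ccontinuous2_plus; [|apply Ccontinuous2_dR0].
  apply Ccontinuous2_plus; (apply Ccontinuous2_mult; [Ccontinuous_poly|]); [apply Ccontinuous2_x0 | apply Ccontinuous2_x3].
Qed.

Lemma Ccontinuous2_dx3 (s t : R) : Ccontinuous2 dx3 s t.
Proof.
  unfold dx3, m00, m30. apply Ccontinuous2_plus; [|apply Ccontinuous2_dR3].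
  apply Ccontinuous2_plus; (apply Ccontinuous2_mult; [Ccontinuous_poly|]); [apply Ccontinuous2_x0 | apply Ccontinuous2_x3].
Qed.

Lemma Ccontinuous_plus (f g : R -> C) : Ccontinuous f -> Ccontinuous g -> Ccontinuous (fun t => f t + g t).
Proof.
  intros [F1 F2] [G1 G2]; split; intros t.
  - apply (continuous_plus (V := R_NormedModule) (fun t => Re (f t)) (fun t => Re (g t))); auto.
  - apply (continuous_plus (V := R_NormedModule) (fun t => Im (f t)) (fun t => Im (g t))); auto.
Qed.

Lemma Ccontinuous_const_mult (c : C) (f : R -> C) : Ccontinuous f -> Ccontinuous (fun t => c * f t).
Proof.
  intros [F1 F2]; split; intros t.
  - apply (continuous_minus (V := R_NormedModule) (fun t => Re c * Re (f t))%R (fun t => Im c * Im (f t))%R);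
      apply (continuous_scal_r (V := R_NormedModule)); auto.
  - apply (continuous_plus (V := R_NormedModule) (fun t => Re c * Im (f t))%R (fun t => Im c * Re (f t))%R);
      apply (continuous_scal_r (V := R_NormedModule)); auto.
Qed.

Lemma Cderive_CInt_x0 (l r s : R) :
  is_Cderive (fun s => CInt (x0 s) l r) s
    (m00 s * CInt (x0 s) l r + m03 s * CInt (x3 s) l r + (R0 s r - R0 s l)).
Proof.
  pose proof (Ccontinuous_of_2 x0 s (Ccontinuous2_x0 s)) as C0.
  pose proof (Ccontinuous_of_2 x3 s (Ccontinuous2_x3 s)) as C3.
  pose proof (Ccontinuous_of_2 dR0 s (Ccontinuous2_dR0 s)) as CR.
  eapply is_Cderive_eq.
  - apply (is_Cderive_CInt x0 dx0); [exact Cderive_x0 | exact Ccontinuous2_dx0 | exact Ccontinuous2_x0].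
  - unfold dx0.
    rewrite (CInt_plus (fun t => m00 s * x0 s t + m03 s * x3 s t) (dR0 s)).
    + rewrite (CInt_plus (fun t => m00 s * x0 s t) (fun t => m03 s * x3 s t));
        [| apply Ccontinuous_const_mult; exact C0 | apply Ccontinuous_const_mult; exact C3].
      rewrite (CInt_scal (m00 s) (x0 s)), (CInt_scal (m03 s) (x3 s)) by assumption.
      rewrite (CInt_derive (R0 s) (dR0 s) l r (Cderive_R0 s) CR). reflexivity.
    + apply Ccontinuous_plus; apply Ccontinuous_const_mult; assumption.
    + exact CR.
Qed.

Lemma Cderive_CInt_x3 (l r s : R) :
  is_Cderive (fun s => CInt (x3 s) l r) s
    (m30 s * CInt (x0 s) l r + m00 s * CInt (x3 s) l r + (R3 s r - R3 s l)).
Proof.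
  pose proof (Ccontinuous_of_2 x0 s (Ccontinuous2_x0 s)) as C0.
  pose proof (Ccontinuous_of_2 x3 s (Ccontinuous2_x3 s)) as C3.
  pose proof (Ccontinuous_of_2 dR3 s (Ccontinuous2_dR3 s)) as CR.
  eapply is_Cderive_eq.
  - apply (is_Cderive_CInt x3 dx3); [exact Cderive_x3 | exact Ccontinuous2_dx3 | exact Ccontinuous2_x3].
  - unfold dx3.
    rewrite (CInt_plus (fun t => m30 s * x0 s t + m00 s * x3 s t) (dR3 s)).
    + rewrite (CInt_plus (fun t => m30 s * x0 s t) (fun t => m00 s * x3 s t));
        [| apply Ccontinuous_const_mult; exact C0 | apply Ccontinuous_const_mult; exact C3].
      rewrite (CInt_scal (m30 s) (x0 s)), (CInt_scal (m00 s) (x3 s)) by assumption.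
      rewrite (CInt_derive (R3 s) (dR3 s) l r (Cderive_R3 s) CR). reflexivity.
    + apply Ccontinuous_plus; apply Ccontinuous_const_mult; assumption.
    + exact CR.
Qed.

Let Om (s : R) : C := Cexp (- (q * RtoC s ^ 6) * RtoC (/ 3)).

Lemma Cderive_Om (s : R) : is_Cderive Om s (m00 s * Om s).
Proof.
  eapply is_Cderive_eq; [apply is_Cderive_Cexp; Cderive_poly|].
  unfold m00. change (Cexp (- (q * RtoC s ^ 6) * RtoC (/ 3))) with (Om s). generalize (Om s). intros e.
  replace (RtoC (INR 6)) with (RtoC 6) by (f_equal; simpl; ring).
  assert (H3 : RtoC (/ 3) * 3 = 1) by (rewrite <- RtoC_mult; f_equal; field).
  transitivity (- (2 * q) * RtoC s ^ 5 * e * (RtoC (/ 3) * 3)); [cbn [Cpow]; ring | rewrite H3; ring].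
Qed.

Lemma Cderive_p (s : R) : is_Cderive p s (m03 s).
Proof.
  eapply is_Cderive_eq; [unfold p; Cderive_poly|]. unfold m03.
  replace (RtoC (INR 2)) with (RtoC 2) by (f_equal; simpl; ring). simpl. ring.
Qed.

Lemma bound_arg : exists A B, forall s t, (0 <= s <= 1)%R ->
  (Cmod (u s t) <= A * Rabs t + B)%R /\ (Cmod (v s t) <= A * Rabs t + B)%R.
Proof.
  assert (H : forall c d s t, (0 <= s <= 1)%R ->
    (Cmod (arg_u c d s t) <= Cmod (2 * c) * Rabs t + Cmod (c * (c ^ 3 + 2 * d ^ 3)))%R).
  { intros c d s t Hs. unfold arg_u, Cminus. eapply Rle_trans; [apply Cmod_triangle|].
    rewrite Cmod_opp. apply Rplus_le_compat.
    - rewrite (Cmod_mult (2 * c)). apply Rmult_le_compat_l; [apply Cmod_ge_0|].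
      rewrite Cmod_mult, !Cmod_R, (Rabs_pos_eq s) by lra. pose proof (Rabs_pos t). nra.
    - rewrite (Cmod_mult (c * _)), Cmod_pow, Cmod_R, (Rabs_pos_eq s) by lra.
      rewrite <- (Rmult_1_r (Cmod (c * _))) at 2. apply Rmult_le_compat_l; [apply Cmod_ge_0|].
      rewrite <- (pow1 4). apply pow_incr. lra. }
  exists (Cmod (2 * a) + Cmod (2 * b))%R,
    (Cmod (a * (a ^ 3 + 2 * b ^ 3)) + Cmod (b * (b ^ 3 + 2 * a ^ 3)))%R.
  intros s t Hs. pose proof (Rabs_pos t).
  pose proof (Cmod_ge_0 (2 * a)). pose proof (Cmod_ge_0 (2 * b)).
  pose proof (Cmod_ge_0 (a * (a ^ 3 + 2 * b ^ 3))). pose proof (Cmod_ge_0 (b * (b ^ 3 + 2 * a ^ 3))).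
  split; (eapply Rle_trans; [apply H, Hs | nra]).
Qed.

Lemma gauss_bil_bound (c0 c1 c2 c3 : R -> R -> C) :
  subgaussian c0 -> subgaussian c1 -> subgaussian c2 -> subgaussian c3 ->
  exists K, (0 <= K)%R /\ forall s t, (0 <= s <= 1)%R ->
    (Cmod (gauss t * bil U U' (c0 s t) (c1 s t) (c2 s t) (c3 s t) (u s t) (v s t)) <= K / (1 + t ^ 2))%R.
Proof.
  intros H0 H1 H2 H3. destruct bound_arg as (A & B & HAB).
  apply (subgaussian_gaussian_bound (fun s t => bil U U' (c0 s t) (c1 s t) (c2 s t) (c3 s t) (u s t) (v s t))).
  apply (subgaussian_bil U U' c0 c1 c2 c3 u v A B); try assumption; intros s t Hs; apply (HAB s t Hs).
Qed.

Lemma bound_R0 : exists K, (0 <= K)%R /\ forall s t, (0 <= s <= 1)%R -> (Cmod (R0 s t) <= K / (1 + t ^ 2))%R.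
Proof.
  apply (gauss_bil_bound k0 (fun _ _ => - a) (fun _ _ => - b) (fun _ _ => 0)); unfold k0; subgaussian_poly.
Qed.

Lemma bound_R3 : exists K, (0 <= K)%R /\ forall s t, (0 <= s <= 1)%R -> (Cmod (R3 s t) <= K / (1 + t ^ 2))%R.
Proof.
  apply (gauss_bil_bound l0 l1 l2 k0); unfold l0, l1, l2, k0; subgaussian_poly.
Qed.

Lemma bound_x0 : exists K, (0 <= K)%R /\ forall s t, (0 <= s <= 1)%R -> (Cmod (x0 s t) <= K / (1 + t ^ 2))%R.
Proof.
  apply (gauss_bil_bound (fun _ _ => 1) (fun _ _ => 0) (fun _ _ => 0) (fun _ _ => 0)); subgaussian_poly.
Qed.

Lemma Cmod_mult_pow_le (c : C) (s : R) (n : nat) : (0 <= s <= 1)%R -> (Cmod (c * RtoC s ^ n) <= Cmod c)%R.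
Proof.
  intros Hs. rewrite Cmod_mult, Cmod_pow, Cmod_R, Rabs_pos_eq by lra.
  rewrite <- (Rmult_1_r (Cmod c)) at 2. apply Rmult_le_compat_l; [apply Cmod_ge_0|].
  rewrite <- (pow1 n). apply pow_incr. lra.
Qed.

(** The comparison solution carries the factor G, the Gaussian integral over the same interval
    [l, r], so that both errors vanish at s = 0. Gronwall then sees only R0 and R3 at l and r, which
    are bounded uniformly in s. *)
Lemma CInt_x0_approx : exists K, (0 <= K)%R /\ forall l r,
  (Cmod (CInt (x0 1) l r - CInt gauss l r * (Om 1 * h (a * b))) <= K * (/ (1 + l ^ 2) + / (1 + r ^ 2)))%R.
Proof.
  destruct bound_R0 as (K0 & HK0 & B0). destruct bound_R3 as (K3 & HK3 & B3).
  set (M := (Cmod (- (2 * q)) + Cmod (2 * a * b)%C + Cmod (32 * (a * b) ^ 5)%C)%R).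
  set (c := (2 * exp (4 * M + 1))%R).
  exists (c * (K0 + K3))%R.
  assert (HM1 := Cmod_ge_0 (- (2 * q))). assert (HM2 := Cmod_ge_0 (2 * a * b)). assert (HM3 := Cmod_ge_0 (32 * (a * b) ^ 5)).
  (* Gronwall bounds the square of the error by c eps^2; with c >= 1 this is at most (c eps)^2, so
     the final constant is [c] instead of its square root. *)
  assert (Hc : (1 <= c)%R) by (unfold c; pose proof (exp_ineq1_le (4 * M + 1)); unfold M in *; lra).
  split; [apply Rmult_le_pos; lra|].
  intros l r. set (G := CInt gauss l r). set (eps := ((K0 + K3) * (/ (1 + l ^ 2) + / (1 + r ^ 2)))%R).
  assert (Hl : (0 < / (1 + l ^ 2))%R) by (apply Rinv_0_lt_compat; nra).
  assert (Hr : (0 < / (1 + r ^ 2))%R) by (apply Rinv_0_lt_compat; nra).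
  destruct Hh as [Hh1 Hh2].
  pose proof (gronwall_Clinear_system
    (fun s => CInt (x0 s) l r - G * (Om s * h (p s))) (fun s => CInt (x3 s) l r - G * (Om s * h' (p s)))
    m00 m03 m30 m00 (fun s => R0 s r - R0 s l) (fun s => R3 s r - R3 s l) M eps) as Hg.
  assert (HE : (Cmod (CInt (x0 1) l r - G * (Om 1 * h (p 1))) * Cmod (CInt (x0 1) l r - G * (Om 1 * h (p 1)))
      <= 2 * exp (4 * M + 1) * (eps * eps))%R).
  { apply Hg; clear Hg.
    - intros s. eapply is_Cderive_eq.
      + apply is_Cderive_minus; [apply Cderive_CInt_x0|].
        apply is_Cderive_mult; [apply is_Cderive_const|].
        apply is_Cderive_mult; [apply Cderive_Om | apply Hh1, Cderive_p].
      + cbv beta. ring.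
    - intros s. eapply is_Cderive_eq.
      + apply is_Cderive_minus; [apply Cderive_CInt_x3|].
        apply is_Cderive_mult; [apply is_Cderive_const|].
        apply is_Cderive_mult; [apply Cderive_Om | apply Hh2, Cderive_p].
      + cbv beta. unfold m30, m03. generalize (h (p s)) (h' (p s)). intros. unfold p. ring.
    - intros s Hs.
      assert (Heps : forall (R : R -> R -> C) K, (0 <= K)%R -> (K <= K0 + K3)%R ->
         (forall s t, (0 <= s <= 1)%R -> (Cmod (R s t) <= K / (1 + t ^ 2))%R) -> (Cmod (R s r - R s l)%C <= eps)%R).
      { intros R K HK HKK HB. unfold Cminus. eapply Rle_trans; [apply Cmod_triangle|]. rewrite Cmod_opp.
        pose proof (HB s r Hs) as Br. pose proof (HB s l Hs) as Bl. unfold Rdiv in Br, Bl.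
        unfold eps. assert (K * / (1 + l ^ 2) <= (K0 + K3) * / (1 + l ^ 2))%R by (apply Rmult_le_compat_r; lra).
        assert (K * / (1 + r ^ 2) <= (K0 + K3) * / (1 + r ^ 2))%R by (apply Rmult_le_compat_r; lra). lra. }
      pose proof (Cmod_mult_pow_le (- (2 * q)) s 5 Hs). pose proof (Cmod_mult_pow_le (2 * a * b) s 1 Hs).
      pose proof (Cmod_mult_pow_le (32 * (a * b) ^ 5) s 9 Hs).
      unfold M, m00, m03, m30. repeat split; try lra.
      + apply (Heps R0 K0); [exact HK0 | lra | exact B0].
      + apply (Heps R3 K3); [exact HK3 | lra | exact B3].
    - unfold p. replace (a * b * RtoC 0 ^ 2) with (RtoC 0) by (simpl; ring). rewrite h_0.
      replace (Om 0) with (RtoC 1).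
      2:{ unfold Om. rewrite <- Cexp_0. f_equal. simpl. ring. }
      rewrite (CInt_ext (x0 0) (fun t => (U 0 * U 0) * gauss t)).
      + rewrite CInt_scal; [unfold G; ring|]. apply (Ccontinuous_of_2 (fun _ t => gauss t) 0). apply Ccontinuous2_gauss.
      + intros t. unfold x0, bil, u, v, arg_u.
        replace (2 * a * (RtoC 0 * RtoC t) - a * (a ^ 3 + 2 * b ^ 3) * RtoC 0 ^ 4) with (RtoC 0) by (simpl; ring).
        replace (2 * b * (RtoC 0 * RtoC t) - b * (b ^ 3 + 2 * a ^ 3) * RtoC 0 ^ 4) with (RtoC 0) by (simpl; ring).
        ring.
    - unfold p. replace (a * b * RtoC 0 ^ 2) with (RtoC 0) by (simpl; ring). rewrite h'_0.
      replace (Om 0) with (RtoC 1).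
      2:{ unfold Om. rewrite <- Cexp_0. f_equal. simpl. ring. }
      rewrite (CInt_ext (x3 0) (fun t => (2 * (U' 0 * U' 0)) * gauss t)).
      + rewrite CInt_scal; [unfold G; ring|]. apply (Ccontinuous_of_2 (fun _ t => gauss t) 0). apply Ccontinuous2_gauss.
      + intros t. unfold x3, bil, u, v, arg_u.
        replace (2 * a * (RtoC 0 * RtoC t) - a * (a ^ 3 + 2 * b ^ 3) * RtoC 0 ^ 4) with (RtoC 0) by (simpl; ring).
        replace (2 * b * (RtoC 0 * RtoC t) - b * (b ^ 3 + 2 * a ^ 3) * RtoC 0 ^ 4) with (RtoC 0) by (simpl; ring).
        simpl. ring. }
  fold c in HE. replace (p 1) with (a * b) in HE by (unfold p; simpl; ring).
  assert (Heps : (0 <= eps)%R) by (unfold eps; apply Rmult_le_pos; lra).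
  rewrite Rmult_assoc. fold eps.
  apply Rsqr_incr_0_var; [|apply Rmult_le_pos; lra]. unfold Rsqr.
  eapply Rle_trans; [exact HE|].
  replace (c * eps * (c * eps))%R with (c * (c * (eps * eps)))%R by ring.
  apply Rmult_le_compat_l; [lra|]. assert (0 <= eps * eps)%R by (apply Rmult_le_pos; exact Heps). nra.
Qed.

End Deformation.

(** * Passage to the integral over the real line *)

Lemma is_RInt_gen_C_intro (f : R -> C) (L : C) : Ccontinuous f ->
  (forall eps, (0 < eps)%R -> exists T, forall l r, (l < - T)%R -> (T < r)%R -> (Cmod (CInt f l r - L) < eps)%R) ->
  is_RInt_gen (V := C_R_NormedModule) f (Rbar_locally m_infty) (Rbar_locally p_infty) L.
Proof.
  intros Hf H Q [eps HQ]. destruct (H eps (cond_pos eps)) as [T HT].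
  apply (Filter_prod _ _ _ (fun l => (l < - T)%R) (fun r => (T < r)%R)).
  - exists (- T)%R. auto.
  - exists T. auto.
  - intros l r Hl Hr. exists (CInt f l r). split; [apply is_RInt_CInt, Hf|].
    apply HQ. specialize (HT l r Hl Hr). split.
    + change (Rabs (Re (CInt f l r - L)) < eps)%R. eapply Rle_lt_trans; [apply re_le_Cmod | exact HT].
    + change (Rabs (Im (CInt f l r - L)) < eps)%R. eapply Rle_lt_trans; [apply im_le_Cmod | exact HT].
Qed.

Lemma CInt_gauss (l r : R) : CInt gauss l r = RtoC (RInt (fun t => exp (- t ^ 2)) l r).
Proof.
  unfold CInt, RtoC. f_equal.
  rewrite (RInt_ext _ (fun _ => 0%R)) by reflexivity.
  rewrite RInt_const. unfold scal; simpl; unfold mult; simpl. ring.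
Qed.

Lemma RInt_gaussian_limit (eps : R) : (0 < eps)%R -> exists T, forall l r, (l < - T)%R -> (T < r)%R ->
  (Rabs (RInt (fun t => exp (- t ^ 2)) l r - Gamma (1 / 2)) < eps)%R.
Proof.
  intros He. assert (He2 : (0 < eps / 2)%R) by lra.
  destruct (is_lim_RInt_gaussian _ (locally_ball (Gamma (1 / 2) / 2)%R (mkposreal _ He2))) as [T HT].
  exists T. intros l r Hl Hr.
  assert (H1 := HT (- l)%R ltac:(lra)). assert (H2 := HT r Hr).
  change (Rabs (RInt (fun t => exp (- t ^ 2)) 0 (- l) - Gamma (1 / 2) / 2) < eps / 2)%R in H1.
  change (Rabs (RInt (fun t => exp (- t ^ 2)) 0 r - Gamma (1 / 2) / 2) < eps / 2)%R in H2.
  replace l with (- - l)%R by ring. rewrite RInt_gaussian_symmetric.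
  set (A := RInt _ 0 (- l)) in *. set (B := RInt _ 0 r) in *.
  replace (A + B - Gamma (1 / 2))%R with ((A - Gamma (1 / 2) / 2) + (B - Gamma (1 / 2) / 2))%R by field.
  eapply Rle_lt_trans; [apply Rabs_triang | lra].
Qed.

Lemma inv_sqr_limit (K eps : R) : (0 <= K)%R -> (0 < eps)%R -> exists T, (0 < T)%R /\
  forall x, (T < Rabs x)%R -> (K * / (1 + x ^ 2) < eps)%R.
Proof.
  intros HK He. exists (K / eps + 1)%R.
  assert (H0 : (0 <= K / eps)%R) by (apply Rmult_le_pos; [exact HK | apply Rlt_le, Rinv_0_lt_compat, He]).
  split; [lra|]. intros x Hx. rewrite <- (pow2_abs x). set (y := Rabs x) in *.
  apply Rlt_div_l; [nra|].
  assert (E : (eps * (K / eps) = K)%R) by (field; lra).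
  assert (Hlt : (K / eps < 1 + y ^ 2)%R) by nra.
  apply (Rmult_lt_compat_l eps) in Hlt; [|exact He]. lra.
Qed.

Definition pair_integrand (U : C -> C) (a b : C) (t : R) : C :=
  gauss t * (U (arg_u a b 1 t) * U (arg_u b a 1 t)).

Lemma Ccontinuous_ext (f g : R -> C) : (forall t, f t = g t) -> Ccontinuous f -> Ccontinuous g.
Proof.
  intros E [H1 H2]; split; intros t.
  - apply continuous_ext with (2 := H1 t). intros x; now rewrite E.
  - apply continuous_ext with (2 := H2 t). intros x; now rewrite E.
Qed.

(** The boundary error tends to 0 while the truncated Gaussian tends to Gamma(1/2). Continuity and
    the decay bound accompany the value because the final linear combination must be shown
    absolutely integrable. *)
Lemma pair_integral (a b : C) (U U' h h' : C -> C) :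
  airy_solution U U' -> kernel_solution h h' -> h 0 = U 0 * U 0 -> h' 0 = 2 * (U' 0 * U' 0) ->
  Ccontinuous (pair_integrand U a b) /\
  (exists K, forall t, (Cmod (pair_integrand U a b t) <= K * / (1 + t ^ 2))%R) /\
  is_RInt_gen (V := C_R_NormedModule) (pair_integrand U a b) (Rbar_locally m_infty) (Rbar_locally p_infty)
    (RtoC (Gamma (1 / 2)) * (Cexp (- ((a ^ 3 + b ^ 3) ^ 2 / 3)) * h (a * b))).
Proof.
  intros HU Hh H0 H1.
  assert (E : forall t, gauss t * bil U U' 1 0 0 0 (arg_u a b 1 t) (arg_u b a 1 t) = pair_integrand U a b t).
  { intros t. unfold pair_integrand, bil. ring. }
  assert (HC : Ccontinuous (pair_integrand U a b)).
  { apply (Ccontinuous_ext _ _ E). apply (Ccontinuous_of_2 _ 1 (fun t => Ccontinuous2_x0 a b U U' HU 1 t)). }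
  split; [exact HC | split].
  - destruct (bound_x0 a b U U' HU) as (K & _ & HK). exists K. intros t. rewrite <- E. apply HK. lra.
  - apply is_RInt_gen_C_intro; [exact HC|]. intros eps He.
    destruct (CInt_x0_approx a b U U' h h' HU Hh H0 H1) as (K & HK & HA).
    set (L := Cexp (- ((a ^ 3 + b ^ 3) ^ 2 / 3)) * h (a * b)).
    assert (HL : Cexp (- ((a ^ 3 + b ^ 3) ^ 2 * RtoC 1 ^ 6) * RtoC (/ 3)) * h (a * b) = L).
    { unfold L. do 2 f_equal. rewrite RtoC_inv by lra. simpl. unfold Cdiv. ring. }
    (* Error budget: eps/4 for each of the two ends, and eps/2 for replacing the truncated Gaussian
       by Gamma(1/2). *)
    destruct (inv_sqr_limit K (eps / 4) HK ltac:(lra)) as (T1 & HT1 & B1).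
    assert (Hd : (0 < eps / (2 * (Cmod L + 1)))%R).
    { apply Rdiv_lt_0_compat; [exact He|]. pose proof (Cmod_ge_0 L). lra. }
    destruct (RInt_gaussian_limit _ Hd) as (T2 & B2).
    exists (Rmax T1 T2). intros l r Hl Hr.
    pose proof (Rmax_l T1 T2). pose proof (Rmax_r T1 T2).
    specialize (HA l r). specialize (B2 l r ltac:(lra) ltac:(lra)).
    assert (C1 := B1 l ltac:(rewrite Rabs_left; lra)). assert (C2 := B1 r ltac:(rewrite Rabs_pos_eq; lra)).
    rewrite HL in HA. rewrite (CInt_ext _ _ l r E), CInt_gauss in HA.
    set (g := RInt (fun t => exp (- t ^ 2)) l r) in *. set (Z := CInt (pair_integrand U a b) l r) in *.
    replace (Z - RtoC (Gamma (1 / 2)) * L) with ((Z - RtoC g * L) + RtoC (g - Gamma (1 / 2)) * L)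
      by (rewrite RtoC_minus; ring).
    eapply Rle_lt_trans; [apply Cmod_triangle|]. rewrite Cmod_mult, Cmod_R.
    assert (HB : (Rabs (g - Gamma (1 / 2)) * Cmod L <= eps / 2)%R).
    { pose proof (Cmod_ge_0 L).
      apply Rle_trans with (eps / (2 * (Cmod L + 1)) * (Cmod L + 1))%R.
      - apply Rmult_le_compat; [apply Rabs_pos | assumption | lra | lra].
      - right. field. lra. }
    lra.
Qed.

(** Comparison with the derivative of K atan bounds every partial integral by K pi. *)
Lemma ex_RInt_gen_Cmod (f : R -> C) (K : R) : Ccontinuous f ->
  (forall t, (Cmod (f t) <= K * / (1 + t ^ 2))%R) ->
  ex_RInt_gen (V := R_NormedModule) (fun t => Cmod (f t)) (Rbar_locally m_infty) (Rbar_locally p_infty).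
Proof.
  intros [F1 F2] HK.
  assert (K0 : (0 <= K)%R).
  { pose proof (HK 0%R) as H. pose proof (Cmod_ge_0 (f 0%R)). replace (/ (1 + 0 ^ 2))%R with 1%R in H by field. lra. }
  assert (HC : forall t, continuous (fun t => Cmod (f t)) t).
  { intros t. unfold Cmod. apply (continuous_comp (fun t => (fst (f t) ^ 2 + snd (f t) ^ 2)%R) sqrt).
    - simpl. assert (Hsq : forall g : R -> R, continuous g t -> continuous (fun t => (g t * (g t * 1))%R) t).
      { intros g Hg. apply (continuous_mult (K := R_AbsRing) g (fun t => (g t * 1)%R)); [exact Hg|].
        apply (continuous_mult (K := R_AbsRing) g (fun _ => 1%R)); [exact Hg | apply continuous_const]. }
      apply (continuous_plus (V := R_NormedModule)); apply Hsq; [apply F1 | apply F2].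
    - apply continuity_pt_filterlim, continuity_pt_sqrt. nra. }
  apply (ex_RInt_gen_bounded _ _ (fun _ => True) _ (K * PI)); try typeclasses eauto.
  - auto.
  - exists 0%R. exact I.
  - intros c _. exists c. intros y Hy. split; [exact I | lra].
  - intros c _. exists c. intros y Hy. split; [exact I | lra].
  - intros x _. apply Cmod_ge_0.
  - intros x _. apply HC.
  - intros x y _ _ Hxy.
    assert (HI : is_RInt (fun t => / (1 + t ^ 2))%R x y (atan y - atan x)%R).
    { apply (is_RInt_derive (V := R_CompleteNormedModule)); intros z _.
      - apply is_derive_Reals, derivable_pt_lim_atan.
      - apply (ex_derive_continuous (V := R_NormedModule)). auto_derive. nra. }
    apply (is_RInt_scal (V := R_NormedModule) _ _ _ K) in HI.
    apply Rle_trans with (RInt (fun t => K * / (1 + t ^ 2))%R x y).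
    + apply RInt_le; [exact Hxy | apply ex_RInt_of_continuous, HC | eexists; exact HI |].
      intros z _. apply HK.
    + rewrite (is_RInt_unique (V := R_CompleteNormedModule) (fun t => K * / (1 + t ^ 2))%R _ _ _ HI).
      change (K * (atan y - atan x) <= K * PI)%R. apply Rmult_le_compat_l; [exact K0|].
      pose proof (atan_bound x). pose proof (atan_bound y). lra.
Qed.

Lemma C_R_scal (k : R) (z : C) : scal (V := C_R_NormedModule) k z = RtoC k * z.
Proof. destruct z as [x y]. unfold scal; simpl; unfold prod_scal, Cmult; simpl. f_equal; unfold scal; simpl; unfold mult; simpl; ring. Qed.

Lemma kernel_solution_scal (k : C) (h h' : C -> C) :
  kernel_solution h h' -> kernel_solution (fun z => k * h z) (fun z => k * h' z).
Proof.
  intros [H1 H2]. split; (eapply holo_eq; [apply holo_mult; [apply holo_const | eassumption]|]);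
    intros z; cbv beta; ring.
Qed.

Lemma Airy_bilinear (u v : C) : Ai u * Bi v + Ai v * Bi u =
  RtoC (2 * (sqrt 3 * airy_c1 ^ 2)) * (airy_f u * airy_f v) - RtoC (2 * (sqrt 3 * airy_c2 ^ 2)) * (airy_g u * airy_g v).
Proof. unfold Ai, Bi. rewrite !RtoC_mult, !RtoC_pow. ring. Qed.

Theorem mainTheorem4 (a b : C) :
  is_integral_R
    (fun t : R =>
       let u := 2 * a * t - a * (a ^ 3 + 2 * b ^ 3) in
       let v := 2 * b * t - b * (2 * a ^ 3 + b ^ 3) in
       exp (- t ^ 2) * (Ai u * Bi v + Ai v * Bi u))
    (2 / Rpower 12 (1 / 3) * Cexp (- ((a ^ 3 + b ^ 3) ^ 2 / 3)) *
       (1 / Gamma (5 / 6) * hyp0F1 (5 / 6) (4 / 9 * (a * b) ^ 6)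
        - 2 * a * b / (Rpower 12 (1 / 3) * Gamma (7 / 6))
          * hyp0F1 (7 / 6) (4 / 9 * (a * b) ^ 6))).
Proof.
  assert (Zy : forall c n, (/ 2 <= c)%R -> y0F1 c (0 ^ S n * RtoC (1 / 9)) = 1 /\ y0F1 c (0 ^ S n * RtoC (4 / 9)) = 1).
  { intros c n Hc. simpl. split; [rewrite <- (y0F1_0 c Hc) | rewrite <- (y0F1_0 c Hc)]; f_equal; ring. }
  destruct (pair_integral a b airy_f airy_f' kernel_f kernel_f' airy_solution_f kernel_solution_f) as (Cf & [Kf Bf] & If).
  { rewrite airy_f_0F1. unfold kernel_f. destruct (Zy (2 / 3)%R 2%nat ltac:(lra)) as [-> _].
    destruct (Zy (5 / 6)%R 5%nat ltac:(lra)) as [_ ->]. ring. }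
  { unfold kernel_f', airy_f'. simpl. ring. }
  (* The factor 2 is forced by h'(0) = 2 g'(0)^2 = 2, while [kernel_g'] is 1 at 0. It becomes the 2
     in the coefficient 2ab of the theorem. *)
  destruct (pair_integral a b airy_g airy_g' (fun z => 2 * kernel_g z) (fun z => 2 * kernel_g' z)
     airy_solution_g (kernel_solution_scal 2 _ _ kernel_solution_g)) as (Cg & [Kg Bg] & Ig).
  { rewrite airy_g_0F1. unfold kernel_g. ring. }
  { unfold kernel_g', airy_g'. destruct (Zy (4 / 3)%R 2%nat ltac:(lra)) as [-> _].
    destruct (Zy (7 / 6)%R 5%nat ltac:(lra)) as [_ ->]. simpl. ring. }
  set (k1 := (2 * (sqrt 3 * airy_c1 ^ 2))%R). set (k2 := (2 * (sqrt 3 * airy_c2 ^ 2))%R).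
  assert (E : forall t : R, RtoC k1 * pair_integrand airy_f a b t + RtoC (- k2) * pair_integrand airy_g a b t
    = (fun t : R =>
       let u := 2 * a * t - a * (a ^ 3 + 2 * b ^ 3) in
       let v := 2 * b * t - b * (2 * a ^ 3 + b ^ 3) in
       exp (- t ^ 2) * (Ai u * Bi v + Ai v * Bi u)) t).
  { intros t. cbv zeta. rewrite Airy_bilinear. fold k1 k2. unfold pair_integrand, gauss.
    replace (arg_u a b 1 t) with (2 * a * t - a * (a ^ 3 + 2 * b ^ 3)) by (unfold arg_u; simpl; ring).
    replace (arg_u b a 1 t) with (2 * b * t - b * (2 * a ^ 3 + b ^ 3)) by (unfold arg_u; simpl; ring).
    rewrite RtoC_opp. ring. }
  assert (CF : Ccontinuous (fun t => RtoC k1 * pair_integrand airy_f a b t + RtoC (- k2) * pair_integrand airy_g a b t)).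
  { apply Ccontinuous_plus; apply Ccontinuous_const_mult; assumption. }
  split.
  - apply ex_RInt_gen_Cmod with (K := (Rabs k1 * Kf + Rabs (- k2) * Kg)%R).
    + exact (Ccontinuous_ext _ _ E CF).
    + intros t. rewrite <- E. eapply Rle_trans; [apply Cmod_triangle|]. rewrite !Cmod_mult, !Cmod_R.
      rewrite Rmult_plus_distr_r, !Rmult_assoc.
      apply Rplus_le_compat; apply Rmult_le_compat_l; try apply Rabs_pos; [apply Bf | apply Bg].
  - pose proof (is_RInt_gen_plus (V := C_R_NormedModule) _ _ _ _
      (is_RInt_gen_scal (V := C_R_NormedModule) _ k1 _ If) (is_RInt_gen_scal (V := C_R_NormedModule) _ (- k2)%R _ Ig)) as HI.
    rewrite !C_R_scal in HI.
    set (V1 := hyp0F1 (5 / 6) (4 / 9 * (a * b) ^ 6)). set (V2 := hyp0F1 (7 / 6) (4 / 9 * (a * b) ^ 6)).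
    assert (Hk1 : kernel_f (a * b) = V1).
    { unfold kernel_f, y0F1, V1. f_equal; rewrite RtoC_div by lra; [reflexivity | ring]. }
    assert (Hk2 : kernel_g (a * b) = a * b * V2).
    { unfold kernel_g, y0F1, V2. do 2 f_equal; rewrite RtoC_div by lra; [reflexivity | ring]. }
    rewrite Hk1, Hk2 in HI.
    destruct airy_constants as [A1 A2].
    assert (G5 : (0 < Gamma (5 / 6))%R) by (apply Gamma_pos_unit; lra).
    assert (G7 : (0 < Gamma (7 / 6))%R) by (rewrite Gamma_7_6; pose proof (Gamma_pos_unit (1 / 6) ltac:(lra)); lra).
    pose proof (Rpower_base_pos 12 (1 / 3)) as P12.
    set (e := Cexp (- ((a ^ 3 + b ^ 3) ^ 2 / 3))) in *.
    replace (2 / Rpower 12 (1 / 3) * e * (1 / Gamma (5 / 6) * V1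
        - 2 * a * b / (Rpower 12 (1 / 3) * Gamma (7 / 6)) * V2))
      with (plus (G := C_R_NormedModule) (RtoC k1 * (RtoC (Gamma (1 / 2)) * (e * V1)))
             (RtoC (- k2) * (RtoC (Gamma (1 / 2)) * (e * (2 * (a * b * V2)))))).
    + refine (is_RInt_gen_ext (V := C_R_NormedModule) _ _ _ _ HI).
      apply filter_forall. intros lr t _. rewrite !C_R_scal. apply E.
    + change (RtoC k1 * (RtoC (Gamma (1 / 2)) * (e * V1)) + RtoC (- k2) * (RtoC (Gamma (1 / 2)) * (e * (2 * (a * b * V2))))
        = 2 / Rpower 12 (1 / 3) * e * (1 / Gamma (5 / 6) * V1
        - 2 * a * b / (Rpower 12 (1 / 3) * Gamma (7 / 6)) * V2)).
      (* Gamma(1/2) is moved next to the squared Airy constants, which is the form in which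
         [airy_constants] evaluates them. *)
      transitivity (RtoC (2 * (sqrt 3 * airy_c1 ^ 2 * Gamma (1 / 2))) * e * V1
         - RtoC (2 * (sqrt 3 * airy_c2 ^ 2 * Gamma (1 / 2))) * e * (2 * a * b * V2)).
      { unfold k1, k2. rewrite RtoC_opp, !RtoC_mult. ring. }
      rewrite A1, A2. set (g5 := Gamma (5 / 6)) in *. set (g7 := Gamma (7 / 6)) in *. set (c12 := Rpower 12 (1 / 3)) in *.
      replace (c12 ^ 2)%R with (c12 * c12)%R by ring.
      rewrite !RtoC_mult, !RtoC_div by (apply Rgt_not_eq; repeat apply Rmult_lt_0_compat; assumption).
      rewrite !RtoC_mult. field.
      repeat split; intros Hz; apply RtoC_inj in Hz; lra.
Qed.
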